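(* Let $a_1,a_2,b\in\mathbb{Q}$ with $a_1-a_2\notin\mathbb{Z}$, $a_1>-1$, $a_2>-1$, $b>0$. For $n=0,1,2,\ldots$ define $$q_n(a_1,a_2,b)=\sum_{k=0}^n\binom{n+a_1-a_2}{k}\binom{n+a_2-a_1}{n-k}(a_2+1)_{n+k}\,b^{n-k},$$ and let $q_n(a_2,a_1,b)$ be the same expression with the roles of $a_1$ and $a_2$ exchanged. Then for every $n\ge 0$ $$\mu_{a_2-a_1}^n\,\mu_{a_2}^{2n}\,q_n(a_1,a_2,b)\in n!\,\mathbb{Z}[b],$$ and the following asymptotic formulas hold as $n\to\infty$: $$q_n(a_1,a_2,b)\,\frac{\Gamma(a_2+1)/b^{a_2}}{\Gamma(a_1+1)/b^{a_1}}-q_n(a_2,a_1,b)=(2n)!\,\frac{e^{-\sqrt{2bn}}}{n^{1/4-(a_1+a_2)/2}}\bigl(c_1+O(n^{-1/2})\bigr),$$ $$q_n(a_1,a_2,b)=(2n)!\,\frac{e^{\sqrt{2bn}}}{n^{1/4-(a_1+a_2)/2}}\bigl(c_2+O(n^{-1/2})\bigr),$$ where $$c_1=\frac{2\sin(\pi(a_2-a_1))\,\Gamma(a_2+1)}{b^{a_2-a_1}\,\Gamma(a_1+1)}\,c_2,\qquad c_2=\frac{2^{(a_1+a_2)/2-3/4}}{b^{1/4+(a_1-a_2)/2}\,e^{3b/8}\,\sqrt{\pi}\,\Gamma(a_2+1)}.$$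
   Context: $(a)_0=1$ and $(a)_m=a(a+1)\cdots(a+m-1)$ for $m\ge1$ is the Pochhammer symbol. For real $\alpha$ and an integer $k\ge 0$, $\binom{\alpha}{k}=\alpha(\alpha-1)\cdots(\alpha-k+1)/k!$. For $a\in\mathbb{Q}$ let $\operatorname{den} a\in\mathbb{N}$ be the denominator of $a$ written in lowest terms, and for an integer $n\ge0$ put $$\mu_a^n=(\operatorname{den} a)^n\prod_{p\mid \operatorname{den} a}p^{[n/(p-1)]},$$ the product being over primes $p$ dividing $\operatorname{den} a$ and $[\cdot]$ being the integer part ($n$ in $\mu_a^n$ is a superscript index, not a power). $\mathbb{Z}[b]$ denotes polynomial expressions in $b$ with integer coefficients. The implied constants in $O(\cdot)$ may depend on $a_1,a_2,b$. *)

(* Defs.v *)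
From HB Require Import structures.
From mathcomp Require Import all_boot all_order all_algebra.
From mathcomp Require Import all_classical all_reals all_analysis.

Set Implicit Arguments.
Unset Strict Implicit.
Unset Printing Implicit Defensive.

Import Order.TTheory GRing.Theory Num.Theory.
Import numFieldNormedType.Exports.

Local Open Scope classical_set_scope.
Local Open Scope ring_scope.

Definition pochhammer (a : rat) (m : nat) : rat :=
  \prod_(i < m) (a + i%:R).

Definition gbinom (a : rat) (k : nat) : rat :=
  (\prod_(i < k) (a - i%:R)) / (k`!)%:R.

Definition den (a : rat) : nat := `|denq a|%N.

(* The second argument of mu is a superscript index, not an exponent. *)
Definition mu (a : rat) (n : nat) : nat :=
  (den a ^ n * \prod_(p <- primes (den a)) p ^ (n %/ p.-1))%N.

Definition q (n : nat) (a1 a2 b : rat) : rat :=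
  \sum_(k < n.+1)
    gbinom (n%:R + a1 - a2) k * gbinom (n%:R + a2 - a1) (n - k)
    * pochhammer (a2 + 1) (n + k) * b ^+ (n - k).

(* Euler's integral. The integral is the real-valued one, whose value is junk
   when the Lebesgue integral is infinite, so this is the Gamma function only
   for x > 0. *)
Definition Gamma (R : realType) (x : R) : R :=
  \int[lebesgue_measure]_(t in `]0, +oo[%classic) (t `^ (x - 1) * expR (- t)).

Definition c2 (R : realType) (a1 a2 b : R) : R :=
  2 `^ ((a1 + a2) / 2 - 3 / 4)
  / (b `^ (1 / 4 + (a1 - a2) / 2) * expR (3 * b / 8) * Num.sqrt pi
     * Gamma (a2 + 1)).

Definition c1 (R : realType) (a1 a2 b : R) : R :=
  2 * sin (pi * (a2 - a1)) * Gamma (a2 + 1)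
  / (b `^ (a2 - a1) * Gamma (a1 + 1)) * c2 a1 a2 b.

(* Main.v *)
(* Integrality is termwise: mu_a^k binom(a, k) is an integer for rational a, and
   (a + 1)_(n + k) is (n + k)! times such a binomial.

   Asymptotics of q_n: with z = sqrt(2 b n) the term of index j = n - k is a common
   factor times z^(2j) / (2j)! times a ratio that is constant up to a correction linear in
   2 j (2 j - 1) / z^2 - 1. The weights z^(2j) / (2j)! sum to cosh z and concentrate
   around j = z / 2, and the linear correction averages out.

   The linear form: let al = a1 - a2 and
     K(t) = int_1^t (y - 1)^n (t / y - 1)^n y^(n + a2) (t / y)^(n + a1) dy / y.
   Expanding the powers and decomposing n! / (X (X - 1) ... (X - n)) into partial fractions,
   K(t) is a polynomial times t^a2 plus a polynomial times t^a1, with the coefficients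
   of q_n. Hence the integral of e^(- b t) K(t) over t > 0 is, up to an explicit
   factor, Gamma(a2 + 1) b^(- a2) q_n(a1, a2) - Gamma(a1 + 1) b^(- a1) q_n(a2, a1).
   The part t < 1 is bounded, and the part t > 1 is the double integral of
   e^(- b y z) (y - 1)^n (z - 1)^n y^(n + a2) z^(n + a1) over y, z > 1. Its inner integral is a
   perturbed Gamma integral, and the outer one is then concentrated at y = sqrt(2 n / b),
   where b y / 2 + n / y is minimal and equal to sqrt(2 b n). *)
Require Import Defs.
From mathcomp Require Import all_boot all_order all_algebra.
From mathcomp Require Import all_classical all_reals all_analysis.
From mathcomp Require Import measurable_realfun ring lra zify.

Set Implicit Arguments.
Unset Strict Implicit.
Unset Printing Implicit Defensive.

Import Order.TTheory GRing.Theory Num.Theory.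
Import numFieldNormedType.Exports.

Local Open Scope classical_set_scope.
Local Open Scope ring_scope.

(** * Integrality *)

(** The two products in the linear form have size e^(sqrt(2 b n)) while their difference has size
    e^(-sqrt(2 b n)), so it cannot be found by subtracting asymptotic formulas; hence the detour
    through an integral of a positive function. The bounded part t < 1 is harmless because the main
    part is (2 n)! b^(-2 n) up to e^(O(sqrt n)). The sine enters because the common factor of the
    kernel coefficients is the inverse of al * prod (1 - al^2 / m^2). Around its peak the weight
    z^(2j) / (2j)! has relative width z^(-1/2), that is n^(-1/4). An error of order n^(-1/2)
    therefore requires the linear correction to cancel, and 2 j (2 j - 1) / z^2 is chosen because
    its weighted sum telescopes. In the outer integral the linear term is removed by the symmetry x
    -> -x. The exponent 3 b / 8 has two origins: 3 j^2 / (4 n) at j^2 = b n / 2 for q_n, and b / 8 +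
    b / 4 for the linear form, from the second-order corrections of the inner integral and of (1 - 1
    / y)^n. *)

Lemma logn_fact_le (p n : nat) : prime p -> (logn p n`! <= n %/ p.-1)%N.
Proof.
move=> pp; have p1 := prime_gt1 pp.
rewrite logn_fact // leq_divRL; last by rewrite -subn1 subn_gt0.
(* Strengthened for the induction: keeping the remainder [n %/ p ^ K] reduces each step to
   [m %/ p * p <= m] with [m = n %/ p ^ K]. *)
suff H K : ((\sum_(1 <= k < K.+1) n %/ p ^ k) * p.-1 + n %/ p ^ K <= n)%N.
  exact: leq_trans (leq_addr _ _) (H n).
elim: K => [|K IH]; first by rewrite big_geq // expn0 divn1.
rewrite big_nat_recr //= mulnDl.
apply: leq_trans IH; rewrite -addnA leq_add2l expnSr divnMA.
rewrite -mulnSr prednK ?prime_gt0 //; exact: leq_trunc_div.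
Qed.

Lemma eqz_mod_prod (k : nat) (F G : nat -> int) (d : int) :
  (forall i, (F i = G i %[mod d])%Z) ->
  (\prod_(i < k) F i = \prod_(i < k) G i %[mod d])%Z.
Proof.
move=> H; elim: k => [|k IH]; first by rewrite !big_ord0.
by rewrite !big_ord_recr /= -modzMm IH H modzMm.
Qed.

Lemma prod_subr_ffact (m k : nat) :
  \prod_(i < k) (m%:Z - i%:Z) = (m ^_ k)%:Z.
Proof.
elim: k => [|k IH]; first by rewrite big_ord0.
rewrite big_ord_recr /= IH ffactnSr PoszM.
have [le_km|lt_mk] := leqP k m; first by rewrite subzn.
by rewrite ffact_small // !mul0r.
Qed.

(** Split [k!] into its part at the primes of [d] and its part [B] prime to [d]. The first divides
    the product of prime powers by [logn_fact_le]. Modulo [B] the step [d] is invertible, so up to a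
    unit the progression is a product of [k] consecutive integers, which [k!] divides. *)
Lemma fact_dvd_prod_arith (r : int) (d k : nat) : (0 < d)%N ->
  (k`!%:Z %| (\prod_(p <- primes d) p ^ (k %/ p.-1))%N%:Z
             * \prod_(i < k) (r - i%:Z * d%:Z))%Z.
Proof.
move=> d0; rewrite -(partnC \pi(d) (fact_gt0 k)) PoszM; apply: dvdz_mul.
  change ((k`!)`_(\pi(d)) %| \prod_(p <- primes d) p ^ (k %/ p.-1))%N.
  apply/dvdn_partP; first exact: part_gt0.
  move=> p pA.
  have pp : prime p by move: pA; rewrite mem_primes => /andP[].
  have pd : p \in primes d.
    move: pA; rewrite /= -[p \in \pi(d)]/(p \in \pi(d)).
    by rewrite pi_of_part ?fact_gt0 // => /andP[].
  rewrite p_part (bigD1_seq p) ?primes_uniq //=.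
  apply: dvdn_mulr; apply: dvdn_exp2l; apply: leq_trans (logn_fact_le k pp).
  by apply: dvdn_leq_log; [exact: fact_gt0 | exact: dvdn_part].
set B := ((k`!)`_(_^'))%N.
have B0 : (0 < B)%N by exact: part_gt0.
have cop : coprimez d%:Z B%:Z.
  rewrite /coprimez /gcdz !absz_nat -(part_pnat_id (pnat_pi d0)).
  exact: coprime_partC.
(* [e] inverts [d] modulo [B]; multiplying by [e ^+ k] turns the step [d] into the step 1. *)
have /coprimezP[[e f] /= ef] := cop.
have cope : coprimez (e ^+ k) B%:Z.
  apply: coprimezXl; apply/coprimezP; exists (d%:Z, f) => /=.
  by rewrite mulrC.
rewrite coprimez_sym in cope.
rewrite -(Gauss_dvdzr _ cope) -[k in X in X * _]card_ord -prodr_const -big_split /=.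
have Bn0 : B%:Z != 0 by rewrite eqz_nat -lt0n.
(* A nonnegative representative of [e * r], so that the product of the [m - i] is the falling
   factorial [m ^_ k]. *)
set m := `|(e * r %% B%:Z)%Z|%N.
have mE : m%:Z = (e * r %% B%:Z)%Z by rewrite /m gez0_abs // modz_ge0.
have H i : (e * (r - i%:Z * d%:Z) = m%:Z - i%:Z %[mod B%:Z])%Z.
  apply/eqP; rewrite eqz_mod_dvd.
  have -> : e * (r - i%:Z * d%:Z) - (m%:Z - i%:Z)
      = (e * r - m%:Z) + (i%:Z * f) * B%:Z.
    have fB : f * B%:Z = 1 - e * d%:Z by rewrite -ef addrAC subrr add0r.
    by rewrite -mulrA fB; ring.
  rewrite rpredD //; last exact: dvdz_mull.
  by rewrite -eqz_mod_dvd mE modz_mod.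
apply/dvdz_mod0P.
rewrite (eqz_mod_prod k H) prod_subr_ffact -bin_ffact.
apply/dvdz_mod0P; apply: (@dvdn_trans k`!); first exact: dvdn_part.
by rewrite absz_nat; exact: dvdn_mull.
Qed.

Lemma den_gt0 (a : rat) : (0 < den a)%N.
Proof. by rewrite /den absz_gt0 denq_neq0. Qed.

Lemma denqE (a : rat) : denq a = (den a)%:Z.
Proof. by rewrite /den gez0_abs // ltW // denq_gt0. Qed.

Lemma numq_div_den (a : rat) : a = (numq a)%:~R / (den a)%:R.
Proof. by rewrite -{1}[a]divq_num_den denqE -pmulrn. Qed.

(** Integer parts are superadditive. This distributes the index of [mu] among the factors of one
    term of [q]. *)
Lemma mu_dvdn (a : rat) (j k n : nat) : (j + k <= n)%N ->
  (mu a j * mu a k %| mu a n)%N.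
Proof.
move=> le_n; rewrite /mu mulnACA -expnD; apply: dvdn_mul.
  exact: dvdn_exp2l.
rewrite -big_split /= !big_seq.
apply: (big_ind2 (fun x y => (x %| y)%N)) => //.
  by move=> *; exact: dvdn_mul.
move=> p; rewrite mem_primes => /andP[pp _].
rewrite -expnD; apply: dvdn_exp2l.
have p1 : (0 < p.-1)%N by have := prime_gt1 pp; case: p pp => [|[]].
rewrite leq_divRL // mulnDl.
apply: leq_trans le_n; apply: leq_add; exact: leq_trunc_div.
Qed.

(** The power of [den a] clears the numerator of the binomial into the arithmetic progression of
    [fact_dvd_prod_arith]; the remaining prime powers compensate for [k!]. *)
Lemma mu_gbinom_int (a : rat) (m : int) (k : nat) :
  (mu a k)%:R * gbinom (m%:~R - a) k \is a Num.int.
Proof.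
have d0 := den_gt0 a.
have dn0 : (den a)%:R != 0 :> rat by rewrite pnatr_eq0 -lt0n.
have k0 : k`!%:R != 0 :> rat by rewrite pnatr_eq0 -lt0n fact_gt0.
have /dvdzP[c Hc] := fact_dvd_prod_arith (m * (den a)%:Z - numq a) k d0.
suff -> : (mu a k)%:R * gbinom (m%:~R - a) k = c%:~R :> rat by exact: intr_int.
apply: (mulIf k0); rewrite /gbinom mulrA mulfVK //.
have := congr1 (fun z : int => z%:~R : rat) Hc; rewrite intrM [RHS]intrM => Hc'.
rewrite -[k`!%:R]pmulrn -{}Hc' /mu natrM mulrAC -[in RHS]pmulrn mulrC.
congr (_ * _); rewrite natrX rmorph_prod /=.
rewrite -[k in _ ^+ k]card_ord -prodr_const -big_split /=.
apply: eq_bigr => i _; rewrite rmorphB rmorphB /= !rmorphM /=.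
rewrite {2}[a]numq_div_den mulrBr mulrBr mulrCA divff // mulr1 -!pmulrn.
by rewrite [_ * m%:~R]mulrC [_ * i%:R]mulrC.
Qed.

Lemma pochhammer_gbinom (a : rat) (m : nat) :
  pochhammer (a + 1) m = (-1) ^+ m * (m`!)%:R * gbinom ((-1)%:~R - a) m.
Proof.
rewrite /gbinom mulrAC -!mulrA mulVf ?pnatr_eq0 -?lt0n ?fact_gt0 // mulr1.
rewrite -[m in _ ^+ m]card_ord -prodr_const -big_split /=.
by apply: eq_bigr => i _; rewrite rmorphN1; ring.
Qed.

Lemma q_integrality (a1 a2 : rat) (n : nat) :
  exists P : {poly int}, forall x : rat,
    (mu (a2 - a1) n)%:R * (mu a2 (2 * n))%:R * q n a1 a2 x
    = (n`!)%:R * (map_poly intr P).[x].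
Proof.
have H (k : 'I_n.+1) : exists c : int,
    (mu (a2 - a1) n)%:R * (mu a2 (2 * n))%:R * (gbinom (n%:R + a1 - a2) k
    * gbinom (n%:R + a2 - a1) (n - k) * pochhammer (a2 + 1) (n + k))
    = (n`!)%:R * c%:~R :> rat.
  have kn : (k <= n)%N by rewrite -ltnS.
  have /dvdnP[u Hu] : (mu (a2 - a1) k * mu (a2 - a1) (n - k) %| mu (a2 - a1) n)%N.
    by apply: mu_dvdn; rewrite subnKC.
  have /dvdnP[v Hv] : (mu a2 (n + k) * mu a2 0 %| mu a2 (2 * n))%N.
    by apply: mu_dvdn; rewrite addn0 mul2n -addnn leq_add2l.
  (* The Pochhammer symbol carries [(n + k)!], and this is where the factor [n!] comes from. *)
  have /dvdnP[w Hw] : (n`! %| (n + k)`!)%N.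
    by rewrite -(bin_fact (leq_addr k n)) mulnCA; exact: dvdn_mulr.
  have := mu_gbinom_int (a2 - a1) n k.
  have -> : n%:~R - (a2 - a1) = n%:R + a1 - a2 :> rat by rewrite opprB addrA.
  move=> /intrP[c1 H1].
  have muN : mu (a1 - a2) = mu (a2 - a1).
    by rewrite /mu /den -opprB denqN.
  have := mu_gbinom_int (a1 - a2) n (n - k); rewrite muN.
  have -> : n%:~R - (a1 - a2) = n%:R + a2 - a1 :> rat by rewrite opprB addrA.
  move=> /intrP[c2 H2].
  have /intrP[c3 H3] := mu_gbinom_int a2 (-1) (n + k).
  exists (u%:Z * c1 * c2 * (v * mu a2 0 * w)%N%:Z * c3 * (-1) ^+ (n + k)).
  rewrite pochhammer_gbinom Hu Hv Hw !intrM -H1 -H2 -H3.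
  have -> : ((-1) ^+ (n + k))%:~R = (-1) ^+ (n + k) :> rat by rewrite rmorphXn rmorphN1.
  generalize (mu (a2 - a1) k) (mu (a2 - a1) (n - k)) (mu a2 (n + k)) (mu a2 0).
  by move=> M1 M2 M3 M4; rewrite -!pmulrn !natrM; ring.
have [c Hc] := choice H.
exists (\sum_(k < n.+1) (c k)%:P * 'X^(n - k)) => x.
rewrite rmorph_sum /= horner_sum /q !mulr_sumr; apply: eq_bigr => k _.
rewrite [map_poly _ _]rmorphM /= map_polyC map_polyXn hornerM hornerC hornerXn.
by rewrite mulrA Hc mulrA.
Qed.

(** * Integrals over the line and the Gamma function *)

Section whole_line_integrals.
Context {R : realType}.
Local Notation mu := (@lebesgue_measure R).
Implicit Types f G F : R -> R.

Lemma cvg_integralT f : measurable_fun setT f -> (forall x, 0 <= f x) ->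
  (\int[mu]_(x in `[(- n%:R)%R, n%:R%R]) (f x)%:E)%E @[n --> \oo]
  --> (\int[mu]_x (f x)%:E)%E.
Proof.
move=> mf f0; rewrite -(@bigcup_itvT R true false).
apply: ge0_nondecreasing_set_cvg_integral.
- move=> m n mn; rewrite subsetEset => x /=.
  rewrite !in_itv /= => /andP[h1 h2].
  have mnR : m%:R <= n%:R :> R by rewrite ler_nat.
  by apply/andP; split; lra.
- by move=> n; exact: measurable_itv.
- by move=> n; apply/measurable_EFinP; exact: measurable_funTS.
- by move=> n x _; rewrite lee_fin.
Qed.

(** The rule on segments [[-n, n]] passes to the line by monotone convergence, since the range of
    [F] is the increasing union of the images of these segments. The equality is one of extended
    reals. *)
Lemma integral_substitution F (F' : R -> R) G :
  (forall x : R, is_derive x 1 F (F' x)) -> continuous F' ->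
  (forall x, 0 < F' x) ->
  (forall x, {for F x, continuous G}) -> (forall x, 0 <= G (F x)) ->
  (\int[mu]_(y in range F) (G y)%:E = \int[mu]_x (G (F x) * F' x)%:E)%E.
Proof.
move=> dF cF' F'0 cG G0.
have derF x : derive1 F x = F' x by rewrite derive1E; exact: derive_val.
have cF : continuous F.
  by move=> x; apply/differentiable_continuous/derivable1_diffP.
have incF x y : x < y -> F x < F y.
  move=> xy; have [z _ Hz] := MVT xy (fun z _ => dF z) (continuous_subspaceT cF).
  by rewrite -subr_gt0 Hz mulr_gt0 // subr_gt0.
have leF x y : x <= y -> F x <= F y.
  by rewrite le_eqVlt => /predU1P[->//|/incF/ltW].
have rangeF : range F = \bigcup_n `[F (- n%:R), F n%:R]%classic.
  apply/seteqP; split => [_ [x _ <-]|y [n _]].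
    exists (Num.bound `|x|) => //=; rewrite in_itv /=.
    have xb := archi_boundP (normr_ge0 x); rewrite ltr_norml in xb.
    by move/andP: xb => [h1 h2]; apply/andP; split; apply: leF; exact: ltW.
  rewrite /= in_itv /= => /andP[h1 h2].
  have nn : - n%:R <= n%:R :> R by have := ler0n R n; lra.
  have [||c _ <-] := @IVT R F (- n%:R) n%:R y nn.
  - exact: continuous_subspaceT.
  - by rewrite min_l ?max_r ?leF // h1 h2.
  - by exists c.
have mGF : measurable_fun setT (fun x => G (F x) * F' x).
  apply: continuous_measurable_fun => x.
  apply: cvgM; last exact: cF'.
  by apply: (@continuous_comp _ _ _ F G); [exact: cF | exact: cG].
have dFE : derive1 F = F' by apply/funext.
have lim := cvg_integralT mGF (fun x => mulr_ge0 (G0 x) (ltW (F'0 x))).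
apply/esym; move/cvg_lim : lim => <- //.
rewrite rangeF; apply/cvg_lim => //.
rewrite (_ : (fun n => _) = fun n : nat =>
   (\int[mu]_(y in `[(F (- n%:R))%R, (F n%:R)%R]%classic) (G y)%:E)%E); last first.
  apply/funext => n.
  have nn : - n%:R <= n%:R :> R by have := ler0n R n; lra.
  rewrite (@integration_by_substitution_increasing _ F G (- n%:R) n%:R) //.
  - by rewrite dFE.
  - by move=> x y _ _; exact: incF.
  - by move=> x _; rewrite dFE.
  - by rewrite dFE; apply/cvg_ex; exists (F' (- n%:R)); apply: cvg_at_right_filter; exact: cF'.
  - by rewrite dFE; apply/cvg_ex; exists (F' n%:R); apply: cvg_at_left_filter; exact: cF'.
  - split; first by move=> x _; exact: ex_derive.
      by apply: cvg_at_right_filter; exact: cF.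
    by apply: cvg_at_left_filter; exact: cF.
  - apply: continuous_in_subspaceT => y; rewrite inE /= in_itv /= => /andP[h1 h2].
    have [||c _ <-] := @IVT R F (- n%:R) n%:R y nn.
    + exact: continuous_subspaceT.
    + by rewrite min_l ?max_r ?leF // h1 h2.
    + exact: cG.
apply: ge0_nondecreasing_set_cvg_integral.
- move=> m n mn; rewrite subsetEset => x /=.
  rewrite !in_itv /= => /andP[h1 h2].
  have mnR : m%:R <= n%:R :> R by rewrite ler_nat.
  apply/andP; split; first by apply: le_trans h1; apply: leF; lra.
  by apply: (le_trans h2); exact: leF.
- by move=> n; exact: measurable_itv.
- move=> n; apply/measurable_EFinP.
  apply: subspace_continuous_measurable_fun => //.
  apply: continuous_in_subspaceT => y; rewrite inE /= in_itv /= => /andP[h1 h2].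
  have nn : - n%:R <= n%:R :> R by have := ler0n R n; lra.
  have [||c _ <-] := @IVT R F (- n%:R) n%:R y nn.
  + exact: continuous_subspaceT.
  + by rewrite min_l ?max_r ?leF // h1 h2.
  + exact: cG.
- move=> n y; rewrite /= in_itv /= => /andP[h1 h2].
  have nn : - n%:R <= n%:R :> R by have := ler0n R n; lra.
  have [||c _ <-] := @IVT R F (- n%:R) n%:R y nn.
  + exact: continuous_subspaceT.
  + by rewrite min_l ?max_r ?leF // h1 h2.
  + by rewrite lee_fin.
Qed.

Lemma integral_derive F (F' : R -> R) a b : a <= b ->
  (forall x : R, is_derive x 1 F (F' x)) -> continuous F' ->
  (\int[mu]_(x in `[a, b]) (F' x)%:E = (F b - F a)%:E)%E.
Proof.
rewrite le_eqVlt => /predU1P[->|ab] dF cF'.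
  by rewrite set_itv1 integral_set1 subrr.
have cF : continuous F.
  by move=> x; apply/differentiable_continuous/derivable1_diffP.
rewrite (continuous_FTC2 ab (F := F)) //.
- exact: continuous_subspaceT.
- split; first by move=> x _; exact: ex_derive.
    by apply: cvg_at_right_filter; exact: cF.
  by apply: cvg_at_left_filter; exact: cF.
- by move=> x _; rewrite derive1E; exact: derive_val.
Qed.

Lemma integralT_shift f c : continuous f -> (forall x, 0 <= f x) ->
  (\int[mu]_x (f x)%:E = \int[mu]_x (f (x + c))%:E)%E.
Proof.
move=> cf f0.
have dF (x : R) : is_derive x 1 (fun x => x + c) 1.
  by apply: is_derive_eq; rewrite addr0.
have := @integral_substitution _ _ f dF.
have -> : range (fun x => x + c) = setT.
  by apply/seteqP; split => // y _; exists (y - c) => //; rewrite subrK.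
move=> -> //.
- by apply: eq_integral => x _; rewrite mulr1.
- by move=> x; exact: cvg_cst.
- by move=> x; exact: cf.
Qed.

Lemma integralT_opp f : continuous f -> (forall x, 0 <= f x) ->
  (\int[mu]_x (f x)%:E = \int[mu]_x (f (- x))%:E)%E.
Proof.
move=> cf f0; have mf := continuous_measurable_fun cf.
have cfN : continuous (fun x => f (- x)).
  by move=> x; apply: (@continuous_comp _ _ _ -%R f); [exact: opp_continuous | exact: cf].
have h1 := cvg_integralT mf f0.
have h2 := cvg_integralT (continuous_measurable_fun cfN) (fun x => f0 (- x)).
move/cvg_lim : h1 => <- //; move/cvg_lim : h2 => <- //.
congr (limn _); apply/funext => n.
have nn : - n%:R <= n%:R :> R by have := ler0n R n; lra.
have := integration_by_substitution_oppr (G := f) nn.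
rewrite opprK => -> //; exact: continuous_subspaceT.
Qed.

Lemma range_expR : range (@expR R) = `]0, +oo[%classic.
Proof.
apply/seteqP; split => [_ [x _ <-]|y /=].
  by rewrite /= in_itv /= andbT expR_gt0.
by rewrite in_itv /= andbT => y0; exists (ln y) => //; rewrite lnK.
Qed.

Lemma powR_expR (s x : R) : expR x `^ s = expR (s * x).
Proof. by rewrite /powR gt_eqF ?expR_gt0 // expRK. Qed.

Lemma continuous_expR_comp f : continuous f -> continuous (fun x => expR (f x)).
Proof.
by move=> cf x; apply: (@continuous_comp _ _ _ f expR);
  [exact: cf | exact: continuous_expR].
Qed.

(* The integrand of the Gamma integral after the substitution t = e^x, which moves
   all the integrals of this development to the whole line. *)
Definition logGammaF (s r x : R) : R := expR (s * x - r * expR x).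

Lemma continuous_logGammaF s r : continuous (logGammaF s r).
Proof.
apply: continuous_expR_comp => x; apply: cvgB.
  by apply: cvgM; [exact: cvg_cst | exact: cvg_id].
by apply: cvgM; [exact: cvg_cst | exact: continuous_expR].
Qed.

End whole_line_integrals.

(** * The Gamma function and Gaussian integrals in the hyperbolic sine *)

Section gamma_function.
Context {R : realType}.
Local Notation mu := (@lebesgue_measure R).

Lemma continuous_powRl (s x : R) : 0 < x -> {for x, continuous (fun t : R => t `^ s)}.
Proof.
move=> x0; apply/differentiable_continuous/derivable1_diffP/derivable_powR.
by rewrite in_itv /= andbT.
Qed.

Lemma integral_logGammaF s r : (\int[mu]_(t in `]0%R, +oo[) (t `^ (s - 1) * expR (- (r * t)))%:E
   = \int[mu]_x (logGammaF s r x)%:E)%E.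
Proof.
rewrite -range_expR (@integral_substitution _ _ _ _ (@is_derive_expR R)) //.
- apply: eq_integral => x _; congr EFin.
  by rewrite powR_expR /logGammaF -!expRD; congr expR; ring.
- exact: continuous_expR.
- by move=> x; exact: expR_gt0.
- move=> x; apply: cvgM.
    by apply: continuous_powRl; exact: expR_gt0.
  apply: (@continuous_expR_comp R (fun t : R => - (r * t))) => y.
  by apply: cvgN; apply: cvgM; [exact: cvg_cst | exact: cvg_id].
Qed.

Lemma logGammaF_ge0 s r (x : R) : 0 <= logGammaF s r x.
Proof. exact: expR_ge0. Qed.

Lemma measurable_logGammaF s r : measurable_fun setT (@logGammaF R s r).
Proof. by apply: continuous_measurable_fun; exact: continuous_logGammaF. Qed.

Let EG (s : R) := (\int[mu]_x (logGammaF s 1 x)%:E)%E.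

Let EG_ge0 s : (0 <= EG s)%E.
Proof. by apply: integral_ge0 => x _; rewrite lee_fin logGammaF_ge0. Qed.

(** Integration by parts on [[-n, n]], with boundary terms tending to 0. It is stated in the
    extended reals because it is used to prove that these integrals are finite. *)
Lemma integral_logGammaF_rec (s : R) : 0 < s -> (s%:E * EG s = EG (s + 1))%E.
Proof.
move=> s0.
pose D (x : R) := s * logGammaF s 1 x - logGammaF (s + 1) 1 x.
have dD (x : R) : is_derive x 1 (logGammaF s 1) (D x).
  rewrite /logGammaF; apply: is_derive_eq.
  rewrite /D /logGammaF /GRing.scale /=.
  have -> : (s + 1) * x - 1 * expR x = (s * x - 1 * expR x) + x by ring.
  by rewrite [expR (_ + x)]expRD; ring.
have cD : continuous D.
  move=> x; apply: cvgB; last exact: continuous_logGammaF.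
  by apply: cvgM; [exact: cvg_cst | exact: continuous_logGammaF].
pose bd (n : nat) : R := logGammaF s 1 n%:R - logGammaF s 1 (- n%:R).
have bd0 : bd n @[n --> \oo] --> (0 : R).
  pose C := (expR (4 * s ^+ 2) + 1) * (1 + s^-1).
  have e3 : - C * harmonic n @[n --> \oo] --> (0 : R).
    by rewrite -[X in _ --> X](mulr0 (- C)); apply: cvgM; [exact: cvg_cst | exact: cvg_harmonic].
  have e4 : C * harmonic n @[n --> \oo] --> (0 : R).
    by rewrite -[X in _ --> X](mulr0 C); apply: cvgM; [exact: cvg_cst | exact: cvg_harmonic].
  apply: squeeze_cvgr e3 e4; apply: nearW => n; rewrite mulNr -ler_norml.
  (* The exponent inequality follows from 2 s n <= 4 s^2 + n^2 / 4 and e^n >= n^2 / 4. *)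
  have b1 : logGammaF s 1 n%:R <= expR (4 * s ^+ 2) * expR (- n%:R) `^ s.
    rewrite powR_expR -expRD ler_expR mul1r.
    have := expR_ge1Dx (n%:R / 2 : R) => h.
    have -> : expR n%:R = expR (n%:R / 2) ^+ 2 :> R.
      by rewrite expr2 -expRD; congr expR; lra.
    move: h; move: (expR _) (ler0n R n) => E; set N := n%:R => N0 h.
    have h1 : (N / 2) ^+ 2 <= E ^+ 2.
      by rewrite ler_sqr ?nnegrE; lra.
    have h2 := sqr_ge0 (2 * s - N / 2).
    nra.
  have b2 : logGammaF s 1 (- n%:R) <= expR (- n%:R) `^ s.
    by rewrite powR_expR ler_expR mul1r gerBl expR_ge0.
  have b5 : expR (- n%:R) `^ s <= (1 + s^-1) * harmonic n.
    rewrite powR_expR mulrN expRN /harmonic /= -[leLHS]mul1r ler_pdivrMr ?expR_gt0 //.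
    rewrite mulrAC ler_pdivlMr ?ltr0n // mul1r.
    apply: (@le_trans _ _ ((1 + s^-1) * (1 + s * n%:R))); last first.
      by rewrite ler_wpM2l ?expR_ge1Dx // addr_ge0 // invr_ge0 ltW.
    rewrite mulrDl mul1r mulrDr mulr1 mulKf ?gt_eqF // -natr1.
    have n0 := ler0n R n; have si : 0 < s^-1 by rewrite invr_gt0.
    have sn : 0 <= s * n%:R by rewrite mulr_ge0 // ltW.
    lra.
  have b3 := logGammaF_ge0 s 1 n%:R; have b4 := logGammaF_ge0 s 1 (- n%:R).
  have b6 : (expR (4 * s ^+ 2) + 1) * expR (- n%:R) `^ s <= C * harmonic n.
    by rewrite /C -mulrA ler_wpM2l // addr_ge0 // expR_ge0.
  apply: le_trans b6; rewrite mulrDl mul1r.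
  have b7 : 0 <= expR (4 * s ^+ 2) * expR (- n%:R) `^ s :> R.
    by rewrite mulr_ge0 ?expR_ge0 ?powR_ge0.
  have b8 : 0 <= expR (- n%:R) `^ s :> R by exact: powR_ge0.
  rewrite ler_norml /bd; move: b1 b2 b3 b4 b7 b8; clear.
  move: (logGammaF _ _ _) (logGammaF _ _ _) (_ * _) (_ `^ _) => A B E F *.
  by apply/andP; split; lra.
have key n : (s%:E * \int[mu]_(x in `[(- n%:R)%R, n%:R%R]) (logGammaF s 1 x)%:E
    = (bd n)%:E + \int[mu]_(x in `[(- n%:R)%R, n%:R%R]) (logGammaF (s + 1) 1 x)%:E)%E.
  have nn : - n%:R <= n%:R :> R by have := ler0n R n; lra.
  have mI : measurable (`[(- n%:R)%R, n%:R%R]%classic : set R) by exact: measurable_itv.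
  rewrite -(integral_derive nn dD cD) -ge0_integralZl_EFin //; last first.
  - exact: ltW.
  - apply/measurable_EFinP; apply: measurable_funTS; exact: measurable_logGammaF.
  - by move=> x _; rewrite lee_fin logGammaF_ge0.
  rewrite -integralD_EFin; last 3 first.
  - exact: mI.
  - apply: continuous_compact_integrable; first exact: segment_compact.
    exact: continuous_subspaceT.
  - apply: continuous_compact_integrable; first exact: segment_compact.
    apply: continuous_subspaceT; exact: continuous_logGammaF.
  by apply: eq_integral => x _; rewrite -EFinM -EFinD /D subrK.
have h1 := cvg_integralT (measurable_logGammaF s 1) (logGammaF_ge0 s 1).
have h2 := cvg_integralT (measurable_logGammaF (s + 1) 1) (logGammaF_ge0 (s + 1) 1).
have h3 := cvgeZl (isT : s%:E \is a fin_num) h1.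
have bd0E : (bd n)%:E @[n --> \oo] --> (0%:E : \bar R).
  by apply: cvg_EFin => //; apply: nearW.
have keyE := funext key; rewrite keyE in h3.
have h4 := cvgeD (fin_num_adde_defr _ (isT : (0%:E : \bar R) \is a fin_num)) bd0E h2.
rewrite add0e in h4.
exact: (cvg_unique _ h3 (h4 _)).
Qed.

Lemma integral_logGammaF1 : (\int[mu]_x (logGammaF 1 1 x)%:E = 1)%E.
Proof.
have dF (x : R) : is_derive x 1 (fun x => - expR (- expR x)) (logGammaF 1 1 x).
  apply: is_derive_eq; rewrite /logGammaF /GRing.scale /= !mul1r expRD; ring.
have := @integral_substitution _ _ _ (fun=> 1) dF.
have -> : range (fun x : R => - expR (- expR x)) = `]-1, 0[%classic.
  apply/seteqP; split => [_ [x _ <-]|y] /=; rewrite in_itv /=.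
    by rewrite oppr_lt0 expR_gt0 ltrN2 -expR0 ltr_expR oppr_lt0 expR_gt0.
  move=> /andP[y1 y0]; exists (ln (- ln (- y))) => //.
  have h : 0 < - ln (- y) by rewrite oppr_gt0 ln_lt0 //; lra.
  by rewrite lnK // opprK lnK ?opprK // posrE; lra.
move=> H; transitivity (\int[mu]_x (1 * logGammaF 1 1 x)%:E)%E.
  by apply: eq_integral => x _; rewrite mul1r.
rewrite -H //.
- rewrite integral_cst //= lebesgue_measure_itv /= lte_fin ltrN10 mul1e -EFinB.
  by rewrite opprK add0r.
- exact: continuous_logGammaF.
- by move=> x; exact: expR_gt0.
- by move=> x; exact: cvg_cst.
Qed.

(** At positive integers the recursion starts from the value 1. For 1 <= t <= M one has e^(t x) <=
    e^x + e^(M x). Below 1 the recursion is read backwards: [s * EG s] is finite. *)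
Lemma integral_logGammaF_lty (s : R) : 0 < s ->
  (\int[mu]_x (logGammaF s 1 x)%:E < +oo)%E.
Proof.
move=> s0.
have EGn (n : nat) : (EG n.+1%:R < +oo)%E.
  elim: n => [|n IH]; first by rewrite /EG integral_logGammaF1 ltry.
  rewrite -natr1 -integral_logGammaF_rec ?ltr0n //.
  by rewrite lte_mul_pinfty.
have EG1 t : 1 <= t -> (EG t < +oo)%E.
  move=> t1; pose N := Num.bound t.
  have tN : t <= N.+1%:R.
    have := archi_boundP (le_trans ler01 t1); rewrite -/N -natr1; lra.
  apply: (@le_lt_trans _ _ (EG 1%:R + EG N.+1%:R)%E); last first.
    by rewrite lte_add_pinfty // EGn.
  rewrite /EG -ge0_integralD //.
  - apply: ge0_le_integral => //.
    + by move=> x _; rewrite lee_fin logGammaF_ge0.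
    + by apply/measurable_EFinP; exact: measurable_logGammaF.
    + by apply: emeasurable_funD; apply/measurable_EFinP; exact: measurable_logGammaF.
    + move=> x _; rewrite -EFinD lee_fin /logGammaF.
      have [x0|x0] := leP 0 x.
        apply: (@le_trans _ _ (expR (N.+1%:R * x - 1 * expR x))).
          by rewrite ler_expR lerD2r ler_wpM2r.
        by rewrite lerDr expR_ge0.
      apply: (@le_trans _ _ (expR (1%:R * x - 1 * expR x))).
        by rewrite ler_expR lerD2r ler_wnM2r // ltW.
      by rewrite lerDl expR_ge0.
  - by move=> x _; rewrite lee_fin logGammaF_ge0.
  - by apply/measurable_EFinP; exact: measurable_logGammaF.
  - by move=> x _; rewrite lee_fin logGammaF_ge0.
  - by apply/measurable_EFinP; exact: measurable_logGammaF.
have : (EG (s + 1) < +oo)%E by apply: EG1; lra.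
rewrite -integral_logGammaF_rec // /EG.
case: (\int[mu]_x _)%E (EG_ge0 s) => // [r _ _|]; first exact: ltry.
by rewrite gt0_muley ?lte_fin.
Qed.

Lemma GammaE (s : R) : 0 < s -> (Gamma s)%:E = (\int[mu]_x (logGammaF s 1 x)%:E)%E.
Proof.
move=> s0; rewrite /Gamma /Rintegral -integral_logGammaF.
have -> : (\int[mu]_(t in `]0%R, +oo[) (t `^ (s - 1) * expR (- t))%:E
    = \int[mu]_(t in `]0%R, +oo[) (t `^ (s - 1) * expR (- (1 * t)))%:E)%E.
  by apply: eq_integral => x _; rewrite mul1r.
rewrite integral_logGammaF fineK // ge0_fin_numE; first exact: integral_logGammaF_lty.
exact: EG_ge0.
Qed.

Lemma Gamma1 : Gamma 1 = 1 :> R.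
Proof. by apply: EFin_inj; rewrite GammaE // integral_logGammaF1. Qed.

Lemma Gamma_rec (s : R) : 0 < s -> Gamma (s + 1) = s * Gamma s.
Proof.
move=> s0; have s1 : 0 < s + 1 by rewrite addr_gt0.
apply: EFin_inj; apply: etrans (GammaE s1) _.
apply: etrans (esym (integral_logGammaF_rec s0)) _.
exact: (congr1 (fun z => s%:E * z)%E (esym (GammaE s0))).
Qed.

Lemma Gamma_natS (n : nat) : Gamma n.+1%:R = n`!%:R :> R.
Proof.
elim: n => [|n IH]; first by rewrite Gamma1.
by rewrite -natr1 Gamma_rec ?ltr0n // IH factS natrM.
Qed.

Lemma Gamma_gt0 (s : R) : 0 < s -> 0 < Gamma s.
Proof.
move=> s0; rewrite -lte_fin GammaE //.
apply: (@lt_le_trans _ _ (\int[mu]_(x in `[0%R, 1%R]) (expR (- expR 1))%:E)%E).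
  rewrite integral_cst //= lebesgue_measure_itv /= lte01 sube0 mule1.
  by rewrite lte_fin expR_gt0.
apply: (@le_trans _ _ (\int[mu]_(x in `[0%R, 1%R]) (logGammaF s 1 x)%:E)%E).
  apply: ge0_le_integral => //.
  - by apply/measurable_EFinP; apply: measurable_funTS; exact: measurable_logGammaF.
  - move=> x; rewrite /= in_itv /= => /andP[x0 x1].
    rewrite lee_fin ler_expR mul1r -[leLHS]add0r lerD //.
      by rewrite mulr_ge0 // ltW.
    by rewrite lerN2 ler_expR.
apply: ge0_subset_integral => //.
- by apply/measurable_EFinP; exact: measurable_logGammaF.
- by move=> x _; rewrite lee_fin logGammaF_ge0.
Qed.

(** The scaling t -> t / r is a shift by [- ln r] in the logarithmic variable. *)
Lemma integral_logGammaF_scale (s r : R) : 0 < s -> 0 < r ->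
  (\int[mu]_x (logGammaF s r x)%:E)%E = (Gamma s * r `^ (- s))%:E.
Proof.
move=> s0 r0; rewrite (@integralT_shift _ _ (- ln r)); last 2 first.
- exact: continuous_logGammaF.
- exact: logGammaF_ge0.
rewrite mulrC EFinM GammaE // -ge0_integralZl_EFin ?powR_ge0 //.
- apply: eq_integral => x _; rewrite -EFinM; congr EFin.
  rewrite /logGammaF /powR gt_eqF // -!expRD; congr expR.
  by rewrite expRD expRN lnK ?posrE //; field; rewrite gt_eqF.
- by move=> x _; rewrite lee_fin logGammaF_ge0.
- by apply/measurable_EFinP; exact: measurable_logGammaF.
Qed.

Lemma ge0_integralT_Zl (k : R) (f : R -> R) : measurable_fun setT f ->
  (forall x, 0 <= f x) -> 0 <= k ->
  (\int[mu]_x (k * f x)%:E = k%:E * \int[mu]_x (f x)%:E)%E.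
Proof.
move=> mf f0 k0; rewrite -ge0_integralZl_EFin //.
- by move=> x _; rewrite lee_fin.
- exact/measurable_EFinP.
Qed.

Lemma ge0_integralT_D (f g : R -> R) : measurable_fun setT f -> measurable_fun setT g ->
  (forall x, 0 <= f x) -> (forall x, 0 <= g x) ->
  (\int[mu]_x (f x + g x)%:E = \int[mu]_x (f x)%:E + \int[mu]_x (g x)%:E)%E.
Proof.
move=> mf mg f0 g0; rewrite -ge0_integralD //.
- by move=> x _; rewrite lee_fin.
- exact/measurable_EFinP.
- by move=> x _; rewrite lee_fin.
- exact/measurable_EFinP.
Qed.

Lemma ge0_integralT_le (f g : R -> R) : measurable_fun setT f -> measurable_fun setT g ->
  (forall x, 0 <= f x) -> (forall x, f x <= g x) ->
  (\int[mu]_x (f x)%:E <= \int[mu]_x (g x)%:E)%E.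
Proof.
move=> mf mg f0 fg; apply: ge0_le_integral => //.
- by move=> x _; rewrite lee_fin.
- exact/measurable_EFinP.
- exact/measurable_EFinP.
- by move=> x _; rewrite lee_fin.
Qed.

(** [sh2 x] is 2 sinh (x / 2) and [ch2 x] is cosh (x / 2). Since e^x + e^(-x) = [sh2 x ^+ 2 + 2] and
    [ch2] is the derivative of [sh2], the exponential at the saddle point is an exact Gaussian in
    [sh2]. *)
Definition sh2 (x : R) : R := expR (x / 2) - expR (- (x / 2)).
Definition ch2 (x : R) : R := (expR (x / 2) + expR (- (x / 2))) / 2.

Lemma is_derive_sh2 (x : R) : is_derive x 1 sh2 (ch2 x).
Proof.
rewrite /sh2; apply: is_derive_eq; rewrite /ch2 /GRing.scale /=; ring.
Qed.

Lemma continuous_ch2 : continuous ch2.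
Proof.
move=> x; apply/differentiable_continuous/derivable1_diffP.
by rewrite /ch2; exact: ex_derive.
Qed.

Lemma continuous_sh2 : continuous sh2.
Proof.
move=> x; apply/differentiable_continuous/derivable1_diffP.
by have := is_derive_sh2 x => H; exact: ex_derive.
Qed.

Lemma ch2_ge1 x : 1 <= ch2 x.
Proof.
rewrite /ch2 expRN; have := expR_gt0 (x / 2); move: (expR _) => t t0.
have ti : t * t^-1 = 1 by rewrite divff ?gt_eqF.
have ti0 : 0 < t^-1 by rewrite invr_gt0.
have := sqr_ge0 (t - 1) => h.
have : 0 <= t^-1 * (t - 1) ^+ 2 by rewrite mulr_ge0 // ltW.
have -> : t^-1 * (t - 1) ^+ 2 = t * (t * t^-1) - 2 * (t * t^-1) + t^-1 by ring.
by rewrite ti; lra.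
Qed.

Lemma integral_gauss_sh2 (c : R) : 0 < c ->
  (\int[mu]_x (expR (- c * sh2 x ^+ 2) * ch2 x)%:E = (Num.sqrt (pi / c))%:E)%E.
Proof.
move=> c0.
have k0 : 0 < Num.sqrt c by rewrite sqrtr_gt0.
have dF (x : R) : is_derive x 1 (fun x => Num.sqrt c * sh2 x) (Num.sqrt c * ch2 x).
  have H := is_derive_sh2 x; apply: is_derive_eq; rewrite /GRing.scale /=; ring.
have := @integral_substitution _ _ _ gauss_fun dF.
have -> : range (fun x : R => Num.sqrt c * sh2 x) = setT.
  apply/seteqP; split => // y _.
  (* [v] is the positive root of [v - v^-1 = u], so [2 * ln v] is a preimage of [y]. *)
  pose u := y / Num.sqrt c; pose v := (u + Num.sqrt (u ^+ 2 + 4)) / 2.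
  have s2 : Num.sqrt (u ^+ 2 + 4) ^+ 2 = u ^+ 2 + 4 by rewrite sqr_sqrtr // addr_ge0 ?sqr_ge0.
  have v0 : 0 < v.
    have : `|u| < Num.sqrt (u ^+ 2 + 4).
      by rewrite -sqrtr_sqr ltr_sqrt ?ltrDl // ltr_wpDl // sqr_ge0.
    by rewrite ltr_norml => /andP[h _]; rewrite /v; lra.
  have vE : v - v^-1 = u.
    apply: (mulIf (lt0r_neq0 v0)); rewrite mulrBl mulVf ?gt_eqF //.
    by rewrite /v; move: s2; set q := Num.sqrt _ => s2; lra.
  exists (2 * ln v) => //.
  rewrite /sh2 mulrAC divff // mul1r expRN lnK // vE /u mulrC divfK //.
  by rewrite gt_eqF.
rewrite integralT_gauss => H.
have {}H : (\int[mu]_x ((Num.sqrt c * (expR (- c * sh2 x ^+ 2) * ch2 x))%:E) = (Num.sqrt pi)%:E)%E.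
  rewrite H.
  - apply: eq_integral => x _; congr EFin; rewrite /gauss_fun exprMn sqr_sqrtr ?ltW // mulNr; ring.
  - by move=> x; apply: cvgM; [exact: cvg_cst | exact: continuous_ch2].
  - by move=> x; rewrite mulr_gt0 // (lt_le_trans ltr01) // ch2_ge1.
  - by move=> x; exact: continuous_gauss_fun.
  - by move=> x; exact: gauss_fun_ge0.
rewrite ge0_integralT_Zl ?ltW // in H; last 2 first.
- apply: continuous_measurable_fun => x; apply: cvgM; last exact: continuous_ch2.
  apply: (@continuous_expR_comp R (fun t : R => - c * sh2 t ^+ 2)) => y.
  by apply: cvgM; [exact: cvg_cst | apply: cvgM; exact: continuous_sh2].
- by move=> x; rewrite mulr_ge0 ?expR_ge0 // (le_trans ler01) // ch2_ge1.
move: H; case: (\int[mu]_x _)%E => [r| |].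
- move=> [] H; congr EFin; rewrite sqrtrM ?pi_ge0 // sqrtrV ?ltW // -H mulrAC divff ?mul1r //.
  by rewrite gt_eqF.
- by rewrite gt0_muley ?lte_fin.
- by rewrite gt0_muleNy ?lte_fin.
Qed.
End gamma_function.

(** * Relative asymptotics *)

Section asymptotics.
Context {R : realType}.
Implicit Types (u v : nat -> R) (t x : R).

Lemma expR_sub1_sub_ge0 t : 0 <= expR t - 1 - t.
Proof. by have := expR_ge1Dx t; lra. Qed.

Lemma expR_sub1_sub_le t : expR t - 1 - t <= t ^+ 2 * expR `|t|.
Proof.
have [t0|t0] := leP 0 t.
  rewrite ger0_norm //.
  have h : expR t - 1 <= t * expR t.
    have := expR_ge1Dx (- t); rewrite expRN => h.
    have := ler_wpM2r (expR_ge0 t) h; rewrite mulVf ?gt_eqF ?expR_gt0 //; lra.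
  by have := ler_wpM2l t0 h; rewrite mulrBr mulr1 expr2 -mulrA; lra.
have h : expR t * (1 - t) <= 1.
  have := expR_ge1Dx (- t); rewrite expRN => h.
  by have := ler_wpM2l (expR_ge0 t) h; rewrite mulfV ?gt_eqF ?expR_gt0.
have h1 : expR t - 1 - t <= t ^+ 2.
  have e0 := expR_gt0 t; have e1 : expR t <= 1 by rewrite -expR0 ler_expR ltW.
  have := expR_ge1Dx t; nra.
have h2 : 1 <= expR `|t| by rewrite -expR0 ler_expR.
by apply: le_trans h1 _; rewrite ler_peMr ?sqr_ge0.
Qed.

Lemma normr_expR_sub1_sub t : `|expR t - 1 - t| <= t ^+ 2 * expR `|t|.
Proof. by rewrite ger0_norm ?expR_sub1_sub_ge0 ?expR_sub1_sub_le. Qed.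

Lemma normr_expR_sub1 t : `|expR t - 1| <= `|t| * expR `|t|.
Proof.
have h t' : 0 <= t' -> expR t' - 1 <= t' * expR t'.
  move=> t0; have := expR_ge1Dx (- t'); rewrite expRN => h.
  have := ler_wpM2r (expR_ge0 t') h; rewrite mulVf ?gt_eqF ?expR_gt0 //; lra.
have [t0|t0] := leP 0 t.
  by rewrite [`|t|]ger0_norm // ger0_norm ?h // subr_ge0 -expR0 ler_expR.
rewrite [`|t|]ltr0_norm // ler0_norm; last by rewrite subr_le0 -expR0 ler_expR ltW.
have := h (- t); rewrite oppr_ge0 => /(_ (ltW t0)) {}h.
apply: (@le_trans _ _ (- t)); first by have := expR_ge1Dx t; lra.
have t1 : 1 <= expR (- t) by rewrite -expR0 ler_expR oppr_ge0 ltW.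
by rewrite ler_peMr // oppr_ge0 ltW.
Qed.

(** Applying [le_ln1Dx] to [1 + t] and to its inverse gives t / (1 + t) <= ln (1 + t) <= t, and the
    gap is t^2 / (1 + t). *)
Lemma normr_ln1D_sub t : - (1 / 2) <= t -> `|ln (1 + t) - t| <= 2 * t ^+ 2.
Proof.
move=> t0; have p0 : 0 < 1 + t by lra.
have h1 : ln (1 + t) <= t by apply: le_ln1Dx; lra.
have h2 : ln (1 - t / (1 + t)) <= - (t / (1 + t)).
  apply: le_ln1Dx; rewrite ltrN2 ltr_pdivrMr //; lra.
have e : 1 - t / (1 + t) = (1 + t)^-1 by field; rewrite gt_eqF.
rewrite e lnV ?posrE // lerN2 in h2.
rewrite ler0_norm ?subr_le0 // opprB.
apply: (@le_trans _ _ (t - t / (1 + t))); first by lra.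
have -> : t - t / (1 + t) = t ^+ 2 / (1 + t) by field; rewrite gt_eqF.
rewrite ler_pdivrMr //; have := sqr_ge0 t; nra.
Qed.

Lemma normr_ln1D t : `|t| <= 1 / 2 -> `|ln (1 + t)| <= 2 * `|t|.
Proof.
move=> th; have /andP[h1 h2] : - (1 / 2) <= t <= 1 / 2 by rewrite -ler_norml.
have := normr_ln1D_sub h1 => h.
have -> : ln (1 + t) = (ln (1 + t) - t) + t by ring.
apply: le_trans (ler_normD _ _) _.
have : t ^+ 2 <= `|t| / 2 by rewrite -real_normK ?num_real // expr2; have := normr_ge0 t; nra.
lra.
Qed.

(* u n = 1 + O(n^(-1/2)), in the logarithmic form that is stable under products *)
Definition asymp1 u := exists C : R,
  \forall n \near \oo, 0 < u n /\ `|ln (u n)| <= C / Num.sqrt n%:R.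

Lemma near_sqrt_ge (K : R) : \forall n \near \oo, K <= Num.sqrt n%:R.
Proof.
exists (Num.bound (K ^+ 2)) => // n /= hn.
have h := archi_boundP (sqr_ge0 K).
apply: le_trans (ler_norm K) _; rewrite -sqrtr_sqr ler_wsqrtr //.
by apply: le_trans (ltW h) _; rewrite ler_nat.
Qed.

Lemma near_sqrt_gt0 : \forall n \near \oo, 0 < Num.sqrt n%:R :> R.
Proof. by near=> n; apply: (lt_le_trans ltr01); near: n; exact: near_sqrt_ge. 
Unshelve. all: end_near. Qed.

Lemma near_div_sqrt_le (C e : R) : 0 < e -> \forall n \near \oo, C / Num.sqrt n%:R <= e.
Proof.
move=> e0; near=> n.
have s0 : 0 < Num.sqrt n%:R :> R by near: n; exact: near_sqrt_gt0.
rewrite ler_pdivrMr // mulrC -ler_pdivrMr //; near: n; exact: near_sqrt_ge.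
Unshelve. all: end_near. Qed.

Lemma asymp1_near u v : (\forall n \near \oo, u n = v n) -> asymp1 u -> asymp1 v.
Proof.
move=> uv [C uC]; exists C; near=> n.
have <- : u n = v n by near: n.
by near: n.
Unshelve. all: end_near. Qed.

Lemma asymp1M u v : asymp1 u -> asymp1 v -> asymp1 (fun n => u n * v n).
Proof.
move=> [C uC] [D vD]; exists (C + D); near=> n.
have [u0 hu] : 0 < u n /\ `|ln (u n)| <= C / Num.sqrt n%:R by near: n.
have [v0 hv] : 0 < v n /\ `|ln (v n)| <= D / Num.sqrt n%:R by near: n.
split; first exact: mulr_gt0.
rewrite lnM ?posrE // mulrDl; exact: le_trans (ler_normD _ _) (lerD hu hv).
Unshelve. all: end_near. Qed.

Lemma asymp1_dist u (C : R) : (\forall n \near \oo, `|u n - 1| <= C / Num.sqrt n%:R) ->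
  asymp1 u.
Proof.
move=> uC; exists (2 * C); near=> n.
have h : `|u n - 1| <= C / Num.sqrt n%:R by near: n.
have h2 : C / Num.sqrt n%:R <= 1 / 2 :> R.
  by near: n; apply: near_div_sqrt_le; lra.
have h3 := le_trans h h2; have := h3; rewrite ler_norml => /andP[h4 h5].
have -> : u n = 1 + (u n - 1) by ring.
split; first lra.
by apply: le_trans (normr_ln1D h3) _; rewrite -mulrA ler_pM2l.
Unshelve. all: end_near. Qed.

Lemma asymp1_distP u : asymp1 u ->
  exists C : R, \forall n \near \oo, `|u n - 1| <= C / Num.sqrt n%:R.
Proof.
move=> [C uC]; exists (C * expR 1); near=> n.
have [u0 hu] : 0 < u n /\ `|ln (u n)| <= C / Num.sqrt n%:R by near: n.
have h2 : C / Num.sqrt n%:R <= 1 :> R by near: n; exact: near_div_sqrt_le.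
have := normr_expR_sub1 (ln (u n)); rewrite lnK ?posrE // => h.
apply: le_trans h _; rewrite mulrAC; apply: ler_pM; rewrite ?expR_ge0 ?normr_ge0 //.
by rewrite ler_expR (le_trans hu).
Unshelve. all: end_near. Qed.

Lemma sqrt_nat_le (n : nat) : Num.sqrt n%:R <= n%:R :> R.
Proof.
case: n => [|n]; first by rewrite sqrtr0.
have h : 1 <= Num.sqrt n.+1%:R :> R.
  have h1 : 1 <= n.+1%:R :> R by rewrite ler1n.
  by have := ler_wsqrtr h1; rewrite sqrtr1.
have := sqr_sqrtr (ler0n R n.+1); rewrite expr2 => e.
by rewrite -[leRHS]e ler_peMl // sqrtr_ge0.
Qed.

Lemma asymp1_dist_nat u (C : R) : (\forall n \near \oo, `|u n - 1| <= C / n%:R) ->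
  asymp1 u.
Proof.
move=> uC; apply: (@asymp1_dist _ `|C|); near=> n.
have s0 : 0 < Num.sqrt n%:R :> R by near: n; exact: near_sqrt_gt0.
have n0 : 0 < n%:R :> R by apply: lt_le_trans s0 (sqrt_nat_le n).
have h : `|u n - 1| <= C / n%:R by near: n.
apply: le_trans h _; apply: (@le_trans _ _ (`|C| / n%:R)).
  by rewrite ler_pM2r ?invr_gt0 // ler_norm.
by rewrite ler_wpM2l // lef_pV2 ?posrE // sqrt_nat_le.
Unshelve. all: end_near. Qed.

(** For the Gamma ratios, which occur at the argument [2 * n] and have an error of order 1 / n. *)
Lemma asymp1_comp_double u : (exists C : R, \forall n \near \oo, `|u n - 1| <= C / n%:R) ->
  asymp1 (fun n => u (2 * n)%N).
Proof.
move=> [C [N _ uN]]; apply: (@asymp1_dist_nat _ `|C|); near=> n.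
have n0 : (0 < n)%N by near: n; exact: nbhs_infty_gt.
have nN : (N <= n)%N by near: n; exact: nbhs_infty_ge.
have := uN (2 * n)%N; rewrite /= => /(_ _)/le_trans -> //.
  by rewrite (leq_trans nN) // leq_pmull.
apply: (@le_trans _ _ (`|C| / (2 * n)%:R)).
  by rewrite ler_pM2r ?invr_gt0 ?ltr0n ?muln_gt0 //= ler_norm.
by rewrite ler_wpM2l // lef_pV2 ?posrE ?ltr0n ?muln_gt0 //= ler_nat leq_pmull.
Unshelve. all: end_near. Qed.
End asymptotics.

(** * The sine product, the Gamma ratio and the Wallis ratio *)

Section sine_product.
Context {R : realType}.
Local Notation mu := (@lebesgue_measure R).
Local Notation J f := (\int[mu]_(t in `[0, pi / 2]) (f t)).

Let pihalf_ge0 : 0 <= pi / 2 :> R. Proof. by rewrite divr_ge0 ?pi_ge0. Qed.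

Let integrableJ (f : R -> R) : continuous f -> mu.-integrable `[0, pi / 2] (EFin \o f).
Proof.
move=> cf; apply: continuous_compact_integrable; first exact: segment_compact.
exact: continuous_subspaceT.
Qed.

Let JD (f g : R -> R) : continuous f -> continuous g ->
  J (fun t => f t + g t) = J f + J g.
Proof.
by move=> cf cg; rewrite RintegralD //; exact: integrableJ.
Qed.

Let JZ (k : R) (f : R -> R) : continuous f -> J (fun t => k * f t) = k * J f.
Proof. by move=> cf; rewrite RintegralZl //; exact: integrableJ. Qed.

Let JB (f g : R -> R) : continuous f -> continuous g ->
  J (fun t => f t - g t) = J f - J g.
Proof.
by move=> cf cg; rewrite RintegralB //; exact: integrableJ.
Qed.

Let J_derive (F f : R -> R) : (forall x : R, is_derive x 1 F (f x)) -> continuous f ->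
  J f = F (pi / 2) - F 0.
Proof. by move=> dF cf; rewrite /Rintegral (integral_derive pihalf_ge0 dF cf). Qed.

Let J_le (f g : R -> R) : continuous f -> continuous g ->
  (forall t, 0 <= t <= pi / 2 -> f t <= g t) -> J f <= J g.
Proof.
move=> cf cg fg; apply: le_Rintegral; [by []|exact: integrableJ|exact: integrableJ|].
by move=> t; rewrite /= in_itv; exact: fg.
Qed.

Lemma continuous_cosM (a : R) : continuous (fun t : R => cos (a * t)).
Proof. by move=> t; apply/differentiable_continuous/derivable1_diffP; exact: ex_derive. Qed.

Lemma is_derive_expn (f : R -> R) (n : nat) (x df : R) : is_derive x 1 f df ->
  is_derive x 1 (fun t => f t ^+ n.+1) (n.+1%:R * f x ^+ n * df).
Proof.
move=> H; have := is_deriveX n.+1 H.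
rewrite (_ : f ^+ n.+1 = fun t => f t ^+ n.+1) //.
by apply/funext => t; elim: n.+1 => [|m IH]; rewrite ?expr0 // !exprS -IH.
Qed.

Lemma continuous_cosX (n : nat) : continuous (fun t : R => cos t ^+ n).
Proof.
by move=> t; apply: (@continuous_comp _ _ _ cos (fun u => u ^+ n));
  [exact: continuous_cos | exact: exprn_continuous].
Qed.

(** The integral behind Euler's sine product: its recursion in [n] produces the factors 1 - a^2 /
    m^2, while its quotient by the value at [a = 0] tends to 1. *)
Definition cosine_integral (a : R) (n : nat) : R :=
  J (fun t => cos (2 * a * t) * cos t ^+ (2 * n)).

Let cI a n : continuous (fun t : R => cos (2 * a * t) * cos t ^+ (2 * n)).
Proof. by move=> t; apply: cvgM; [exact: continuous_cosM | exact: continuous_cosX]. Qed.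

Lemma cosine_integral_rec (a : R) (n : nat) :
  2 * (n.+1%:R ^+ 2 - a ^+ 2) * cosine_integral a n.+1
  = n.+1%:R * (2 * n).+1%:R * cosine_integral a n.
Proof.
rewrite /cosine_integral.
(* An antiderivative that vanishes at both ends: at [pi / 2] through the power of [cos], at 0
   through the two sines. *)
pose F (t : R) := cos t ^+ (2 * n).+1 *
  (a * (sin (2 * a * t) * cos t) - n.+1%:R * (cos (2 * a * t) * sin t)).
pose F' (t : R) := n.+1%:R * (2 * n).+1%:R * (cos (2 * a * t) * cos t ^+ (2 * n))
  + - (2 * (n.+1%:R ^+ 2 - a ^+ 2)) * (cos (2 * a * t) * cos t ^+ (2 * n.+1)).
have cF' : continuous F'.
  by move=> t; apply: cvgD; apply: cvgM; (try exact: cvg_cst); exact: cI.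
have dF (t : R) : is_derive t 1 F (F' t).
  have H1 := is_derive_expn (2 * n) (is_derive_cos t).
  rewrite /F; apply: is_derive_eq; rewrite /F' /GRing.scale /=.
  have -> : (2 * n.+1 = (2 * n).+2)%N by rewrite mulnS.
  rewrite !exprS -!natr1 natrM.
  have S2 : sin t * sin t = 1 - cos t * cos t by rewrite -!expr2 -(cos2Dsin2 t); ring.
  by ring: S2.
have := J_derive dF cF'.
rewrite JD ?JZ //.
- have -> : F (pi / 2) = 0 by rewrite /F cos_pihalf exprS mul0r mul0r.
  have -> : F 0 = 0 by rewrite /F mulr0 sin0 mul0r !mulr0 subrr mulr0.
  by rewrite subrr => h; lra.
- by move=> t; apply: cvgM; [exact: cvg_cst|exact: cI].
- by move=> t; apply: cvgM; [exact: cvg_cst|exact: cI].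
Qed.

Lemma cosine_integral00 : cosine_integral 0 0 = pi / 2.
Proof.
have c1 : continuous (fun _ : R => 1 : R) by move=> x; exact: cvg_cst.
have := J_derive (fun t : R => is_derive_id t 1) c1; rewrite subr0 => <-.
by apply: eq_Rintegral => t _; rewrite mulr0 mul0r cos0 muln0 expr0 mul1r.
Qed.

Lemma cosine_integral_a0 (a : R) : 2 * a * cosine_integral a 0 = sin (pi * a).
Proof.
have dF (t : R) : is_derive t 1 (fun t => sin (2 * a * t)) (2 * a * cos (2 * a * t)).
  by apply: is_derive_eq; rewrite /GRing.scale /=; ring.
have cF' : continuous (fun t : R => 2 * a * cos (2 * a * t)).
  by move=> t; apply: cvgM; [exact: cvg_cst|exact: continuous_cosM].
have := J_derive dF cF'; rewrite mulr0 sin0 subr0 JZ; last exact: continuous_cosM.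
have -> : 2 * a * (pi / 2) = pi * a by field.
move=> <-; congr (_ * _).
by apply: eq_Rintegral => t _; rewrite muln0 expr0 mulr1.
Qed.

Definition sine_prod (a : R) (n : nat) : R := \prod_(m < n) (1 - a ^+ 2 / m.+1%:R ^+ 2).

Lemma sine_prod_cosine_integral (a : R) (n : nat) :
  sine_prod a n * (pi * a) * cosine_integral a n = sin (pi * a) * cosine_integral 0 n.
Proof.
elim: n => [|n IH].
  rewrite /sine_prod big_ord0 cosine_integral00 -cosine_integral_a0; by field.
have Nn0 : n.+1%:R != 0 :> R by rewrite pnatr_eq0.
have h1 := cosine_integral_rec a n; have h2 := cosine_integral_rec 0 n.
have e1 : (1 - a ^+ 2 / n.+1%:R ^+ 2) * cosine_integral a n.+1
    = (2 * n).+1%:R / (2 * n.+1%:R) * cosine_integral a n.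
  apply: (@mulfI _ (2 * n.+1%:R ^+ 2)); first by rewrite mulf_neq0 ?expf_neq0.
  transitivity (n.+1%:R * (2 * n).+1%:R * cosine_integral a n); last by field.
  by rewrite -h1; field.
have e2 : cosine_integral 0 n.+1 = (2 * n).+1%:R / (2 * n.+1%:R) * cosine_integral 0 n.
  apply: (@mulfI _ (2 * n.+1%:R ^+ 2)); first by rewrite mulf_neq0 ?expf_neq0.
  transitivity (n.+1%:R * (2 * n).+1%:R * cosine_integral 0 n); last by field.
  by rewrite -h2 expr0n /= subr0.
rewrite /sine_prod big_ord_recr /= -/(sine_prod a n) e2.
rewrite [RHS]mulrCA -IH.
rewrite [RHS]mulrCA -e1.
by ring.
Qed.

Lemma cosine_integral_gt0 n : 0 < cosine_integral 0 n.
Proof.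
elim: n => [|n IH]; first by rewrite cosine_integral00 divr_gt0 ?pi_gt0.
have h2 := cosine_integral_rec 0 n.
rewrite -(@pmulr_rgt0 _ (2 * (n.+1%:R ^+ 2 - 0 ^+ 2))) ?h2.
  by rewrite !mulr_gt0 ?ltr0n.
by rewrite expr0n subr0 mulr_gt0 ?exprn_gt0 ?ltr0n.
Qed.

Lemma normr_sin_le (x : R) : `|sin x| <= `|x|.
Proof.
wlog x0 : x / 0 <= x => [H|].
  have [/H //|x0] := leP 0 x.
  by rewrite -normrN -sinN -[leRHS]normrN; apply: H; rewrite oppr_ge0 ltW.
have [c _] := MVT_segment x0 (fun z _ => is_derive_sin z) (continuous_subspaceT (@continuous_sin R)).
rewrite sin0 !subr0 => ->; rewrite normrM -[leRHS]mul1r ler_wpM2r //; exact: cos_max.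
Qed.

Lemma mulr_cos_le_sin (t : R) : 0 <= t <= pi / 2 -> t * cos t <= sin t.
Proof.
move=> /andP[t0 t1].
have [c] := MVT_segment t0 (fun z _ => is_derive_sin z) (continuous_subspaceT (@continuous_sin R)).
rewrite in_itv /= sin0 !subr0 => /andP[c0 ct] ->; rewrite mulrC ler_wpM2r //.
have pi2 : pi / 2 <= pi :> R by have := pi_ge0 R; lra.
have cpi : c <= pi by rewrite (le_trans ct) // (le_trans t1).
rewrite leNgt; apply/negP; rewrite ltr_cos ?in_itv /= ?c0 ?t0 ?(le_trans t1) //.
by rewrite ltNge ct.
Qed.

(** 1 - cos (2 a t) = 2 sin^2 (a t) <= 2 a^2 t^2, and t cos t <= sin t trades t^2 cos^2 t for 1 -
    cos^2 t. So the difference of the integrals is at most 2 a^2 times the difference of two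
    consecutive integrals at [a = 0], which the recursion evaluates. *)
Lemma cosine_integral_bound (a : R) (n : nat) :
  `|cosine_integral a n.+1 / cosine_integral 0 n.+1 - 1| <= 2 * a ^+ 2 / (2 * n).+1%:R.
Proof.
have I0 := cosine_integral_gt0 n.+1.
set D := cosine_integral 0 n.+1 - cosine_integral a n.+1.
have Dp (t : R) : 0 <= t <= pi / 2 -> 0 <= cos (2 * 0 * t) * cos t ^+ (2 * n.+1) - cos (2 * a * t) * cos t ^+ (2 * n.+1)
    <= 2 * a ^+ 2 * (cos (2 * 0 * t) * cos t ^+ (2 * n) - cos (2 * 0 * t) * cos t ^+ (2 * n.+1)).
  move=> t01; rewrite mulr0 mul0r cos0 !mul1r.
  have E : cos (2 * a * t) = 1 - 2 * sin (a * t) ^+ 2.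
    have -> : 2 * a * t = (a * t) *+ 2 by rewrite -mulr_natl; ring.
    have h := cos2Dsin2 (a * t).
    by rewrite cos_mulr2n -mulr_natl; lra.
  have -> : cos t ^+ (2 * n.+1) = cos t ^+ 2 * (cos t ^+ n) ^+ 2.
    by rewrite mulnS exprD mulnC exprM.
  have -> : cos t ^+ (2 * n) = (cos t ^+ n) ^+ 2 by rewrite mulnC exprM.
  rewrite E; move: (sqr_ge0 (cos t ^+ n)); move: ((cos t ^+ n) ^+ 2) => X X0.
  have -> : cos t ^+ 2 * X - (1 - 2 * sin (a * t) ^+ 2) * (cos t ^+ 2 * X)
      = 2 * X * (sin (a * t) ^+ 2 * cos t ^+ 2) by ring.
  have P0 : 0 <= 2 * X by rewrite mulr_ge0.
  rewrite (mulr_ge0 P0 (mulr_ge0 (sqr_ge0 _) (sqr_ge0 _))) /=.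
  have -> : 2 * a ^+ 2 * (X - cos t ^+ 2 * X) = 2 * X * (a ^+ 2 * sin t ^+ 2).
    have -> : sin t ^+ 2 = 1 - cos t ^+ 2 by rewrite -(cos2Dsin2 t); ring.
    by ring.
  rewrite (ler_wpM2l P0) //.
  apply: (@le_trans _ _ ((a * t) ^+ 2 * cos t ^+ 2)).
    rewrite ler_wpM2r ?sqr_ge0 //.
    have hs := normr_sin_le (a * t); rewrite -ler_sqr ?nnegrE // in hs.
    by rewrite !real_normK ?num_real // in hs.
  have c0 : 0 <= cos t.
    apply: cos_ge0_pihalf; case/andP: t01 => h1 h2; apply/andP; split => //.
    by move: pihalf_ge0 h1; lra.
  have s0 : 0 <= t * cos t by case/andP: t01 => h1 _; exact: mulr_ge0.
  have hs := mulr_cos_le_sin t01.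
  rewrite exprMn -mulrA ler_wpM2l ?sqr_ge0 // -exprMn ler_sqr ?nnegrE //.
  exact: le_trans hs.
pose f (t : R) := cos (2 * 0 * t) * cos t ^+ (2 * n.+1) - cos (2 * a * t) * cos t ^+ (2 * n.+1).
pose g (t : R) := cos (2 * 0 * t) * cos t ^+ (2 * n) - cos (2 * 0 * t) * cos t ^+ (2 * n.+1).
have cf : continuous f by move=> t; apply: cvgB; exact: cI.
have cg : continuous g by move=> t; apply: cvgB; exact: cI.
have Df : J f = D by rewrite JB //; exact: cI.
have Dg : J g = cosine_integral 0 n - cosine_integral 0 n.+1 by rewrite JB //; exact: cI.
have D0 : 0 <= D by rewrite -Df; apply: Rintegral_ge0 => t; rewrite /= in_itv => /Dp /andP[].
have D1 : D <= 2 * a ^+ 2 * (cosine_integral 0 n - cosine_integral 0 n.+1).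
  rewrite -Df -Dg -JZ //; apply: J_le => //.
    by move=> t; apply: cvgM; [exact: cvg_cst | exact: cg].
  by move=> t /Dp /andP[].
have h2 := cosine_integral_rec 0 n; rewrite expr0n /= subr0 in h2.
have N0 : 0 < n.+1%:R :> R by rewrite ltr0n.
have M0 : 0 < (2 * n).+1%:R :> R by rewrite ltr0n.
have eM : (2 * n).+1%:R = 2 * n.+1%:R - 1 :> R by rewrite -!natr1 natrM; ring.
have h3 : (2 * n).+1%:R * (cosine_integral 0 n - cosine_integral 0 n.+1) = cosine_integral 0 n.+1.
  apply: (mulfI (lt0r_neq0 N0)); rewrite mulrBr mulrBr mulrA -h2 eM; ring.
rewrite -[X in _ - X](divff (lt0r_neq0 I0)) -mulrBl normrM normrV ?unitfE ?gt_eqF //.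
rewrite (gtr0_norm I0) distrC ger0_norm // ler_pdivrMr // mulrAC ler_pdivlMr //.
apply: le_trans (ler_wpM2r (ltW M0) D1) _.
suff -> : 2 * a ^+ 2 * (cosine_integral 0 n - cosine_integral 0 n.+1) * (2 * n).+1%:R
    = 2 * a ^+ 2 * cosine_integral 0 n.+1 by [].
by rewrite -[in RHS]h3; ring.
Qed.
End sine_product.

(** * Comparison of Gamma (N + 1 + a) with N^a N! *)

Section gamma_asymptotics.
Context {R : realType}.
Local Notation mu := (@lebesgue_measure R).

(** Convexity of the exponential between 0 and [y]. Taken at [y = x - ln N] under the weight of
    Gamma (N + 1), it bounds Gamma (N + 1 + a) by Gamma values at integers. *)
Lemma expR_interp_le (a y : R) : 0 <= a <= 1 -> expR (a * y) <= 1 - a + a * expR y.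
Proof.
move=> /andP[a0 a1].
have h1 := expR_ge1Dx (- (a * y)); have h2 := expR_ge1Dx ((1 - a) * y).
have e : expR y = expR (a * y) * expR ((1 - a) * y) by rewrite -expRD; congr expR; ring.
have e' : expR (a * y) * expR (- (a * y)) = 1 by rewrite -expRD subrr expR0.
rewrite e; have p := expR_gt0 (a * y).
have h : 1 <= (1 - a) * expR (- (a * y)) + a * expR ((1 - a) * y).
  have := ler_wpM2l a0 h2; have a1' : 0 <= 1 - a by lra.
  have := ler_wpM2l a1' h1; lra.
have := ler_wpM2l (ltW p) h; rewrite mulr1 mulrDr mulrCA e'; lra.
Qed.

(** Convexity again: [y] is the mean of [a * y] and [2 * y] with weights 1 / (2 - a) and (1 - a) /
    (2 - a). *)
Lemma expR_interp_ge (a y : R) : 0 <= a <= 1 ->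
  (2 - a) * expR y <= expR (a * y) + (1 - a) * expR (2 * y).
Proof.
move=> /andP[a0 a1].
have h1 := expR_ge1Dx (- ((1 - a) * y)); have h2 := expR_ge1Dx y.
have e : expR (a * y) = expR y * expR (- ((1 - a) * y)) by rewrite -expRD; congr expR; ring.
have e2 : expR (2 * y) = expR y * expR y by rewrite -expRD; congr expR; ring.
rewrite e e2; have p := expR_gt0 y.
have h : 2 - a <= expR (- ((1 - a) * y)) + (1 - a) * expR y.
  have a1' : 0 <= 1 - a by lra.
  have := ler_wpM2l a1' h2; lra.
have := ler_wpM2l (ltW p) h; lra.
Qed.

Lemma Gamma_le_lin (s0 s1 s2 c0 c1 c2 : R) : 0 < s0 -> 0 < s1 -> 0 < s2 ->
  0 <= c0 -> 0 <= c1 -> 0 <= c2 ->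
  (forall x, c0 * logGammaF s0 1 x <= c1 * logGammaF s1 1 x + c2 * logGammaF s2 1 x) ->
  c0 * Gamma s0 <= c1 * Gamma s1 + c2 * Gamma s2.
Proof.
move=> p0 p1 p2 q0 q1 q2 H.
have mZ c s : measurable_fun setT (fun x : R => c * logGammaF s 1 x).
  by apply: measurable_funM => //; exact: measurable_logGammaF.
have Z0 c s x : 0 <= c -> 0 <= c * logGammaF s 1 x :> R.
  by move=> c0'; rewrite mulr_ge0 // logGammaF_ge0.
have I c s : 0 < s -> 0 <= c ->
    (\int[mu]_x (c * logGammaF s 1 x)%:E = (c * Gamma s)%:E)%E.
  move=> sp cp; rewrite ge0_integralT_Zl //; [|exact: measurable_logGammaF|exact: logGammaF_ge0].
  by rewrite EFinM (GammaE sp).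
have K : (\int[mu]_x (c0 * logGammaF s0 1 x)%:E
    <= \int[mu]_x (c1 * logGammaF s1 1 x + c2 * logGammaF s2 1 x)%:E)%E.
  by apply: ge0_integralT_le; [exact: mZ|by apply: measurable_funD; exact: mZ|
    by move=> x; exact: Z0|exact: H].
rewrite ge0_integralT_D in K;
  [|exact: mZ|exact: mZ|by move=> x; exact: Z0|by move=> x; exact: Z0].
by rewrite (I _ _ p0 q0) (I _ _ p1 q1) (I _ _ p2 q2) in K.
Qed.

Lemma logGammaFD (s t x : R) : logGammaF (s + t) 1 x = expR (t * x) * logGammaF s 1 x.
Proof. by rewrite /logGammaF -expRD; congr expR; ring. Qed.

Lemma Gamma_nat1 (N : nat) : Gamma (N%:R + 1) = (N`!)%:R :> R.
Proof. by rewrite natr1 Gamma_natS. Qed.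

Lemma expR_scaled (a x : R) (N : nat) : (0 < N)%N ->
  expR (a * x) = N%:R `^ a * expR (a * (x - ln N%:R)).
Proof.
move=> N0; rewrite /powR gt_eqF ?ltr0n // -expRD; congr expR; ring.
Qed.

Lemma expR_subln (x : R) (N : nat) : (0 < N)%N -> expR (x - ln N%:R) = expR x / N%:R.
Proof. by move=> N0; rewrite expRD expRN lnK // posrE ltr0n. Qed.

Lemma Gamma_le_interp (a : R) (N : nat) : (0 < N)%N -> 0 <= a <= 1 ->
  Gamma (N%:R + 1 + a) <= N%:R `^ a * (N`!)%:R * (1 + a / N%:R).
Proof.
move=> N0 a01; have /andP[a0 a1] := a01.
have Np : 0 < N%:R :> R by rewrite ltr0n.
have Na : 0 <= N%:R `^ a :> R by exact: powR_ge0.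
have Nv : 0 <= N%:R^-1 :> R by rewrite invr_ge0 ltW.
have := @Gamma_le_lin (N%:R + 1 + a) (N%:R + 1) (N%:R + 1 + 1) 1
  (N%:R `^ a * (1 - a)) (N%:R `^ a * (a / N%:R)).
rewrite !mul1r (Gamma_rec (s := N%:R + 1)) ?Gamma_nat1; last by lra.
have -> : N%:R `^ a * (1 - a) * N`!%:R + N%:R `^ a * (a / N%:R) * ((N%:R + 1) * N`!%:R)
   = N%:R `^ a * N`!%:R * (1 + a / N%:R) by field; rewrite gt_eqF.
apply => //; try lra.
- by rewrite mulr_ge0 // subr_ge0.
- by rewrite mulr_ge0 // mulr_ge0.
move=> x; rewrite mul1r (logGammaFD _ a) (logGammaFD (N%:R + 1) 1) mul1r mulrA -mulrDl.
apply: ler_wpM2r; first exact: logGammaF_ge0.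
rewrite (expR_scaled a x N0) -!mulrA -mulrDr ler_wpM2l //.
apply: le_trans (expR_interp_le _ a01) _.
by rewrite expR_subln // [N%:R^-1 * _]mulrC.
Qed.

Lemma Gamma_ge_interp (a : R) (N : nat) : (0 < N)%N -> 0 <= a <= 1 ->
  N%:R `^ a * (N`!)%:R * (1 - 3 / N%:R) <= Gamma (N%:R + 1 + a).
Proof.
move=> N0 a01; have /andP[a0 a1] := a01.
have Np : 0 < N%:R :> R by rewrite ltr0n.
have Na : 0 <= N%:R `^ a :> R by exact: powR_ge0.
have Nv : 0 < N%:R^-1 :> R by rewrite invr_gt0.
have Nv1 : N%:R^-1 <= 1 :> R by rewrite invf_le1 // ler1n.
have := @Gamma_le_lin (N%:R + 1 + 1) (N%:R + 1 + a) (N%:R + 1 + 1 + 1)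
  (N%:R `^ a * ((2 - a) / N%:R)) 1 (N%:R `^ a * ((1 - a) / N%:R ^+ 2)).
rewrite !mul1r (Gamma_rec (s := N%:R + 1 + 1)); last by lra.
rewrite (Gamma_rec (s := N%:R + 1)) ?Gamma_nat1; last by lra.
move=> H.
have {}H : N%:R `^ a * ((2 - a) / N%:R) * ((N%:R + 1) * N`!%:R) <=
    Gamma (N%:R + 1 + a) + N%:R `^ a * ((1 - a) / N%:R ^+ 2) * ((N%:R + 1 + 1) * ((N%:R + 1) * N`!%:R)).
  apply: H; try lra.
  - by rewrite mulr_ge0 // mulr_ge0 ?ltW //; lra.
  - by rewrite mulr_ge0 // divr_ge0 ?exprn_ge0 //; lra.
  - move=> x; rewrite mul1r (logGammaFD _ a) (logGammaFD (N%:R + 1 + 1) 1).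
    rewrite (logGammaFD (N%:R + 1) 1) !mul1r !mulrA -mulrDl.
    apply: ler_wpM2r; first exact: logGammaF_ge0.
    rewrite (expR_scaled a x N0) -!mulrA -mulrDr ler_wpM2l //.
    have := expR_interp_ge (x - ln N%:R) a01.
    have -> : 2 * (x - ln N%:R) = (x - ln N%:R) + (x - ln N%:R) by ring.
    rewrite (expRD (x - ln N%:R) (x - ln N%:R)) expR_subln // => h.
    rewrite [N%:R^-1 * _]mulrC.
    apply: le_trans h _; rewrite lerD2l le_eqVlt; apply/orP; left; apply/eqP.
    by field; rewrite gt_eqF.
have F0 : 0 <= N%:R `^ a * N`!%:R :> R by rewrite mulr_ge0.
have E : N%:R `^ a * ((2 - a) / N%:R) * ((N%:R + 1) * N`!%:R)
   - N%:R `^ a * ((1 - a) / N%:R ^+ 2) * ((N%:R + 1 + 1) * ((N%:R + 1) * N`!%:R))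
   = N%:R `^ a * N`!%:R * (1 + (2 * a - 1) * N%:R^-1 - 2 * (1 - a) * N%:R^-1 ^+ 2).
  by field; rewrite gt_eqF.
(* The interpolation gives the factor 1 + (2 a - 1) / N - 2 (1 - a) / N^2; 1 - 3 / N is a crude
   lower bound for it, uniform in [a] between 0 and 1. *)
apply: (@le_trans _ _ (N%:R `^ a * N`!%:R * (1 + (2 * a - 1) * N%:R^-1 - 2 * (1 - a) * N%:R^-1 ^+ 2))).
  rewrite ler_wpM2l //; move: (N%:R^-1) Nv Nv1 => e e0 e1; nra.
by rewrite -E; lra.
Qed.

Definition Gamma_ratio (a : R) (N : nat) := Gamma (N%:R + 1 + a) / (N%:R `^ a * (N`!)%:R).

Lemma Gamma_ratio01 (a : R) : 0 <= a <= 1 ->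
  exists C : R, \forall N \near \oo, `|Gamma_ratio a N - 1| <= C / N%:R.
Proof.
move=> a01; have /andP[a0 a1] := a01; exists 3; near=> N.
have N0 : (0 < N)%N by near: N; exact: nbhs_infty_gt.
have Np : 0 < N%:R :> R by rewrite ltr0n.
have Nv : 0 < N%:R^-1 :> R by rewrite invr_gt0.
have X0 : 0 < N%:R `^ a * N`!%:R :> R by rewrite mulr_gt0 ?powR_gt0 // ltr0n fact_gt0.
have h1 := Gamma_le_interp N0 a01; have h2 := Gamma_ge_interp N0 a01.
have g1 : Gamma_ratio a N <= 1 + a / N%:R by rewrite ler_pdivrMr // mulrC.
have g2 : 1 - 3 / N%:R <= Gamma_ratio a N by rewrite ler_pdivlMr // mulrC.
have g3 : a / N%:R <= 3 / N%:R by rewrite ler_pM2r //; lra.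
by rewrite ler_norml; apply/andP; split; lra.
Unshelve. all: end_near. Qed.

Lemma Gamma_ratio_rec (a : R) (N : nat) : (0 < N)%N -> -1 < a ->
  Gamma_ratio (a + 1) N = Gamma_ratio a N * (1 + (a + 1) / N%:R).
Proof.
move=> N0 a1; have Np : 0 < N%:R :> R by rewrite ltr0n.
rewrite /Gamma_ratio addrA Gamma_rec; last by lra.
rewrite powRD ?(gt_eqF Np) ?implybT // powRr1 ?ltW //.
by field; rewrite !gt_eqF ?powR_gt0 ?ltr0n ?fact_gt0.
Qed.

(** Interpolation covers 0 <= a <= 1, and each unit shift costs a factor 1 + O(1 / N). The claim is
    proved at [a + 1], which is positive, and then carried one step down, so that -1 < a < 0 is
    included. *)
Lemma Gamma_ratio_asymp (a : R) : -1 < a ->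
  exists C : R, \forall N \near \oo, `|Gamma_ratio a N - 1| <= C / N%:R.
Proof.
move=> a1.
have up (c C : R) : -1 < c -> (\forall N \near \oo, `|Gamma_ratio c N - 1| <= C / N%:R) ->
    exists C' : R, \forall N \near \oo, `|Gamma_ratio (c + 1) N - 1| <= C' / N%:R.
  move=> c1 HC; exists (C + (c + 1) * (1 + `|C|)); near=> N.
  have N0 : (0 < N)%N by near: N; exact: nbhs_infty_gt.
  have Nv : 0 < N%:R^-1 :> R by rewrite invr_gt0 ltr0n.
  have Nv1 : N%:R^-1 <= 1 :> R by rewrite invf_le1 ?ler1n ?ltr0n.
  have h : `|Gamma_ratio c N - 1| <= C / N%:R by near: N.
  rewrite Gamma_ratio_rec //; move: (Gamma_ratio c N) h => G h.
  have -> : G * (1 + (c + 1) / N%:R) - 1 = (G - 1) + (c + 1) * N%:R^-1 * G by ring.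
  apply: le_trans (ler_normD _ _) _; rewrite [(C + _) * _]mulrDl; apply: lerD => //.
  have K0 : 0 <= (c + 1) * N%:R^-1 by rewrite mulr_ge0 ?(ltW Nv) //; lra.
  rewrite normrM (ger0_norm K0) [leRHS]mulrAC ler_wpM2l //.
  have -> : G = 1 + (G - 1) by ring.
  apply: le_trans (ler_normD _ _) _; rewrite normr1 lerD2l (le_trans h) //.
  apply: (@le_trans _ _ (`|C| * N%:R^-1)).
    by rewrite ler_pM2r ?ler_norm.
  by rewrite ler_piMr.
have [c [k [c01 cE]]] : exists c : R, exists k : nat, 0 <= c <= 1 /\ c + k%:R = a + 1.
  have a2 : 0 <= a + 1 by lra.
  exists (a + 1 - (Num.trunc (a + 1))%:R), (Num.trunc (a + 1)); split; last by ring.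
  by have /andP[h1 h2] := truncn_itv a2; rewrite -natr1 in h2; apply/andP; split; lra.
suff H : exists C : R, \forall N \near \oo, `|Gamma_ratio (a + 1) N - 1| <= C / N%:R.
  have [C HC] := H; exists (C + (a + 1)); near=> N.
  have N0 : (0 < N)%N by near: N; exact: nbhs_infty_gt.
  have Nv : 0 < N%:R^-1 :> R by rewrite invr_gt0 ltr0n.
  have h : `|Gamma_ratio (a + 1) N - 1| <= C / N%:R by near: N.
  move: h; rewrite Gamma_ratio_rec //.
  have K0 : 0 <= (a + 1) / N%:R by rewrite mulr_ge0 ?(ltW Nv) //; lra.
  move=> h; rewrite [leRHS]mulrDl; move: h; move: (Gamma_ratio a N) ((a + 1) / N%:R) K0 (C / N%:R) => G K K0 D h.
  have -> : G - 1 = (G * (1 + K) - 1 - K) / (1 + K) by field; rewrite gt_eqF //; lra.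
  have K1 : 0 < 1 + K by lra.
  rewrite normrM normfV (gtr0_norm K1) ler_pdivrMr //.
  apply: le_trans (ler_normB _ _) _; rewrite (ger0_norm K0).
  have D0 := le_trans (normr_ge0 _) h.
  by apply: le_trans (lerD h (lexx K)) _; rewrite ler_peMr; lra.
rewrite -cE; elim: k {cE} => [|k [C IH]].
  by rewrite addr0; exact: Gamma_ratio01.
rewrite -natr1 addrA; apply: up IH.
by have := ler0n R k; case/andP: c01; lra.
Unshelve. all: end_near. Qed.
End gamma_asymptotics.

(** * Limit of the sine product and the Wallis ratio *)

Section wallis.
Context {R : realType}.

Lemma sine_prod_neq0 (a : R) (n : nat) : (forall m : nat, a ^+ 2 != m%:R ^+ 2) ->
  sine_prod a n != 0.
Proof.
move=> am; rewrite /sine_prod; apply/prodf_neq0 => m _.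
rewrite subr_eq0 eq_sym -subr_eq0; have mn0 : m.+1%:R ^+ 2 != 0 :> R by rewrite expf_neq0 // pnatr_eq0.
by rewrite -[X in _ - X](divff mn0) -mulrBl mulf_neq0 ?invr_neq0 // subr_eq0.
Qed.

Lemma sine_prod_asymp (a : R) : (forall m : nat, a ^+ 2 != m%:R ^+ 2) ->
  sin (pi * a) != 0 /\
  exists C : R, \forall n \near \oo, 0 < sine_prod a n * (pi * a) / sin (pi * a) /\
    `|ln (sine_prod a n * (pi * a) / sin (pi * a))| <= C / n%:R.
Proof.
move=> am.
have q0 : 0 <= 2 * a ^+ 2 by rewrite mulr_ge0 // sqr_ge0.
have bnd (n : nat) : (0 < n)%N ->
    `|cosine_integral a n / cosine_integral 0 n - 1| <= 2 * a ^+ 2 / n%:R.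
  case: n => // m _; apply: le_trans (cosine_integral_bound a m) _.
  rewrite ler_wpM2l // lef_pV2 ?posrE ?ltr0n // ler_nat.
  by rewrite ltnS leq_pmull.
have [N HN] : exists N : nat, 2 * a ^+ 2 <= N%:R / 2 /\ (0 < N)%N.
  exists (Num.bound (4 * a ^+ 2)).+1; split => //.
  have h : 0 <= 4 * a ^+ 2 by lra.
  by have := archi_boundP h; rewrite -natr1; lra.
have small (n : nat) : (N <= n)%N ->
    `|cosine_integral a n / cosine_integral 0 n - 1| <= 1 / 2.
  move=> Nn; have n0 : (0 < n)%N by apply: leq_trans Nn; case: HN.
  apply: le_trans (bnd n n0) _; rewrite ler_pdivrMr ?ltr0n //.
  case: HN => h _; apply: le_trans h _.
  have : N%:R <= n%:R :> R by rewrite ler_nat.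
  lra.
(* A vanishing sine would force [cosine_integral a N = 0], although its ratio to
   [cosine_integral 0 N] is within 1 / 2 of 1. *)
have s0 : sin (pi * a) != 0.
  apply/eqP => sn.
  have := sine_prod_cosine_integral a N; rewrite sn mul0r.
  move=> /eqP; rewrite !mulf_eq0 (negbTE (sine_prod_neq0 N am)) gt_eqF ?pi_gt0 //=.
  have a0 : a == 0 = false.
    by apply/negbTE; have := am 0%N; rewrite expr0n /= sqrf_eq0.
  rewrite a0 /= => /eqP I0.
  have := small N (leqnn N); rewrite I0 mul0r sub0r normrN normr1; lra.
split => //; exists (4 * a ^+ 2); near=> n.
have Nn : (N <= n)%N by near: n; exact: nbhs_infty_ge.
have n0 : (0 < n)%N by apply: leq_trans Nn; case: HN.
have := small n Nn => sm; have := bnd n n0 => bd.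
have I0 := cosine_integral_gt0 n.
set r := cosine_integral a n / cosine_integral 0 n in sm bd.
have r0 : 0 < r by move: sm; rewrite ler_norml => /andP[]; lra.
have -> : sine_prod a n * (pi * a) / sin (pi * a) = r^-1.
  rewrite /r invf_div; apply: (mulIf s0); rewrite divfK //.
  have Ia : cosine_integral a n != 0.
    by apply/eqP => h; move: r0; rewrite /r h mul0r ltxx.
  apply: (mulIf Ia); rewrite sine_prod_cosine_integral; field => //.
rewrite invr_gt0 r0 lnV ?posrE // normrN; split => //.
have -> : r = 1 + (r - 1) by ring.
apply: le_trans (normr_ln1D sm) _.
have -> : 4 * a ^+ 2 / n%:R = 2 * (2 * a ^+ 2 / n%:R) by field; rewrite pnatr_eq0 -lt0n.
by rewrite ler_pM2l.
Unshelve. all: end_near. Qed.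

(** The central binomial coefficient over 4^n. It appears in [qratio] when [j!^2] is exchanged for
    the [(2 j)!] of the cosh weights. *)
Definition wallis (n : nat) : R := (2 * n)`!%:R / (n`!%:R ^+ 2 * 4 ^+ n).

Lemma wallis_gt0 n : 0 < wallis n.
Proof. by rewrite divr_gt0 ?mulr_gt0 ?exprn_gt0 ?ltr0n ?fact_gt0. Qed.

Lemma wallis_rec n : wallis n.+1 = wallis n * ((2 * n).+1%:R / (2 * n.+1)%:R).
Proof.
have E : (2 * n.+1)`!%:R = (2 * n.+1)%:R * (2 * n).+1%:R * (2 * n)`!%:R :> R.
  by rewrite (_ : (2 * n.+1 = (2 * n).+2)%N) ?mulnS // 2!factS natrM natrM mulrA.
rewrite /wallis E factS !natrM [4 ^+ n.+1]exprS; field.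
by rewrite nat1r !pnatr_eq0 -!lt0n fact_gt0 expf_neq0 ?pnatr_eq0.
Qed.

Lemma wallis_sine_prod n : sine_prod (1 / 2) n = (2 * n).+1%:R * wallis n ^+ 2.
Proof.
elim: n => [|n IH]; first by rewrite /sine_prod big_ord0 /wallis muln0 fact0 expr0 expr1n !mulr1 divr1 expr1n mulr1.
rewrite /sine_prod big_ord_recr /= -/(sine_prod _ n) IH wallis_rec.
have e : (2 * n.+1).+1%:R = 2 * n.+1%:R + 1 :> R by rewrite -natr1 natrM.
have e2 : (2 * n).+1%:R = 2 * n.+1%:R - 1 :> R by rewrite -!natr1 natrM; ring.
rewrite e e2 natrM; field; by rewrite nat1r pnatr_eq0.
Qed.

(** (2 n + 1) [wallis n ^+ 2] is the partial sine product at 1 / 2, which tends to 2 / pi; the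
    correction from 2 n + 1 to 2 n is of order 1 / n. *)
Lemma wallis_asymp : exists C : R, \forall n \near \oo,
  `|ln (wallis n) + ln (pi * n%:R) / 2| <= C / n%:R.
Proof.
have am (m : nat) : (1 / 2) ^+ 2 != m%:R ^+ 2 :> R.
  apply/eqP => h; have : (1 : R) = (2 * m)%:R ^+ 2 by rewrite natrM exprMn -h; field.
  move/eqP; rewrite -natrX -[X in X == _]/(1%:R) eqr_nat expnMn.
  by case: m {h} => [|m] //; rewrite expnS; lia.
have [_ [C HC]] := sine_prod_asymp am.
have e1 : pi * (1 / 2) = pi / 2 :> R by rewrite mul1r.
have {}HC : \forall n \near \oo, `|ln (sine_prod (1 / 2) n * (pi / 2))| <= C / n%:R.
  by apply: filterS HC => n [_]; rewrite e1 sin_pihalf divr1.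
exists (C / 2 + 1); near=> n.
have n0 : (0 < n)%N by near: n; exact: nbhs_infty_gt.
have np : 0 < n%:R :> R by rewrite ltr0n.
have nv : 0 < n%:R^-1 :> R by rewrite invr_gt0.
have w0 := wallis_gt0 n.
have h : `|ln (sine_prod (1 / 2) n * (pi / 2))| <= C / n%:R by near: n.
rewrite wallis_sine_prod in h.
have t0 : 0 < 1 + 1 / (2 * n%:R) :> R by rewrite addr_gt0 // divr_gt0 // mulr_gt0.
have E : (2 * n).+1%:R * wallis n ^+ 2 * (pi / 2) = wallis n ^+ 2 * (pi * n%:R) * (1 + 1 / (2 * n%:R)).
  by rewrite -natr1 natrM; field; rewrite gt_eqF.
have pn : 0 < pi * n%:R :> R by rewrite mulr_gt0 ?pi_gt0.
have w2 := exprn_gt0 2 w0; have wp := mulr_gt0 w2 pn.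
rewrite E lnM ?posrE // lnM ?posrE // lnXn // in h.
have h2 : `|ln (1 + 1 / (2 * n%:R))| <= n%:R^-1 :> R.
  rewrite ger0_norm ?ln_ge0 ?lerDl ?divr_ge0 ?mulr_ge0 //.
  have h1 : ln (1 + 1 / (2 * n%:R)) <= 1 / (2 * n%:R) :> R.
    by apply: le_ln1Dx; rewrite (lt_le_trans (ltrN10 _)) // divr_ge0 // mulr_ge0.
  apply: le_trans h1 _; rewrite invfM mulrA; nra.
have -> : ln (wallis n) + ln (pi * n%:R) / 2 =
   ((ln (wallis n) *+ 2 + ln (pi * n%:R) + ln (1 + 1 / (2 * n%:R))) - ln (1 + 1 / (2 * n%:R))) / 2.
  by rewrite mulr2n; field.
rewrite normrM (gtr0_norm (x := 2^-1)) // ler_pdivrMr //.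
apply: le_trans (ler_normB _ _) _; apply: le_trans (lerD h h2) _.
have -> : (C / 2 + 1) / n%:R * 2 = C / n%:R + 2 * n%:R^-1 by field; rewrite gt_eqF.
lra.
Unshelve. all: end_near. Qed.
End wallis.

(** * Moments of the cosh weights *)

Section cosh_weights.
Context {R : realType}.
Implicit Types z : R.

Definition coshw z (j : nat) : R := z ^+ (2 * j) / (2 * j)`!%:R.
Definition coshR z : R := (expR z + expR (- z)) / 2.
Local Notation S z m := (\sum_(j < m) coshw z j).

Lemma coshw_ge0 z j : 0 <= coshw z j.
Proof. by rewrite divr_ge0 // mulnC exprM sqr_ge0. Qed.

Lemma cvg_coshw z : (fun m : nat => S z m) @ \oo --> coshR z.
Proof.
have E m : S z m = (series (exp_coeff z) (2 * m)%N + series (exp_coeff (- z)) (2 * m)%N) / 2.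
  elim: m => [|m IH]; first by rewrite muln0 /series /= !big_geq // big_ord0; lra.
  rewrite big_ord_recr /= IH (_ : (2 * m.+1 = (2 * m).+2)%N) ?mulnS //.
  rewrite /series /= !(big_nat_recr (2 * m).+1) // !(big_nat_recr (2 * m)) //= !exp_coeffE /=.
  have e0 : (- z) ^+ (2 * m) = z ^+ (2 * m) by rewrite !exprM sqrrN.
  rewrite !exprS !e0 /coshw; move: (z ^+ (2 * m)) (z ^+ (2 * m).+1) => X Y.
  rewrite mulNr mulrN; move: ((2 * m)`!%:R^-1) (((2 * m).+1)`!%:R^-1) => F G.
  rewrite /series /=; move: (\sum_(0 <= k < _) _) (\sum_(0 <= k < _) _) => A B; lra.
have c (x : R) : series (exp_coeff x) (2 * m)%N @[m --> \oo] --> expR x.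
  apply: (@cvg_comp _ _ _ (fun m => (2 * m)%N) (series (exp_coeff x)) \oo \oo); last exact: is_cvg_series_exp_coeff.
  by apply: cvg_mulnl.
rewrite (_ : (fun m => _) = fun m => (series (exp_coeff z) (2 * m)%N + series (exp_coeff (- z)) (2 * m)%N) / 2); last first.
  by apply/funext => m; exact: E.
by apply: cvgM; [apply: cvgD; exact: c | exact: cvg_cst].
Qed.

Lemma sum_coshw_le z m : S z m <= coshR z.
Proof.
have /cvg_lim c := @cvg_coshw z.
rewrite -c //; apply: nondecreasing_cvgn_le; last by apply/cvg_ex; exists (coshR z); exact: cvg_coshw.
by apply/nondecreasing_seqP => k; rewrite big_ord_recr /= lerDl coshw_ge0.
Qed.

Lemma coshw_double z j : coshw (2 * z) j = 4 ^+ j * coshw z j.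
Proof.
rewrite /coshw exprMn mulrA; congr (_ * _ / _).
by rewrite exprM expr2; congr (_ ^+ _); lra.
Qed.

(** Exponential tilting: [coshw (2 * z) j] is 4^j times [coshw z j], so for [j >= m] the weight at
    [z] is at most 4^(-m) times the weight at [2 * z]. *)
Lemma coshR_sub_sum_le z m : coshR z - S z m <= 4 ^- m * coshR (2 * z).
Proof.
rewrite lerBlDl.
have /cvg_lim <- // := @cvg_coshw z.
apply: limr_le; first by apply/cvg_ex; exists (coshR z); exact: cvg_coshw.
near=> k.
have mk : (m <= k)%N by near: k; exact: nbhs_infty_ge.
have f0 : 0 < 4 ^- m :> R by rewrite invr_gt0 exprn_gt0.
apply: (@le_trans _ _ (S z m + 4 ^- m * S (2 * z) k)); last first.
  by rewrite lerD2l ler_pM2l // sum_coshw_le.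
rewrite -!(big_mkord xpredT (fun j => coshw z j)) (big_cat_nat (n := m)) //= lerD2l.
have -> : S (2 * z) k = \sum_(0 <= j < m) coshw (2 * z) j + \sum_(m <= j < k) coshw (2 * z) j.
  by rewrite -big_cat_nat //= big_mkord.
rewrite mulrDr.
apply: (@le_trans _ _ (4 ^- m * \sum_(m <= j < k) coshw (2 * z) j)); last first.
  by rewrite lerDr mulr_ge0 ?(ltW f0) // sumr_ge0 // => j _; exact: coshw_ge0.
rewrite mulr_sumr big_nat [leRHS]big_nat; apply: ler_sum => j /andP[mj _].
rewrite coshw_double mulrA ler_peMl ?coshw_ge0 // mulrC ler_pdivlMr ?exprn_gt0 // mul1r.
by rewrite ler_weXn2l // ler1n.
Unshelve. all: end_near. Qed.

(** The same tilting, from [z / 2], for the lower end of the range. *)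
Lemma sum_coshw_le_half z m : S z m <= 4 ^+ m * coshR (z / 2).
Proof.
apply: (@le_trans _ _ (4 ^+ m * S (z / 2) m)); last by rewrite ler_pM2l ?exprn_gt0 // sum_coshw_le.
rewrite mulr_sumr; apply: ler_sum => j _.
have -> : coshw z j = 4 ^+ j * coshw (z / 2) j by rewrite -coshw_double; congr coshw; field.
rewrite ler_wpM2r ?coshw_ge0 // ler_weXn2l ?ler1n //; exact: ltnW.
Qed.

Lemma coshR_le_expR z : 0 <= z -> coshR z <= expR z.
Proof.
move=> z0; have : expR (- z) <= expR z by rewrite ler_expR; lra.
by rewrite /coshR; lra.
Qed.

(** The quotient of the preceding weight by the current one. Multiplying by it shifts the index, so
    its weighted moments telescope, which those of the simpler 4 j^2 / z^2 would not do. *)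
Definition coshv z (j : nat) : R := (2 * j)%:R * ((2 * j)%:R - 1) / z ^+ 2.

Lemma coshwvS z j : 0 < z -> coshw z j.+1 * coshv z j.+1 = coshw z j.
Proof.
move=> z0; rewrite /coshw /coshv (_ : (2 * j.+1 = (2 * j).+2)%N) ?mulnS // !factS !natrM !exprS.
have e : (2 * j).+2%:R - 1 = (2 * j).+1%:R :> R by rewrite -natr1; ring.
rewrite e; field.
have j0 := ler0n R j; rewrite pnatr_eq0 -lt0n fact_gt0 (gt_eqF z0) /=.
by apply/andP; split; rewrite gt_eqF //; lra.
Qed.

Lemma coshwv0 z : coshv z 0 = 0.
Proof. by rewrite /coshv muln0 !mul0r. Qed.

Lemma sum_coshwv z m : 0 < z -> \sum_(j < m.+1) coshw z j * coshv z j = S z m.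
Proof.
move=> z0; rewrite big_ord_recl coshwv0 mulr0 add0r.
by apply: eq_bigr => j _; rewrite coshwvS.
Qed.

(** The averaging out of the linear correction: a single boundary weight is left. *)
Lemma sum_coshwv_sub1 z m : 0 < z -> \sum_(j < m.+1) coshw z j * (coshv z j - 1) = - coshw z m.
Proof.
move=> z0; under eq_bigr do rewrite mulrBr mulr1.
by rewrite sumrB sum_coshwv // big_ord_recr /=; ring.
Qed.

Lemma coshvS z j : 0 < z -> coshv z j.+1 = coshv z j + (8 * j + 2)%:R / z ^+ 2.
Proof.
have e1 : (2 * j.+1)%:R = 2 * j%:R + 2 :> R by rewrite mulnS natrD natrM addrC.
have e2 : (8 * j + 2)%:R = 8 * j%:R + 2 :> R by rewrite natrD natrM.
have e3 : (2 * j)%:R = 2 * j%:R :> R by rewrite natrM.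
by move=> z0; rewrite /coshv e1 e2 e3; field; rewrite gt_eqF.
Qed.

(** One factor [coshv] shifts the index and turns the other into [coshv z j] plus (8 j + 2) / z^2.
    With [m] of order [z] the second moment about 1 is of order 1 / z relative to cosh z. *)
Lemma sum_coshwv_sub1_sqr z m : 0 < z ->
  \sum_(j < m.+2) coshw z j * (coshv z j - 1) ^+ 2 <= coshw z m.+1 + (8 * m.+1)%:R / z ^+ 2 * coshR z.
Proof.
move=> z0.
have e j : coshw z j * (coshv z j - 1) ^+ 2 = coshw z j * coshv z j * coshv z j
    - 2 * (coshw z j * coshv z j) + coshw z j by ring.
under eq_bigr do rewrite e.
rewrite big_split sumrB /= -mulr_sumr sum_coshwv // big_ord_recl coshwv0 mulr0 add0r.
have -> : \sum_(i < m.+1) coshw z (lift ord0 i) * coshv z (lift ord0 i) * coshv z (lift ord0 i)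
   = S z m + \sum_(i < m.+1) coshw z i * ((8 * i + 2)%:R / z ^+ 2).
  rewrite -(sum_coshwv m z0) -big_split /=; apply: eq_bigr => i _.
  by rewrite /bump /= add1n coshwvS // coshvS // mulrDr.
have h : \sum_(i < m.+1) coshw z i * ((8 * i + 2)%:R / z ^+ 2) <= (8 * m.+1)%:R / z ^+ 2 * coshR z.
  apply: (@le_trans _ _ ((8 * m.+1)%:R / z ^+ 2 * S z m.+1)); last first.
    by rewrite ler_wpM2l ?sum_coshw_le // divr_ge0 // sqr_ge0.
  rewrite mulr_sumr; apply: ler_sum => i _; rewrite mulrC ler_wpM2r ?coshw_ge0 //.
  rewrite ler_wpM2r ?invr_ge0 ?sqr_ge0 // ler_nat; have := ltn_ord i; lia.
have := coshw_ge0 z m; move: h; rewrite !big_ord_recr /=; lra.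
Qed.
End cosh_weights.

(** * Averages of a slowly varying ratio against the cosh weights *)

Section cosh_concentration.
Context {R : realType}.

Lemma expR1_le4 : expR 1 <= 4 :> R.
Proof.
have h := expR_ge1Dx (- (1 / 2) : R); rewrite expRN in h.
have p := expR_gt0 (1 / 2 : R).
have h2 : expR (1 / 2) <= 2 :> R.
  by rewrite -(invrK (expR (1 / 2))) -[leRHS]invrK lef_pV2 ?posrE ?invr_gt0 //; lra.
have -> : (1 : R) = 1 / 2 + 1 / 2 by lra.
rewrite expRD; nra.
Qed.

Lemma expR_nat (k : nat) (x : R) : expR (k%:R * x) = expR x ^+ k.
Proof. exact: expRM_natl. Qed.

Lemma exprn4_le (k : nat) (x : R) : k%:R <= x -> 4 ^+ k <= expR (2 * x).
Proof.
move=> kx; apply: (@le_trans _ _ (expR (k%:R * 2))); last by rewrite ler_expR; lra.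
rewrite expR_nat lerXn2r ?nnegrE ?expR_ge0 //.
have -> : (2 : R) = 1 + 1 by [].
by have := expR_ge1Dx (1 : R); rewrite expRD; nra.
Qed.

Lemma exprn4_ge (k : nat) (x : R) : x <= k%:R -> expR x <= 4 ^+ k.
Proof.
move=> kx; apply: (@le_trans _ _ (expR (k%:R * 1))); first by rewrite ler_expR; lra.
by rewrite expR_nat lerXn2r ?nnegrE ?expR_ge0 // expR1_le4.
Qed.

(** Below z / 8 the weights sum to at most 4 e^(3 z / 4), and above 2 z to at most 1, so the crude
    bound [K] suffices there. In between, [r] is replaced by its linear approximation in [coshv]:
    the linear term telescopes and the error is a second moment. *)
Lemma cosh_weighted_sum (z : R) (n : nat) (r : nat -> R) (rho k C e K : R) :
  1 <= z -> 2 * z <= n%:R -> 0 < rho -> 0 <= C -> 0 <= e ->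
  (forall j, (j <= n)%N -> `|r j| <= K) ->
  (forall j, z / 8 <= j%:R <= 2 * z ->
    `|r j - rho - rho * k * (coshv z j - 1)| <= rho * C * ((coshv z j - 1) ^+ 2 + e)) ->
  `|\sum_(j < n.+1) coshw z j * r j - rho * coshR z| <=
    rho * C * (16 / z + e) * expR z + (rho * (4 * C + 8 * `|k| + 5) + 5 * K) * expR (3 / 4 * z).
Proof.
move=> z1 zn rho0 C0 e0 rK rmid.
have z0 : 0 < z by lra.
have K0 : 0 <= K by apply: le_trans (rK 0%N _).
pose m0 := (Num.trunc (z / 8)).+1; pose m := Num.trunc (2 * z).
have z2 : 0 <= 2 * z by lra.
have z8 : 0 <= z / 8 by lra.
have /andP[m_le m_gt] := truncn_itv z2; rewrite -/m in m_le m_gt.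
have /andP[m0_le m0_gt] := truncn_itv z8; rewrite -/m0 in m0_gt.
have mp : (0 < m)%N by rewrite /m truncn_gt0; lra.
have mn : (m <= n)%N by rewrite -(ler_nat R); lra.
have c2z : coshR (2 * z) <= expR (2 * z) by exact: coshR_le_expR.
have E1 : 1 <= expR (3 / 4 * z) by rewrite -[X in X <= _]expR0 ler_expR; lra.
(* [m + 1 > 2 z] and e <= 4 give e^(2 z) <= 4^(m + 1). *)
have tail1 : coshR z - \sum_(j < m.+1) coshw z j <= 1.
  apply: le_trans (coshR_sub_sum_le z m.+1) _; rewrite mulrC ler_pdivrMr ?exprn_gt0 // mul1r.
  by apply: le_trans c2z _; apply: exprn4_ge; exact: ltW.
have tail2 : coshw z m <= 4.
  have h := coshR_sub_sum_le z m.
  have h1 : coshw z m <= coshR z - \sum_(j < m) coshw z j.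
    by have := sum_coshw_le z m.+1; rewrite big_ord_recr /=; lra.
  apply: le_trans h1 (le_trans h _); rewrite mulrC ler_pdivrMr ?exprn_gt0 // -exprS.
  by apply: le_trans c2z _; apply: exprn4_ge; exact: ltW.
(* 4^(z / 8) <= e^(z / 4) and cosh (z / 2) <= e^(z / 2) make up the exponent 3 z / 4; the leading 4
   comes from the successor in [m0]. *)
have low : \sum_(j < m0) coshw z j <= 4 * expR (3 / 4 * z).
  apply: le_trans (sum_coshw_le_half z m0) _; rewrite /m0 exprS -mulrA ler_pM2l //.
  have -> : 3 / 4 * z = 2 * (z / 8) + z / 2 by field.
  rewrite expRD; apply: ler_pM; rewrite ?exprn_ge0 //.
  - by rewrite /coshR divr_ge0 // addr_ge0 // expR_ge0.
  - exact: exprn4_le.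
  - by apply: coshR_le_expR; lra.
have tm : (Num.trunc (z / 8) <= m)%N by rewrite /m le_truncn //; lra.
have m0m : (m0 <= m.+1)%N by rewrite /m0 ltnS.
pose d j := r j - rho - rho * k * (coshv z j - 1).
pose L := K + rho * (1 + `|k|).
have L0 : 0 <= L by rewrite /L addr_ge0 // mulr_ge0 ?(ltW rho0) // addr_ge0.
have dlow j : (j < m0)%N -> `|d j| <= L.
  rewrite /m0 ltnS => jm; have jn : (j <= n)%N by rewrite (leq_trans jm) // (leq_trans tm).
  have jz : j%:R <= z / 8 by apply: le_trans m0_le; rewrite ler_nat.
  have v1 : `|coshv z j - 1| <= 1.
    have v0 : 0 <= coshv z j.
      rewrite /coshv; case: (j) => [|i]; first by rewrite muln0 !mul0r.
      rewrite divr_ge0 ?sqr_ge0 // mulr_ge0 // subr_ge0 ler1n muln_gt0.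
    have v2 : coshv z j <= 1.
      rewrite /coshv ler_pdivrMr ?exprn_gt0 // mul1r natrM; have := ler0n R j; nra.
    by rewrite ler_norml; apply/andP; split; lra.
  rewrite /d; apply: le_trans (ler_normB _ _) _; apply: le_trans (lerD (ler_normB _ _) (lexx _)) _.
  rewrite (gtr0_norm rho0) !normrM (gtr0_norm rho0).
  have := rK j jn; rewrite /L.
  have : rho * `|k| * `|coshv z j - 1| <= rho * `|k|.
    by rewrite ler_piMr // mulr_ge0 ?(ltW rho0).
  lra.
have dmid j : (m0 <= j)%N -> (j <= m)%N -> `|d j| <= rho * C * ((coshv z j - 1) ^+ 2 + e).
  move=> h1 h2; apply: rmid; apply/andP; split.
    apply: (@le_trans _ _ m0%:R); first exact: ltW.
    by rewrite ler_nat.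
  by apply: le_trans m_le; rewrite ler_nat.
(* Here [sum_coshwv_sub1] replaces the linear term by the boundary weight [coshw z m]. *)
have sumE : \sum_(j < n.+1) coshw z j * r j - rho * coshR z =
   (\sum_(m.+1 <= j < n.+1) coshw z j * r j) - rho * (coshR z - \sum_(j < m.+1) coshw z j)
   - rho * k * coshw z m + \sum_(j < m.+1) coshw z j * d j.
  rewrite -(big_mkord xpredT (fun j => coshw z j * r j)) (big_cat_nat (n := m.+1)) //=.
  rewrite big_mkord.
  have -> : \sum_(j < m.+1) coshw z j * r j = rho * (\sum_(j < m.+1) coshw z j)
     + rho * k * (\sum_(j < m.+1) coshw z j * (coshv z j - 1)) + \sum_(j < m.+1) coshw z j * d j.
    rewrite !mulr_sumr -!big_split /=; apply: eq_bigr => j _; rewrite /d; ring.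
  rewrite sum_coshwv_sub1 //; ring.
have T1 : `|\sum_(m.+1 <= j < n.+1) coshw z j * r j| <= K.
  apply: le_trans (ler_norm_sum _ _ _) _.
  apply: (@le_trans _ _ (K * \sum_(m.+1 <= j < n.+1) coshw z j)).
    rewrite mulr_sumr big_nat [leRHS]big_nat; apply: ler_sum => j /andP[_ jn].
    by rewrite normrM (ger0_norm (coshw_ge0 z j)) mulrC ler_wpM2r ?coshw_ge0 // rK.
  rewrite ler_piMr //; apply: le_trans tail1.
  have := sum_coshw_le z n.+1.
  by rewrite -(big_mkord xpredT (fun j => coshw z j)) (big_cat_nat (n := m.+1)) //= big_mkord; lra.
have T2 : `|rho * (coshR z - \sum_(j < m.+1) coshw z j)| <= rho.
  rewrite normrM (gtr0_norm rho0) ler_piMr ?(ltW rho0) // ger0_norm // subr_ge0.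
  exact: sum_coshw_le.
have T3 : `|rho * k * coshw z m| <= 4 * rho * `|k|.
  rewrite (normrM _ (coshw z m)) (normrM rho) (gtr0_norm rho0) (ger0_norm (coshw_ge0 z m)).
  by have := ler_wpM2l (mulr_ge0 (ltW rho0) (normr_ge0 k)) tail2; lra.
have T4 : `|\sum_(j < m.+1) coshw z j * d j| <=
    rho * C * (4 + 16 / z * expR z + e * expR z) + L * (4 * expR (3 / 4 * z)).
  apply: le_trans (ler_norm_sum _ _ _) _.
  apply: (@le_trans _ _ (rho * C * (\sum_(j < m.+1) coshw z j * (coshv z j - 1) ^+ 2)
      + rho * C * e * (\sum_(j < m.+1) coshw z j) + L * \sum_(j < m0) coshw z j)).
    rewrite !mulr_sumr (big_ord_widen_cond _ xpredT (fun j => L * coshw z j) m0m) /=.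
    rewrite [X in _ <= _ + X]big_mkcond -!big_split /=; apply: ler_sum => j _.
    rewrite normrM (ger0_norm (coshw_ge0 z j)).
    have w0 := coshw_ge0 z j.
    have q0 : 0 <= rho * C * ((coshv z j - 1) ^+ 2 + e).
      by rewrite mulr_ge0 ?mulr_ge0 ?(ltW rho0) // addr_ge0 // sqr_ge0.
    case: ltnP => jm0.
      by have := ler_wpM2l w0 (dlow j jm0); have := mulr_ge0 w0 q0; lra.
    have jm : (j <= m)%N by rewrite -ltnS.
    by have := ler_wpM2l w0 (dmid j jm0 jm); lra.
  have rC : 0 <= rho * C by rewrite mulr_ge0 ?(ltW rho0).
  have S2 : \sum_(j < m.+1) coshw z j * (coshv z j - 1) ^+ 2 <= 4 + 16 / z * expR z.
    case: (m) mp m_le tail2 => // m' _ hm ht.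
    apply: le_trans (sum_coshwv_sub1_sqr m' z0) _; apply: lerD => //.
    apply: ler_pM.
    - by rewrite divr_ge0 // sqr_ge0.
    - by rewrite /coshR divr_ge0 // addr_ge0 // expR_ge0.
    - rewrite ler_pdivrMr ?exprn_gt0 // natrM.
      have -> : 16 / z * z ^+ 2 = 16 * z by field; rewrite gt_eqF.
      lra.
    - by apply: coshR_le_expR; lra.
  have S1 : \sum_(j < m.+1) coshw z j <= expR z.
    by apply: le_trans (sum_coshw_le _ _) _; apply: coshR_le_expR; lra.
  have := ler_wpM2l rC S2; have := ler_wpM2l (mulr_ge0 rC e0) S1; have := ler_wpM2l L0 low; lra.
rewrite sumE; apply: le_trans (ler_normD _ _) _.
apply: le_trans (lerD (ler_normB _ _) T4) _.
apply: le_trans (lerD (lerD (ler_normB _ _) T3) (lexx _)) _.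
have X0 : 0 <= K + rho + 4 * rho * `|k| + 4 * (rho * C).
  by rewrite !addr_ge0 ?mulr_ge0 ?(ltW rho0).
have := ler_wpM2l X0 E1; have := lerD T1 T2; rewrite /L; lra.
Qed.
End cosh_concentration.

(** * Asymptotics of q *)

Section q_as_weighted_sum.
Context {R : realType}.

Definition gbinomR (a : R) (k : nat) : R := (\prod_(i < k) (a - i%:R)) / (k`!)%:R.
Definition pochR (a : R) (m : nat) : R := \prod_(i < m) (a + i%:R).
Definition qR (n : nat) (a1 a2 b : R) : R :=
  \sum_(k < n.+1) gbinomR (n%:R + a1 - a2) k * gbinomR (n%:R + a2 - a1) (n - k)
    * pochR (a2 + 1) (n + k) * b ^+ (n - k).

Lemma ratr_q (n : nat) (a1 a2 b : rat) :
  ratr (q n a1 a2 b) = qR n (ratr a1) (ratr a2) (ratr b).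
Proof.
have gbE (a : rat) k : ratr (gbinom a k) = gbinomR (ratr a) k.
  rewrite /gbinom /gbinomR fmorph_div /= rmorph_prod ratr_nat; congr (_ / _).
  by apply: eq_bigr => i _; rewrite rmorphB /= ratr_nat.
have poE (a : rat) m : ratr (pochhammer a m) = pochR (ratr a) m.
  by rewrite rmorph_prod; apply: eq_bigr => i _; rewrite rmorphD /= ratr_nat.
rewrite /q rmorph_sum; apply: eq_bigr => k _.
rewrite 3!rmorphM /= rmorphXn !gbE poE; congr (gbinomR _ _ * gbinomR _ _ * pochR _ _ * _).
- by rewrite rmorphB rmorphD /= ratr_nat.
- by rewrite rmorphB rmorphD /= ratr_nat.
- by rewrite rmorphD rmorph1.
Qed.

(** The [i]-th factors of [n! / (n - j)!], of the numerator of binom (n - al, j) and of the part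
    removed from (a2 + 1)_(2 n), normalised by their sizes n, n and 2 n. *)
Definition qfactor (al a2 : R) (n i : nat) : R :=
  (1 - i%:R / n%:R) * (1 - (al + i%:R) / n%:R) / (1 - (i%:R - a2) / (2 * n%:R)).

Definition qratio (al a2 : R) (n j : nat) : R :=
  wallis j * \prod_(i < j) qfactor al a2 n i * \prod_(j <= i < n) (1 + al / i.+1%:R).

Lemma prod_gbinom (al : R) (j d : nat) :
  \prod_(i < d) ((j + d)%:R + al - i%:R)
  = \prod_(j <= i < j + d) (1 + al / i.+1%:R) * (j + d)`!%:R / j`!%:R.
Proof.
have f0 : j`!%:R != 0 :> R by rewrite pnatr_eq0 -lt0n fact_gt0.
elim: d => [|d IH]; first by rewrite big_ord0 addn0 big_geq // mul1r divff.
rewrite big_ord_recl addnS big_nat_recr ?leq_addr //= subr0.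
have -> : \prod_(i < d) ((j + d).+1%:R + al - (bump 0 i)%:R) = \prod_(i < d) ((j + d)%:R + al - i%:R).
  by apply: eq_bigr => i _; rewrite /bump /= natrD -natr1; ring.
rewrite IH factS natrM; field.
by rewrite -natrD nat1r f0 pnatr_eq0.
Qed.

Lemma prod_subr_fact (n j : nat) : (j <= n)%N ->
  \prod_(i < j) (n%:R - i%:R) = n`!%:R / (n - j)`!%:R :> R.
Proof.
move=> jn; have f0 : (n - j)`!%:R != 0 :> R by rewrite pnatr_eq0 -lt0n fact_gt0.
apply: (mulIf f0); rewrite divfK // -(ffact_fact jn) natrM; congr (_ * _).
elim: j jn {f0} => [|j IH] jn; first by rewrite big_ord0.
by rewrite big_ord_recr /= IH ?(ltnW jn) // ffactnSr natrM natrB // ltnW.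
Qed.

Lemma pochR_split (a2 : R) (m j : nat) : (j <= m)%N ->
  pochR (a2 + 1) m = pochR (a2 + 1) (m - j) * \prod_(i < j) (m%:R + a2 - i%:R).
Proof.
elim: j => [|j IH] jm; first by rewrite big_ord0 subn0 mulr1.
rewrite IH ?(ltnW jm) // big_ord_recr /= mulrA.
have -> : (m - j = (m - j.+1).+1)%N by lia.
rewrite {1}/pochR big_ord_recr /= -/(pochR _ _) natrB //.
rewrite -natr1; ring.
Qed.

(** Relative to (a2 + 1)_(2 n) the term of index [j] contains (b n / 2)^j / j!^2, and this equals
    [coshw z j * wallis j] for z^2 = 2 b n. *)
Lemma qR_weighted_sum (n : nat) (al a2 b : R) : (0 < n)%N -> -1 < a2 -> 0 < b ->
  qR n (a2 + al) a2 b
  = pochR (a2 + 1) (2 * n) * \sum_(j < n.+1) coshw (Num.sqrt (2 * b * n%:R)) j * qratio al a2 n j.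
Proof.
move=> n0 a21 b0; rewrite /qR (reindex_inj rev_ord_inj) /= mulr_sumr.
have np : 0 < n%:R :> R by rewrite ltr0n.
have nn0 := lt0r_neq0 np.
apply: eq_bigr => -[j jn] _ /=; rewrite ltnS in jn; rewrite subSS (subKn jn).
have -> : n%:R + (a2 + al) - a2 = n%:R + al by ring.
have -> : n%:R + a2 - (a2 + al) = n%:R - al by ring.
have G1 := prod_gbinom al j (n - j); rewrite (subnKC jn) in G1.
rewrite {1}/gbinomR G1.
have -> : (n + (n - j) = 2 * n - j)%N by lia.
have jn2 : (j <= 2 * n)%N by lia.
rewrite (pochR_split a2 jn2) /coshw exprM sqr_sqrtr; last by rewrite !mulr_ge0 ?ltW.
rewrite /qratio /wallis /gbinomR.
have d0 i : (i < j)%N -> (2 * n)%:R + a2 - i%:R != 0.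
  move=> ij; rewrite gt_eqF // natrM; have : i.+1%:R <= n%:R :> R by rewrite ler_nat; lia.
  by rewrite -natr1; lra.
(* Factor by factor, [qfactor] times (2 n + a2 - i) n is 2 (n - i) (n - al - i). *)
have P : \prod_(i < j) qfactor al a2 n i * \prod_(i < j) ((2 * n)%:R + a2 - i%:R) * n%:R ^+ j
    = 2 ^+ j * (n`!%:R / (n - j)`!%:R) * \prod_(i < j) (n%:R - al - i%:R).
  rewrite -prod_subr_fact // -[j in n%:R ^+ j]card_ord -[j in 2 ^+ j]card_ord -!prodr_const -!big_split /=.
  apply: eq_bigr => -[i ij] _ /=; rewrite /qfactor; have := d0 i ij; rewrite natrM => h.
  field; rewrite nn0 /=.
  by have -> : 2 * n%:R - (i%:R - a2) = 2 * n%:R + a2 - i%:R by ring.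
have f1 : j`!%:R != 0 :> R by rewrite pnatr_eq0 -lt0n fact_gt0.
have f2 : (n - j)`!%:R != 0 :> R by rewrite pnatr_eq0 -lt0n fact_gt0.
have f3 : (2 * j)`!%:R != 0 :> R by rewrite pnatr_eq0 -lt0n fact_gt0.
have n4 : (4 : R) ^+ j = 2 ^+ j * 2 ^+ j by rewrite -exprMn; congr (_ ^+ _); ring.
have p2 : (2 : R) ^+ j != 0 by rewrite expf_neq0.
rewrite n4 !exprMn.
move: (\prod_(i < j) qfactor _ _ _ _) (\prod_(i < j) (_ + a2 - _)) (\prod_(i < j) (_ - al - _)) P => PE PD PN P.
move: (\prod_(j <= i < n) _) (pochR _ _) (b ^+ j) => G po bj.
transitivity (po * bj * G * (PE * PD * n%:R ^+ j) / (j`!%:R ^+ 2 * 2 ^+ j)).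
  by rewrite P; field; rewrite f1 f2 p2.
by field; rewrite f1 f3 p2.
Qed.
End q_as_weighted_sum.

(** * Logarithms of the factors of the ratio *)

Section qratio_asymptotics.
Context {R : realType}.

Lemma wallis_le1 j : wallis j <= 1 :> R.
Proof.
elim: j => [|j IH]; first by rewrite /wallis muln0 fact0 expr1n expr0 mulr1 divr1.
rewrite wallis_rec; apply: le_trans (_ : wallis j * 1 <= 1); last by rewrite mulr1.
rewrite ler_wpM2l ?(ltW (wallis_gt0 j)) // ler_pdivrMr ?ltr0n ?muln_gt0 // mul1r ler_nat.
by rewrite mulnS.
Qed.

Lemma ln_prod_bound (j : nat) (F g : nat -> R) (e : R) :
  (forall i, (i < j)%N -> 0 < F i /\ `|ln (F i) - g i| <= e) ->
  0 < \prod_(i < j) F i /\ `|ln (\prod_(i < j) F i) - \sum_(i < j) g i| <= j%:R * e.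
Proof.
elim: j => [|j IH] H; first by rewrite !big_ord0 ln1 subrr normr0 mul0r.
have [i ij|P0 hP] := IH _; first by apply: H; exact: ltnW.
have [F0 hF] := H j (ltnSn j).
rewrite !big_ord_recr /= mulr_gt0 //; split => //.
rewrite lnM ?posrE // -natr1 mulrDl mul1r.
have -> : forall a b c d : R, a + b - (c + d) = (a - c) + (b - d) by move=> *; ring.
exact: le_trans (ler_normD _ _) (lerD hP hF).
Qed.

Lemma sum_nat_half (j : nat) : \sum_(i < j) (i%:R : R) = j%:R * (j%:R - 1) / 2.
Proof.
elim: j => [|j IH]; first by rewrite big_ord0 !mul0r.
by rewrite big_ord_recr /= IH -natr1; field.
Qed.

(** Each factor contributes [al] times an increment of the logarithm, up to a multiple of 1 / (N +
    1)^2. That is at most 1 / N - 1 / (N + 1), so the errors telescope. *)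
Lemma ln_prod_shift (al : R) (j n : nat) : (0 < j)%N -> 2 * `|al| <= j%:R -> (j <= n)%N ->
  0 < \prod_(j <= i < n) (1 + al / i.+1%:R) /\
  `|ln (\prod_(j <= i < n) (1 + al / i.+1%:R)) - al * (ln n%:R - ln j%:R)|
    <= (2 * al ^+ 2 + 2 * `|al|) * (j%:R^-1 - n%:R^-1).
Proof.
move=> j0 jal jn; rewrite -(subnKC jn); elim: (n - j)%N => [|d [P0 IH]].
  by rewrite addn0 big_geq // ln1 !subrr mulr0 subrr normr0 mulr0.
rewrite addnS big_nat_recr ?leq_addr //=.
set N := (j + d)%N in IH *; set P := \prod_(_ <= _ < _) _ in P0 IH *.
have jN : (j <= N)%N by rewrite leq_addr.
have N0 : (0 < N)%N by apply: leq_trans j0 jN.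
have Np : 0 < N%:R :> R by rewrite ltr0n.
have N1p : 0 < N.+1%:R :> R by rewrite ltr0n.
have iN : N.+1%:R^-1 <= 1 / 2 :> R by rewrite mul1r lef_pV2 ?posrE // ler_nat.
have iN0 : 0 < N.+1%:R^-1 :> R by rewrite invr_gt0.
have [V VE] : exists V : R, V = N.+1%:R^-1 by exists N.+1%:R^-1.
have Ne : ln N%:R - ln N.+1%:R = ln (1 - V) :> R.
  rewrite -ln_div ?posrE // VE; congr ln; apply: (mulIf (lt0r_neq0 N1p)).
  by rewrite mulrBl divfK ?mulVf ?(gt_eqF N1p) // mul1r -natr1 addrK.
have K : V ^+ 2 <= N%:R^-1 - V.
  have -> : N%:R^-1 - V = (N%:R * N.+1%:R)^-1.
    by rewrite VE -natr1; field; rewrite (gt_eqF Np) /= natr1 gt_eqF.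
  rewrite VE expr2 -invfM lef_pV2 ?posrE ?mulr_gt0 // ler_wpM2r ?(ltW N1p) // ler_nat.
  exact: leqnSn.
have aN : `|al * V| <= 1 / 2.
  rewrite VE normrM (gtr0_norm iN0) ler_pdivrMr //.
  have : j%:R <= N.+1%:R :> R by rewrite ler_nat ltnW.
  lra.
rewrite -VE in iN iN0 *.
have hal : - (1 / 2) <= al * V by move: aN; rewrite ler_norml => /andP[].
have F0 : 0 < 1 + al * V by lra.
have h1 := normr_ln1D_sub hal.
have h2 : `|ln (1 - V) - (- V)| <= 2 * (- V) ^+ 2 by apply: normr_ln1D_sub; lra.
split; first exact: mulr_gt0.
rewrite lnM ?posrE //.
have -> : ln P + ln (1 + al * V) - al * (ln N.+1%:R - ln j%:R) = (ln P - al * (ln N%:R - ln j%:R))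
    + ((ln (1 + al * V) - al * V) + al * ((ln N%:R - ln N.+1%:R) - (- V))) by ring.
rewrite Ne; apply: le_trans (ler_normD _ _) _.
have -> : j%:R^-1 - V = (j%:R^-1 - N%:R^-1) + (N%:R^-1 - V) by ring.
rewrite [leRHS]mulrDr; apply: lerD; first exact: IH.
apply: le_trans (ler_normD _ _) _.
rewrite (normrM al).
rewrite exprMn in h1; rewrite sqrrN in h2.
have a0 := normr_ge0 al.
have := ler_wpM2l a0 h2.
have := ler_wpM2l (sqr_ge0 al) K; have := ler_wpM2l a0 K; lra.
Qed.

(** The linear terms of the three logarithms are -i / n, -i / n and +i / (2 n), whence -3 / 2. The
    parameters [al] and [a2] contribute only O(1 / n). *)
Lemma qfactor_ln (al a2 : R) (n j i : nat) (A : R) : A = 1 + `|al| + `|a2| ->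
  (0 < n)%N -> (i < j)%N -> 2 * (j%:R + A) <= n%:R ->
  0 < qfactor al a2 n i /\
  `|ln (qfactor al a2 n i) - (- (3 / 2) * (i%:R / n%:R))| <= A / n%:R + 6 * ((j%:R + A) / n%:R) ^+ 2.
Proof.
move=> AE n0 ij jA; have np : 0 < n%:R :> R by rewrite ltr0n.
have nv : 0 < n%:R^-1 :> R by rewrite invr_gt0.
set J := j%:R + A in jA *.
have iJ : i%:R + A <= J by rewrite lerD2r ler_nat ltnW.
have i0 := ler0n R i; have al0 := normr_ge0 al; have a20 := normr_ge0 a2.
have key (t : R) : `|t| <= J -> - (1 / 2) <= - (t / n%:R) /\
   `|ln (1 - t / n%:R) + t / n%:R| <= 2 * (J / n%:R) ^+ 2.
  move=> tJ.
  have h : `|t / n%:R| <= J / n%:R by rewrite normrM (gtr0_norm nv) ler_pM2r.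
  have h2 : J / n%:R <= 1 / 2 by rewrite ler_pdivrMr //; lra.
  have h3 : - (1 / 2) <= - (t / n%:R).
    by move: (le_trans h h2); rewrite ler_norml => /andP[]; lra.
  split => //; have := normr_ln1D_sub h3; rewrite opprK sqrrN => /le_trans; apply.
  rewrite ler_pM2l // -real_normK ?num_real // lerXn2r ?nnegrE //.
  exact: le_trans (normr_ge0 _) h.
have [|g1 h1] := key i%:R; first by rewrite ger0_norm //; lra.
have [|g2 h2] := key (al + i%:R).
  by apply: le_trans (ler_normD _ _) _; rewrite (ger0_norm i0); lra.
have [|g3 h3] := key ((i%:R - a2) / 2).
  rewrite normrM (gtr0_norm (x := 2^-1)) //.
  have := ler_normB i%:R a2; rewrite (ger0_norm i0); lra.
have e3 : (i%:R - a2) / (2 * n%:R) = ((i%:R - a2) / 2) / n%:R by field; rewrite gt_eqF.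
rewrite /qfactor e3.
have p1 : 0 < 1 - i%:R / n%:R :> R by lra.
have p2 : 0 < 1 - (al + i%:R) / n%:R by lra.
have p3 : 0 < 1 - ((i%:R - a2) / 2) / n%:R by lra.
split; first by rewrite divr_gt0 ?mulr_gt0.
rewrite ln_div ?posrE ?mulr_gt0 // lnM ?posrE //.
have -> : forall x y w : R, x + y - w - - (3 / 2) * (i%:R / n%:R) =
   (x + i%:R / n%:R) + (y + (al + i%:R) / n%:R) - (w + ((i%:R - a2) / 2) / n%:R)
   - (al + a2 / 2) / n%:R by move=> x y w; field; rewrite gt_eqF.
apply: le_trans (ler_normB _ _) _; rewrite addrC; apply: lerD.
  rewrite normrM (gtr0_norm nv) ler_pM2r //.
  apply: le_trans (ler_normD _ _) _; rewrite normrM (gtr0_norm (x := 2^-1)) //; lra.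
apply: le_trans (ler_normB _ _) _.
have := ler_normD (ln (1 - i%:R / n%:R) + i%:R / n%:R) (ln (1 - (al + i%:R) / n%:R) + (al + i%:R) / n%:R).
lra.
Qed.
End qratio_asymptotics.

Section qratio_limits.
Context {R : realType}.

(** For [j] of order sqrt n the Wallis ratio gives -ln (pi j) / 2, the sum of -3 i / (2 n) gives -3
    j^2 / (4 n), and the shifted product gives al (ln n - ln j). The [j] factors each have an error
    O(1 / n), in total O(n^(-1/2)). *)
Lemma qratio_ln (al a2 B B' : R) : 0 < B' -> 0 <= B ->
  exists C : R, \forall n \near \oo, forall j : nat,
    B' * Num.sqrt n%:R <= j%:R <= B * Num.sqrt n%:R ->
    0 < qratio al a2 n j /\
    `|ln (qratio al a2 n j) - (- (ln (pi * j%:R) / 2) - 3 / 4 * (j%:R ^+ 2 / n%:R)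
       + al * (ln n%:R - ln j%:R))| <= C / Num.sqrt n%:R.
Proof.
move=> B'0 B0; have [C0 [N0 _ HN0]] := @wallis_asymp R.
pose A : R := 1 + `|al| + `|a2|; pose D := 2 * al ^+ 2 + 2 * `|al|.
have A1 : 1 <= A by rewrite /A -addrA lerDl addr_ge0.
have D0 : 0 <= D by rewrite /D; have := sqr_ge0 al; have := normr_ge0 al; lra.
exists ((`|C0| + D) / B' + (3 / 4 + A) * B + 6 * B * (B + A) ^+ 2); near=> n => j /andP[jl ju].
have n0 : (0 < n)%N by near: n; exact: nbhs_infty_gt.
have np : 0 < n%:R :> R by rewrite ltr0n.
have sA : 2 * (B + A) + 1 <= Num.sqrt n%:R by near: n; exact: near_sqrt_ge.
have sl : (N0%:R + 2 * `|al| + 1) / B' <= Num.sqrt n%:R by near: n; exact: near_sqrt_ge.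
set s : R := Num.sqrt n%:R in sA sl jl ju *.
have s2 : n%:R = s ^+ 2 :> R by rewrite sqr_sqrtr ?ltW.
have s0 : 0 < s by lra.
rewrite ler_pdivrMr // mulrC in sl.
have al0 := normr_ge0 al; have N0p := ler0n R N0.
have jN : (N0 <= j)%N by rewrite -(ler_nat R); lra.
have j1 : (0 < j)%N by rewrite -(ltr_nat R); lra.
have jp : 0 < j%:R :> R by rewrite ltr0n.
have jal : 2 * `|al| <= j%:R by lra.
have jn : (j <= n)%N by rewrite -(ler_nat R) s2; nra.
have jA : 2 * (j%:R + A) <= n%:R by rewrite s2; nra.
have jinv : j%:R^-1 <= B'^-1 / s.
  by rewrite -invfM lef_pV2 ?posrE ?mulr_gt0.
have w1 : `|ln (wallis j) + ln (pi * j%:R) / 2| <= `|C0| / B' / s.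
  apply: le_trans (HN0 j jN) _; apply: (@le_trans _ _ (`|C0| / j%:R)).
    by rewrite ler_pM2r ?invr_gt0 // ler_norm.
  by rewrite -mulrA ler_wpM2l.
have [g0 g1] := ln_prod_shift j1 jal jn.
have g2 : D * (j%:R^-1 - n%:R^-1) <= D / B' / s.
  rewrite -mulrA ler_wpM2l //; have : 0 <= n%:R^-1 :> R by rewrite invr_ge0.
  lra.
have [f0 f1] := @ln_prod_bound R j (qfactor al a2 n) (fun i => - (3 / 2) * (i%:R / n%:R))
   (A / n%:R + 6 * ((j%:R + A) / n%:R) ^+ 2)
   (fun i ij => @qfactor_ln R al a2 n j i A erefl n0 ij jA).
have sE : \sum_(i < j) (- (3 / 2) * (i%:R / n%:R)) = - (3 / 4) * (j%:R ^+ 2 / n%:R) + 3 / 4 * (j%:R / n%:R) :> R.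
  rewrite -mulr_sumr -mulr_suml sum_nat_half; field; by rewrite gt_eqF.
have jn1 : j%:R / n%:R <= B / s.
  rewrite s2 ler_pdivrMr ?exprn_gt0 //.
  by have -> : B / s * s ^+ 2 = B * s by field; rewrite gt_eqF.
have f2 : j%:R * (A / n%:R + 6 * ((j%:R + A) / n%:R) ^+ 2) + 3 / 4 * (j%:R / n%:R)
    <= ((3 / 4 + A) * B + 6 * B * (B + A) ^+ 2) / s.
  have h2 : (j%:R + A) / n%:R <= (B + A) / s.
    rewrite s2 ler_pdivrMr ?exprn_gt0 //.
    have -> : (B + A) / s * s ^+ 2 = (B + A) * s by field; rewrite gt_eqF.
    nra.
  have h3 : j%:R * ((j%:R + A) / n%:R) ^+ 2 <= B * s * ((B + A) / s) ^+ 2.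
    apply: ler_pM => //; first exact: sqr_ge0.
    rewrite lerXn2r ?nnegrE //; apply: divr_ge0; rewrite ?(ltW np) ?(ltW s0) //; lra.
  have h4 : B * s * ((B + A) / s) ^+ 2 = B * (B + A) ^+ 2 / s by field; rewrite gt_eqF.
  rewrite h4 in h3.
  have A0 : 0 <= 3 / 4 + A by lra.
  have h5 := ler_wpM2l A0 jn1.
  have e1 : j%:R * (A / n%:R) = A * (j%:R / n%:R) by ring.
  have e2 : ((3 / 4 + A) * B + 6 * B * (B + A) ^+ 2) / s = (3 / 4 + A) * (B / s) + 6 * (B * (B + A) ^+ 2 / s) by ring.
  rewrite e2 mulrDr e1; lra.
have w0 := wallis_gt0 (R := R) j.
split; first by rewrite /qratio !mulr_gt0.
rewrite /qratio lnM ?posrE ?mulr_gt0 // lnM ?posrE //.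
rewrite sE in f1.
move: (ln (wallis j)) w1 => W w1; move: (ln (\prod_(i < j) _)) f1 => F f1.
move: (ln (\prod_(_ <= _ < _) _)) g1 => G g1.
have -> : W + F + G - (- (ln (pi * j%:R) / 2) - 3 / 4 * (j%:R ^+ 2 / n%:R) + al * (ln n%:R - ln j%:R))
  = (W + ln (pi * j%:R) / 2) + ((F - (- (3 / 4) * (j%:R ^+ 2 / n%:R) + 3 / 4 * (j%:R / n%:R))) + 3 / 4 * (j%:R / n%:R))
    + (G - al * (ln n%:R - ln j%:R)) by ring.
apply: le_trans (ler_normD _ _) _.
apply: le_trans (lerD (ler_normD _ _) g1) _.
apply: le_trans (lerD (lerD w1 (ler_normD _ _)) g2) _.
have jn0 : 0 <= 3 / 4 * (j%:R / n%:R) :> R by rewrite mulr_ge0 // divr_ge0.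
rewrite (ger0_norm jn0).
have -> : ((`|C0| + D) / B' + (3 / 4 + A) * B + 6 * B * (B + A) ^+ 2) / s =
  `|C0| / B' / s + ((3 / 4 + A) * B + 6 * B * (B + A) ^+ 2) / s + D / B' / s by ring.
by rewrite lerD2r lerD2l; apply: le_trans f2; rewrite lerD2r.
Unshelve. all: end_near. Qed.
End qratio_limits.

Section q_asymptotics.
Context {R : realType}.

(** The Taylor term of order 2 (M + 1) of e^(d sqrt n) is a multiple of n^(M + 1), one power of n
    more than the polynomial. *)
Lemma nat_expR_sqrt_le (M : nat) (d : R) : 0 < d -> exists C : R, forall n : nat, (0 < n)%N ->
  n.+1%:R ^+ M * expR (- (d * Num.sqrt n%:R)) <= C / Num.sqrt n%:R.
Proof.
move=> d0; pose k := M.+1; exists (2 ^+ M * (2 * k)`!%:R / d ^+ (2 * k)) => n n0.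
have np : 0 < n%:R :> R by rewrite ltr0n.
set s := Num.sqrt n%:R; have s0 : 0 < s by rewrite sqrtr_gt0.
have s2 : n%:R = s ^+ 2 :> R by rewrite sqr_sqrtr ?ltW.
have sn : s <= n%:R by exact: sqrt_nat_le.
have h : (d * s) ^+ (2 * k) / (2 * k)`!%:R <= expR (d * s).
  have ds0 : 0 <= d * s by rewrite mulr_ge0 ?ltW.
  apply: le_trans (coshR_le_expR ds0); apply: le_trans (sum_coshw_le _ k.+1).
  by rewrite big_ord_recr /= lerDr sumr_ge0 // => i _; exact: coshw_ge0.
rewrite expRN ler_pdivrMr ?expR_gt0 // mulrAC ler_pdivlMr //.
have f0 : 0 < (2 * k)`!%:R :> R by rewrite ltr0n fact_gt0.
have dk : 0 < d ^+ (2 * k) by rewrite exprn_gt0.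
apply: (@le_trans _ _ (2 ^+ M * (2 * k)`!%:R / d ^+ (2 * k) * ((d * s) ^+ (2 * k) / (2 * k)`!%:R))); last first.
  by rewrite ler_wpM2l // divr_ge0 ?mulr_ge0 ?exprn_ge0 // ltW.
have -> : 2 ^+ M * (2 * k)`!%:R / d ^+ (2 * k) * ((d * s) ^+ (2 * k) / (2 * k)`!%:R) = 2 ^+ M * s ^+ (2 * k).
  by rewrite exprMn; field; rewrite !gt_eqF.
rewrite exprM -s2 /k exprSr mulrA; apply: ler_pM => //.
  exact: ltW.
rewrite -exprMn lerXn2r ?nnegrE ?mulr_ge0 //.
by rewrite -natrM ler_nat; lia.
Qed.

(** In its application [V] is 4 j^2 / z^2, which carries the asymptotics, and [v] is [coshv z j],
    whose moments telescope; [e] bounds their distance and the error [E]. The bounds 1 / 16 and 16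
    correspond to z / 8 <= j <= 2 z. *)
Lemma normr_expR_quadratic (g c : R) : exists2 C : R, 0 <= C &
  forall V v E e : R, 1 / 16 <= V <= 16 -> `|E| <= e -> e <= 1 -> `|V - v| <= e ->
  `|expR (g * ln V - c * (V - 1) + E) - 1 - (g - c) * (v - 1)| <= C * ((v - 1) ^+ 2 + e).
Proof.
have [k kE] : exists k : R, k = g - c by eexists.
have [M ME] : exists M : R, M = `|k| * 15 + `|g| * 16 * 225 + 1 by eexists.
have [C1 C1E] : exists C1 : R,
  C1 = 3 * (k ^+ 2 + (`|g| * 16) ^+ 2 * 225 + 1) * expR M + `|g| * 16 + 1 by eexists.
have C10 : 0 <= C1.
  have q : 0 <= 3 * (k ^+ 2 + (`|g| * 16) ^+ 2 * 225 + 1).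
    by have := sqr_ge0 k; have := sqr_ge0 (`|g| * 16); lra.
  have := mulr_ge0 q (expR_ge0 M); have := normr_ge0 g; rewrite C1E; lra.
exists (2 * C1 + C1 + `|k|) => [|V v E e /andP[V1 V2] Ee e1 Vv].
  by rewrite !addr_ge0 ?mulr_ge0.
rewrite -kE; have V0 : 0 < V by lra.
have e0 : 0 <= e by apply: le_trans Ee.
set W := V - 1.
have W15 : `|W| <= 15 by rewrite ler_norml /W; apply/andP; split; lra.
have W2 : W ^+ 2 <= 225.
  by rewrite -real_normK ?num_real //; have := normr_ge0 W; nra.
(* 1 - 1 / V <= ln V <= V - 1, and the gap is (V - 1)^2 / V. *)
have lnV : `|ln V - W| <= 16 * W ^+ 2.
  have h1 : ln V <= W by have := @le_ln1Dx R W; rewrite /W addrCA subrr addr0; apply; lra.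
  have h2 : ln V^-1 <= V^-1 - 1.
    have := @le_ln1Dx R (V^-1 - 1); rewrite addrCA subrr addr0; apply.
    by rewrite ltrBDl addrN invr_gt0.
  rewrite lnV ?posrE // in h2.
  have h3 : V^-1 <= 16.
    by rewrite -[leRHS]invrK lef_pV2 ?posrE ?invr_gt0 //; lra.
  have h4 : W - (1 - V^-1) = W ^+ 2 * V^-1 by rewrite /W; field; rewrite gt_eqF.
  rewrite ler0_norm ?subr_le0 // opprB.
  have := ler_wpM2l (sqr_ge0 W) h3; lra.
set G := g * (ln V - W).
have Gb : `|G| <= `|g| * 16 * W ^+ 2 by rewrite /G normrM -mulrA ler_wpM2l.
have -> : g * ln V - c * W + E = k * W + (G + E) by rewrite /G kE; ring.
set T := k * W + (G + E).
have G2 : `|G| <= `|g| * 16 * 225 by apply: le_trans Gb _; rewrite ler_wpM2l ?mulr_ge0.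
have TM : `|T| <= M.
  apply: le_trans (ler_normD _ _) _; rewrite ME -addrA; apply: lerD.
    by rewrite normrM ler_wpM2l.
  by apply: le_trans (ler_normD _ _) _; apply: lerD => //; exact: le_trans Ee e1.
have T2 : T ^+ 2 <= 3 * (k ^+ 2 + (`|g| * 16) ^+ 2 * 225 + 1) * (W ^+ 2 + e).
  have E2 : E ^+ 2 <= e by rewrite -real_normK ?num_real //; have := normr_ge0 E; nra.
  have G3 : G ^+ 2 <= (`|g| * 16) ^+ 2 * 225 * W ^+ 2.
    rewrite -real_normK ?num_real //.
    apply: (@le_trans _ _ ((`|g| * 16 * W ^+ 2) ^+ 2)).
      by rewrite ler_sqr ?nnegrE //; exact: le_trans (normr_ge0 _) Gb.
    by rewrite exprMn -mulrA ler_wpM2l ?sqr_ge0 // [X in X <= _]expr2 ler_wpM2r ?sqr_ge0.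
  have h : T ^+ 2 <= 3 * (k ^+ 2 * W ^+ 2 + G ^+ 2 + E ^+ 2).
    have := sqr_ge0 (k * W - G); have := sqr_ge0 (k * W - E); have := sqr_ge0 (G - E).
    by rewrite /T -exprMn; lra.
  apply: le_trans h _.
  have := mulr_ge0 (sqr_ge0 k) e0; have : 0 <= (`|g| * 16) ^+ 2 * 225 * e.
    by apply: mulr_ge0 => //; apply: mulr_ge0 => //; exact: sqr_ge0.
  have := sqr_ge0 W; lra.
have main : `|expR T - 1 - k * W| <= C1 * (W ^+ 2 + e).
  have -> : expR T - 1 - k * W = (expR T - 1 - T) + (G + E) by rewrite /T; ring.
  apply: le_trans (ler_normD _ _) _.
  have h1 := normr_expR_sub1_sub T.
  have h2 : T ^+ 2 * expR `|T| <= 3 * (k ^+ 2 + (`|g| * 16) ^+ 2 * 225 + 1) * (W ^+ 2 + e) * expR M.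
    by apply: ler_pM; rewrite ?sqr_ge0 ?expR_ge0 // ler_expR.
  have h3 : `|G + E| <= (`|g| * 16 + 1) * (W ^+ 2 + e).
    apply: le_trans (ler_normD _ _) _; have := mulr_ge0 (normr_ge0 g) e0; have := sqr_ge0 W; lra.
  rewrite C1E; lra.
have kWv : k * W = k * (v - 1) + k * (V - v) by rewrite /W; ring.
have -> : expR T - 1 - k * (v - 1) = (expR T - 1 - k * W) + k * (V - v) by rewrite kWv; ring.
apply: le_trans (ler_normD _ _) _.
have h5 : W ^+ 2 <= 2 * (v - 1) ^+ 2 + 2 * e.
  have Vv2 : (V - v) ^+ 2 <= e by rewrite -real_normK ?num_real //; have := normr_ge0 (V - v); nra.
  have -> : W = (v - 1) + (V - v) by rewrite /W; ring.
  have := sqr_ge0 ((v - 1) - (V - v)); lra.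
have h6 : `|k * (V - v)| <= `|k| * e by rewrite normrM ler_wpM2l.
have h7 := ler_wpM2l C10 h5; have := sqr_ge0 (v - 1); have := normr_ge0 k.
move=> k0 v0; have := mulr_ge0 k0 v0; have := mulr_ge0 C10 v0; have := mulr_ge0 C10 e0; lra.
Qed.
End q_asymptotics.

(** * Global bound and middle-range expansion of the ratio *)

Section qratio_estimates.
Context {R : realType}.

(** For [i >= 1] the numerator 1 - i / n is at most the denominator because i > -a2. At [i = 0] the
    denominator 1 + a2 / (2 n) may be less than 1 but exceeds 1 / 2. *)
Lemma qfactor_norm_le (al a2 : R) (n i : nat) : -1 < a2 -> (i < n)%N ->
  `|qfactor al a2 n i| <= (if i == 0%N then 2 else 1) * (1 + `|al| / n%:R).
Proof.
move=> a21 i_n; have n0 : (0 < n)%N by apply: leq_ltn_trans i_n.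
have np : 0 < n%:R :> R by rewrite ltr0n.
have nv : 0 < n%:R^-1 :> R by rewrite invr_gt0.
have i1n : i.+1%:R <= n%:R :> R by rewrite ler_nat.
rewrite -natr1 in i1n; have i0 := ler0n R i.
have u1 : i%:R / n%:R <= 1 :> R by rewrite ler_pdivrMr //; lra.
have u0 : 0 <= i%:R / n%:R :> R by rewrite divr_ge0.
have D : (i%:R - a2) / (2 * n%:R) < 1 by rewrite ltr_pdivrMr ?mulr_gt0 //; lra.
have b2 : `|1 - (al + i%:R) / n%:R| <= 1 + `|al| / n%:R.
  have -> : 1 - (al + i%:R) / n%:R = (1 - i%:R / n%:R) - al / n%:R by ring.
  apply: le_trans (ler_normB _ _) _; apply: lerD.
    by rewrite ger0_norm; lra.
  by rewrite normrM (gtr0_norm nv).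
have D0 : 0 < 1 - (i%:R - a2) / (2 * n%:R) by lra.
rewrite /qfactor normrM normfV (gtr0_norm D0) normrM mulrAC.
apply: ler_pM => //; first by rewrite divr_ge0 // ltW.
rewrite ger0_norm; last by lra.
rewrite ler_pdivrMr //; case: eqP => [->|/eqP].
  have : a2 / (2 * n%:R) > - (1 / 2).
    rewrite ltr_pdivlMr ?mulr_gt0 //; have : 1 <= n%:R :> R by rewrite ler1n.
    lra.
  by rewrite mul0r sub0r mulNr; lra.
rewrite -lt0n mul1r => ip; have i1 : 1 <= i%:R :> R by rewrite ler1n.
rewrite lerD2l lerN2 ler_pdivrMr ?mulr_gt0 //.
have -> : i%:R / n%:R * (2 * n%:R) = 2 * i%:R :> R by field; rewrite gt_eqF.
lra.
Qed.

(** A polynomial bound on the full range, enough against the exponentially small weights outside the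
    middle. With [m >= |al|], Bernoulli's inequality compares the shifted product with ((n + 1) / (j
    + 1))^m, which telescopes. *)
Lemma qratio_bound (al a2 : R) : -1 < a2 -> exists K : R, exists m : nat,
  forall n j : nat, (0 < n)%N -> (j <= n)%N -> `|qratio al a2 n j| <= K * n.+1%:R ^+ m.
Proof.
move=> a21; pose m := Num.bound `|al|; exists (2 * expR `|al|), m => n j n0 jn.
have np : 0 < n%:R :> R by rewrite ltr0n.
have nv : 0 < n%:R^-1 :> R by rewrite invr_gt0.
set t := 1 + `|al| / n%:R.
have t1 : 1 <= t by rewrite lerDl mulr_ge0 // ltW.
have P1 : `|\prod_(i < j) qfactor al a2 n i| <= 2 * expR `|al|.
  apply: (@le_trans _ _ (2 * t ^+ j)).
    rewrite normr_prod; case: j jn => [|j] jn.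
      by rewrite big_ord0 expr0 mulr1 ler1n.
    rewrite big_ord_recl exprS mulrA; apply: ler_pM => //.
    - by rewrite prodr_ge0.
    - by have := qfactor_norm_le al a21 n0; rewrite eqxx.
    - rewrite -[j in _ ^+ j]card_ord -prodr_const; apply: ler_prod => -[i ij] _ /=.
      rewrite normr_ge0 /=; have := @qfactor_norm_le al a2 n (bump 0 i) a21.
      by rewrite /bump /= add1n mul1r; apply; exact: leq_ltn_trans jn.
  rewrite ler_pM2l //; apply: (@le_trans _ _ (t ^+ n)); first exact: ler_weXn2l.
  have -> : `|al| = n%:R * (`|al| / n%:R) by field; rewrite gt_eqF.
  rewrite expRM_natl lerXn2r ?nnegrE ?expR_ge0 //; first by lra.
  exact: expR_ge1Dx.
have P2 : `|\prod_(j <= i < n) (1 + al / i.+1%:R)| <= n.+1%:R ^+ m.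
  apply: (@le_trans _ _ ((n.+1%:R / j.+1%:R) ^+ m)); last first.
    rewrite lerXn2r ?nnegrE ?divr_ge0 //.
    by rewrite ler_pdivrMr // ler_peMr // ler1n.
  rewrite -(subnKC jn); elim: (n - j)%N => [|d IH].
    by rewrite addn0 big_geq // normr1 divff ?pnatr_eq0 // expr1n.
  rewrite addnS big_nat_recr ?leq_addr //= normrM.
  set N := (j + d)%N in IH *.
  have E : N.+2%:R / j.+1%:R = N.+1%:R / j.+1%:R * (1 + N.+1%:R^-1) :> R.
    have h : N.+1%:R != 0 :> R by rewrite pnatr_eq0.
    rewrite -[N.+2%:R]natr1; field.
    by rewrite !nat1r !pnatr_eq0.
  rewrite E exprMn; apply: ler_pM => //.
  have Nv : 0 < N.+1%:R^-1 :> R by rewrite invr_gt0.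
  apply: le_trans (ler_normD _ _) _; rewrite normr1 normrM (gtr0_norm Nv).
  have am : `|al| <= m%:R by apply: ltW; exact: archi_boundP.
  apply: (@le_trans _ _ (1 + m%:R * N.+1%:R^-1)).
    by rewrite lerD2l ler_wpM2r // ltW.
  move: (N.+1%:R^-1) Nv => w w0; elim: (m) => [|k IHk]; first by rewrite mul0r addr0 expr0.
  rewrite exprS -natr1; have := ler0n R k => k0.
  have w1 : 0 <= 1 + w by lra.
  have := ler_wpM2l w1 IHk; have := mulr_ge0 k0 (mulr_ge0 (ltW w0) (ltW w0)); lra.
rewrite /qratio 2!normrM; apply: ler_pM; rewrite ?mulr_ge0 //.
rewrite -[leRHS]mul1r; apply: ler_pM => //.
by rewrite ger0_norm ?(ltW (wallis_gt0 j)) // wallis_le1.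
Qed.

(* The limit of qratio al a2 n j along j ~ sqrt (b n / 2), where the weights coshw concentrate. *)
Definition qlead (al b : R) (n : nat) : R :=
  expR (- (ln pi / 2) - (1 / 2 + al) / 2 * ln (b * n%:R / 2) + al * ln n%:R - 3 * b / 8).

Lemma qratio_mid (al a2 b : R) : 0 < b -> exists2 C : R, 0 <= C &
  \forall n \near \oo, forall j : nat,
    Num.sqrt (2 * b * n%:R) / 8 <= j%:R <= 2 * Num.sqrt (2 * b * n%:R) ->
    `|qratio al a2 n j - qlead al b n
      - qlead al b n * (- ((1 / 2 + al) / 2) - 3 * b / 8) * (coshv (Num.sqrt (2 * b * n%:R)) j - 1)|
    <= qlead al b n * C * ((coshv (Num.sqrt (2 * b * n%:R)) j - 1) ^+ 2 + (Num.sqrt n%:R)^-1).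
Proof.
move=> b0; pose B : R := Num.sqrt (2 * b).
have B0 : 0 < B by rewrite sqrtr_gt0 mulr_gt0.
have B80 : 0 < B / 8 by rewrite divr_gt0.
have B20 : 0 <= 2 * B by rewrite mulr_ge0 // ltW.
have B2 : B ^+ 2 = 2 * b by rewrite sqr_sqrtr // mulr_ge0 // ltW.
have [C1 H1] := qratio_ln al a2 B80 B20.
have [C2 C20 H2] := normr_expR_quadratic (- ((1 / 2 + al) / 2)) (3 * b / 8).
pose C3 : R := `|C1| + 4 / B.
have C30 : 0 <= C3 by rewrite addr_ge0 // divr_ge0 // ltW.
exists (C2 * (1 + C3)); first by rewrite mulr_ge0 // addr_ge0.
near=> n => j jj.
have n0 : (0 < n)%N by near: n; exact: nbhs_infty_gt.
have C3s : C3 / Num.sqrt n%:R <= 1 by near: n; exact: near_div_sqrt_le.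
have H1n : forall j : nat, B / 8 * Num.sqrt n%:R <= j%:R <= 2 * B * Num.sqrt n%:R ->
    0 < qratio al a2 n j /\
    `|ln (qratio al a2 n j) - (- (ln (pi * j%:R) / 2) - 3 / 4 * (j%:R ^+ 2 / n%:R)
       + al * (ln n%:R - ln j%:R))| <= C1 / Num.sqrt n%:R by near: n.
have np : 0 < n%:R :> R by rewrite ltr0n.
have s0 : 0 < Num.sqrt n%:R :> R by rewrite sqrtr_gt0.
have s2 : Num.sqrt n%:R ^+ 2 = n%:R :> R by rewrite sqr_sqrtr // ltW.
have zE : Num.sqrt (2 * b * n%:R) = B * Num.sqrt n%:R.
  by rewrite sqrtrM // mulr_ge0 // ltW.
rewrite zE in jj *; move: (Num.sqrt n%:R) s0 s2 zE jj C3s H1n => s s0 s2 zE jj C3s H1n.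
have jj' : B / 8 * s <= j%:R <= 2 * B * s.
  by rewrite -(mulrA 2) [B / 8 * s]mulrAC.
have [r0 rln] := H1n j jj'.
have /andP[jl ju] := jj.
have Bs0 : 0 < B * s by rewrite mulr_gt0.
have jp : 0 < j%:R :> R by apply: lt_le_trans jl; rewrite divr_gt0.
pose V : R := 4 * j%:R ^+ 2 / (B * s) ^+ 2.
have Bs2 : 0 < (B * s) ^+ 2 by rewrite exprn_gt0.
have V1 : 1 / 16 <= V <= 16.
  rewrite /V ler_pdivlMr // ler_pdivrMr //; apply/andP; split.
    have : (B * s / 8) ^+ 2 <= j%:R ^+ 2 by rewrite ler_sqr ?nnegrE ?divr_ge0 ?(ltW Bs0).
    by rewrite expr_div_n; lra.
  have : j%:R ^+ 2 <= (2 * (B * s)) ^+ 2 by rewrite ler_sqr ?nnegrE ?mulr_ge0 ?(ltW B0) ?(ltW s0).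
  by rewrite [(2 * _) ^+ 2]exprMn; lra.
have Vp : 0 < V by case/andP: V1 => h _; lra.
have xp : 0 < b * n%:R / 2 by rewrite divr_gt0 // mulr_gt0.
(* [V] is the square of j / (z / 2). Both ln j and j^2 / n become functions of [V], and their values
   at [V = 1] are collected in [qlead]. *)
have jV : j%:R ^+ 2 = V * (b * n%:R / 2).
  rewrite /V exprMn B2 s2; field; by rewrite !gt_eqF.
have lnj : ln j%:R = (ln V + ln (b * n%:R / 2)) / 2.
  have := congr1 (@ln R) jV; rewrite lnXn // lnM ?posrE // mulr2n; lra.
set v := coshv (B * s) j.
have Vv : `|V - v| <= C3 / s.
  have -> : V - v = 2 * j%:R / (B * s) ^+ 2.
    by rewrite /V /v /coshv natrM; field; rewrite !gt_eqF.
  rewrite ger0_norm; last by rewrite divr_ge0 ?mulr_ge0 // ltW.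
  apply: (@le_trans _ _ (4 / B / s)).
    rewrite ler_pdivrMr //.
    have -> : 4 / B / s * (B * s) ^+ 2 = 4 * (B * s) by field; rewrite !gt_eqF.
    lra.
  by rewrite ler_pM2r ?invr_gt0 // /C3 lerDr.
set E := ln (qratio al a2 n j) - (- (ln (pi * j%:R) / 2) - 3 / 4 * (j%:R ^+ 2 / n%:R)
       + al * (ln n%:R - ln j%:R)) in rln.
have Ee : `|E| <= C3 / s.
  apply: le_trans rln _; rewrite ler_pM2r ?invr_gt0 //.
  by apply: le_trans (ler_norm _) _; rewrite /C3 lerDl divr_ge0 // ltW.
have rE : qratio al a2 n j = qlead al b n *
    expR (- ((1 / 2 + al) / 2) * ln V - 3 * b / 8 * (V - 1) + E).
  rewrite /qlead -expRD -[LHS]lnK ?posrE //; congr expR.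
  have -> : ln (qratio al a2 n j) = E + (- (ln (pi * j%:R) / 2) - 3 / 4 * (j%:R ^+ 2 / n%:R)
       + al * (ln n%:R - ln j%:R)) by rewrite /E; ring.
  rewrite lnM ?posrE ?pi_gt0 // lnj jV.
  have -> : V * (b * n%:R / 2) / n%:R = V * b / 2 by field; rewrite gt_eqF.
  by field.
have := H2 V v E (C3 / s) V1 Ee C3s Vv.
have L0 : 0 < qlead al b n by exact: expR_gt0.
rewrite rE; move: (qlead al b n) L0 (expR _) => L L0 X h.
have -> : forall k w : R, L * X - L - L * k * w = L * (X - 1 - k * w) by move=> *; ring.
rewrite normrM (gtr0_norm L0) -[leRHS]mulrA ler_pM2l //.
apply: le_trans h _; rewrite -mulrA ler_wpM2l //.
have si : 0 <= s^-1 by rewrite invr_ge0 ltW.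
have := mulr_ge0 C30 (sqr_ge0 (v - 1)); lra.
Unshelve. all: end_near. Qed.
End qratio_estimates.

(** * Asymptotics of the weighted sum *)

Section q_limit.
Context {R : realType}.

(** Converts the multiplicative error of [asymp1] into the additive error of the theorem; since [c]
    is nonzero, both have the same order. *)
Lemma asymp1_bigO (X pref : nat -> R) (c : R) : (\forall n \near \oo, pref n != 0) -> c != 0 ->
  asymp1 (fun n => X n / (pref n * c)) ->
  exists2 delta : nat -> R,
    delta =O_\oo (fun n : nat => n%:R `^ (- (1 / 2)) : R) &
    \forall n \near \oo, X n = pref n * (c + delta n).
Proof.
move=> p0 c0 /asymp1_distP[C HC]; exists (fun n => X n / pref n - c).
  apply/eqO_exP; exists (`|c| * (`|C| + 1)) => //; first by rewrite /= mulr_gt0 ?normr_gt0 // ltr_wpDl.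
  near=> n.
  have n0 : (0 < n)%N by near: n; exact: nbhs_infty_gt.
  have pn : pref n != 0 by near: n.
  have h : `|X n / (pref n * c) - 1| <= C / Num.sqrt n%:R by near: n.
  have s0 : 0 < Num.sqrt n%:R :> R by rewrite sqrtr_gt0 ltr0n.
  have -> : X n / pref n - c = c * (X n / (pref n * c) - 1) by field; rewrite pn c0.
  have -> : `|n%:R `^ (- (1 / 2))| = (Num.sqrt n%:R)^-1 :> R.
    by rewrite ger0_norm ?powR_ge0 // powRN mul1r powR12_sqrt.
  rewrite normrM -[leRHS]mulrA ler_wpM2l //.
  apply: le_trans h _; rewrite ler_pM2r ?invr_gt0 //.
  by apply: le_trans (ler_norm _) _; rewrite lerDl.
near=> n.
have pn : pref n != 0 by near: n.
by field; rewrite pn.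
Unshelve. all: end_near. Qed.

Lemma q_weighted_asymp (al a2 b : R) : -1 < a2 -> 0 < b ->
  asymp1 (fun n => (\sum_(j < n.+1) coshw (Num.sqrt (2 * b * n%:R)) j * qratio al a2 n j)
     / (qlead al b n * expR (Num.sqrt (2 * b * n%:R)) / 2)).
Proof.
move=> a21 b0.
have [K [m HK]] := qratio_bound al a21.
have [C C0 HC] := qratio_mid al a2 b0.
pose B : R := Num.sqrt (2 * b).
have B0 : 0 < B by rewrite sqrtr_gt0 mulr_gt0.
pose k : R := - ((1 / 2 + al) / 2) - 3 * b / 8.
have B4 : 0 < B / 4 by rewrite divr_gt0.
have K0 : 0 <= K * 2 ^+ m by apply: le_trans (HK 1%N 0%N isT isT).
have [D0 HD0] := nat_expR_sqrt_le 0 B4.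
pose th : R := (1 / 2 + al) / 2 - al.
pose c0 : R := ln pi / 2 + (1 / 2 + al) / 2 * ln (b / 2) + 3 * b / 8.
pose M := Num.bound `|th|.
have [D HD] := nat_expR_sqrt_le (m + M) B4.
(* [qlead] is a constant times a fixed power of [n], so its inverse grows at most polynomially and
   e^(-z / 4) absorbs it. *)
have qleadV n : (0 < n)%N -> (qlead al b n)^-1 <= expR c0 * n.+1%:R ^+ M.
  move=> n0; have np : 0 < n%:R :> R by rewrite ltr0n.
  have l0 : 0 <= ln (n%:R : R) by rewrite ln_ge0 // ler1n.
  have l1 : ln (n%:R : R) <= ln (n.+1%:R) by rewrite ler_ln ?posrE ?ltr0n // ler_nat.
  have -> : n.+1%:R ^+ M = expR (M%:R * ln (n.+1%:R : R)).
    by rewrite expRM_natl lnK // posrE ltr0n.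
  rewrite /qlead -expRN -expRD ler_expR.
  have -> : b * n%:R / 2 = (b / 2) * n%:R by rewrite mulrAC.
  rewrite lnM ?posrE ?divr_gt0 //.
  have tM : `|th| <= M%:R by apply/ltW/archi_boundP.
  have : th * ln (n%:R : R) <= M%:R * ln (n.+1%:R : R).
    apply: le_trans (ler_wpM2r l0 (ler_norm th)) _.
    by apply: ler_pM.
  move=> tl; rewrite (_ : - _ = c0 + th * ln n%:R) ?lerD2l //.
  by rewrite /c0 /th; ring.
apply: (@asymp1_dist _ _ (D0 + 2 * (C * (16 / B + 1)) + 2 * ((4 * C + 8 * `|k| + 5) * D0 + 5 * `|K| * expR c0 * D))).
near=> n.
have n0 : (0 < n)%N by near: n; exact: nbhs_infty_gt.
have HCn : forall j : nat,
    Num.sqrt (2 * b * n%:R) / 8 <= j%:R <= 2 * Num.sqrt (2 * b * n%:R) ->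
    `|qratio al a2 n j - qlead al b n
      - qlead al b n * k * (coshv (Num.sqrt (2 * b * n%:R)) j - 1)|
    <= qlead al b n * C * ((coshv (Num.sqrt (2 * b * n%:R)) j - 1) ^+ 2 + (Num.sqrt n%:R)^-1) by near: n.
have s1 : 1 / B <= Num.sqrt n%:R by near: n; exact: near_sqrt_ge.
have s3 : 2 * B <= Num.sqrt n%:R by near: n; exact: near_sqrt_ge.
have np : 0 < n%:R :> R by rewrite ltr0n.
have s0 : 0 < Num.sqrt n%:R :> R by rewrite sqrtr_gt0.
have s2 : Num.sqrt n%:R ^+ 2 = n%:R :> R by rewrite sqr_sqrtr // ltW.
have zE : Num.sqrt (2 * b * n%:R) = B * Num.sqrt n%:R.
  by rewrite sqrtrM // mulr_ge0 // ltW.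
have qV := qleadV n n0; have d0 := HD0 n n0; have dM := HD n n0.
rewrite zE in HCn *; move: (Num.sqrt n%:R) s0 s1 s2 s3 HCn d0 dM {zE} => s s0 s1 s2 s3 HCn d0 dM.
have z0 : 0 < B * s by rewrite mulr_gt0.
have L0 : 0 < qlead al b n by exact: expR_gt0.
have si0 : 0 <= s^-1 by rewrite invr_ge0 ltW.
have z1 : 1 <= B * s by rewrite mulrC -ler_pdivrMr.
have zn : 2 * (B * s) <= n%:R by rewrite -s2 mulrA expr2 ler_wpM2r // ltW.
have main := cosh_weighted_sum z1 zn L0 C0 si0 (fun j jn => HK n j n0 jn) HCn.
set Sg := \sum_(j < n.+1) _ in main *.
have pK : 0 < n.+1%:R ^+ m :> R by rewrite exprn_gt0 // ltr0n.
have dS : n.+1%:R ^+ m * (qlead al b n)^-1 * expR (- (B / 4 * s)) <= expR c0 * (D / s).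
  apply: (@le_trans _ _ (expR c0 * (n.+1%:R ^+ (m + M) * expR (- (B / 4 * s))))).
    rewrite exprD mulrA ler_wpM2r ?expR_ge0 // mulrCA.
    by rewrite ler_wpM2l // ltW.
  by rewrite ler_wpM2l ?expR_ge0.
(* The scale e^(-z / 4): the error e^(3 z / 4) is e^z [e4], and the term e^(-z) of cosh z is e^z
   [e4 ^+ 8]. *)
set e4 := expR (- (B / 4 * s)) in d0 dS dM.
have e40 : 0 < e4 by exact: expR_gt0.
have e41 : e4 <= 1.
  by rewrite -[X in _ <= X]expR0 ler_expR oppr_le0 mulr_ge0 // ltW.
have E0 : 0 < expR (B * s) by exact: expR_gt0.
have E34 : expR (3 / 4 * (B * s)) = expR (B * s) * e4.
  by rewrite -expRD; congr expR; field.
have Em : expR (- (B * s)) = expR (B * s) * e4 ^+ 8.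
  by rewrite -expRM_natl -expRD; congr expR; field.
have cE : coshR (B * s) = (expR (B * s) + expR (- (B * s))) / 2 by [].
rewrite {}cE {}E34 {}Em in main.
rewrite expr0 mul1r in d0.
have e8 : e4 ^+ 8 <= D0 / s.
  by apply: le_trans d0; rewrite exprS ler_piMr ?exprn_ile1 // ltW.
have KS : K * (n.+1%:R ^+ m * (qlead al b n)^-1 * e4) <= `|K| * (expR c0 * (D / s)).
  apply: (@le_trans _ _ (`|K| * (n.+1%:R ^+ m * (qlead al b n)^-1 * e4))).
    rewrite ler_wpM2r ?ler_norm // mulr_ge0 ?(ltW e40) // mulr_ge0 ?invr_ge0 //; exact: ltW.
  by rewrite ler_wpM2l.
have k0 : 0 <= 4 * C + 8 * `|k| + 5 by have := normr_ge0 k; lra.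
have dk : (4 * C + 8 * `|k| + 5) * e4 <= (4 * C + 8 * `|k| + 5) * (D0 / s) by rewrite ler_wpM2l.
move: main KS e8 dk L0 E0 B0 s0 {d0 dS dM qV k0}.
move: (n.+1%:R ^+ m) (expR c0) (4 * C + 8 * `|k| + 5) (`|K|) (qlead al b n) (expR (B * s)).
move=> N ec kk nK L E main KS e8 dk L0 E0 Bp sp.
have -> : Sg / (L * E / 2) - 1 = 2 / (L * E) * (Sg - L * ((E + E * e4 ^+ 8) / 2)) + e4 ^+ 8.
  by field; rewrite ?gt_eqF.
apply: le_trans (ler_normD _ _) _.
rewrite normrM (ger0_norm (ltW _ : 0 <= 2 / (L * E))) ?divr_gt0 ?mulr_gt0 //.
rewrite (ger0_norm (exprn_ge0 _ (ltW e40))).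
have LE : 0 <= 2 / (L * E) by rewrite divr_ge0 // mulr_ge0 // ltW.
have h2 := ler_wpM2l LE main.
apply: le_trans (lerD h2 e8) _.
have -> : 2 / (L * E) * (L * C * (16 / (B * s) + s^-1) * E + (L * kk + 5 * (K * N)) * (E * e4))
  = 2 * (C * (16 / B + 1)) / s + 2 * (kk * e4) + 10 * (K * (N / L * e4)).
  by field; rewrite ?gt_eqF.
have -> : (D0 + 2 * (C * (16 / B + 1)) + 2 * (kk * D0 + 5 * nK * ec * D)) / s
  = 2 * (C * (16 / B + 1)) / s + 2 * (kk * (D0 / s)) + 10 * (nK * (ec * (D / s))) + D0 / s.
  by field; rewrite ?gt_eqF.
rewrite lerD2r; apply: lerD; first by rewrite lerD2l; apply: ler_wpM2l.
exact: ler_wpM2l.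
Unshelve. all: end_near. Qed.
End q_limit.

Section q_asymptotics.
Context {R : realType}.

Lemma pochR_Gamma (a : R) m : -1 < a -> pochR (a + 1) m * Gamma (a + 1) = Gamma (m%:R + 1 + a).
Proof.
move=> a1; elim: m => [|m IH]; first by rewrite /pochR big_ord0 mul1r add0r addrC.
rewrite /pochR big_ord_recr /= mulrAC -/(pochR _ _) IH.
have -> : m.+1%:R + 1 + a = (m%:R + 1 + a) + 1 by rewrite -natr1; ring.
rewrite Gamma_rec; last by have := ler0n R m; lra.
by rewrite [RHS]mulrC; congr (_ * _); ring.
Qed.

Lemma powR_lnE (x y : R) : 0 < x -> x `^ y = expR (y * ln x).
Proof. by move=> x0; rewrite /powR gt_eqF. Qed.

Lemma sqrt_lnE (x : R) : 0 < x -> Num.sqrt x = expR (ln x / 2).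
Proof. by move=> x0; rewrite -powR12_sqrt ?ltW // powR_lnE // mulrC. Qed.

(** (a2 + 1)_(2 n) is Gamma (2 n + 1 + a2) / Gamma (a2 + 1), so [Gamma_ratio] treats the prefactor
    and [q_weighted_asymp] the sum. What is left is an identity of constants and powers, verified on
    logarithms in [key]. *)
Lemma q_asymp (a1 a2 b : R) : -1 < a2 -> 0 < b ->
  asymp1 (fun n => qR n a1 a2 b / (((2 * n)`!)%:R
            * (expR (Num.sqrt (2 * b * n%:R)) / n%:R `^ (1 / 4 - (a1 + a2) / 2)) * c2 a1 a2 b)).
Proof.
move=> a21 b0.
have aG : asymp1 (fun n => Gamma_ratio a2 (2 * n)).
  have [C HC] := Gamma_ratio_asymp a21.
  have := asymp1_comp_double (ex_intro _ C HC).
  by [].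
apply: asymp1_near (asymp1M aG (q_weighted_asymp (a1 - a2) a21 b0)).
near=> n.
have n0 : (0 < n)%N by near: n; exact: nbhs_infty_gt.
have np : 0 < n%:R :> R by rewrite ltr0n.
have G0 : 0 < Gamma (a2 + 1) by apply: Gamma_gt0; lra.
have f0 : 0 < ((2 * n)`!)%:R :> R by rewrite ltr0n fact_gt0.
have -> : a1 = a2 + (a1 - a2) by ring.
rewrite qR_weighted_sum // /Gamma_ratio -pochR_Gamma // addrAC subrr add0r.
set Sg := \sum_(j < n.+1) _.
have n2 : (2 * n)%:R = 2 * n%:R :> R by rewrite natrM.
have pi0 := pi_gt0 R.
rewrite /qlead /c2 n2 !powR_lnE ?mulr_gt0 // (sqrt_lnE pi0) !lnM ?posrE ?invr_gt0 ?mulr_gt0 //.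
set E1 := expR (a2 * _); set E2 := expR (- _ - _ + _ - _); set ez := expR (Num.sqrt _).
set E3 := expR (_ * ln n%:R); set E4 := expR (_ * ln 2); set E5 := expR (_ * ln b).
set E6 := expR (3 * b / 8); set E7 := expR (ln pi / 2).
have key : 2 * E4 = E1 * E2 * E3 * E5 * E6 * E7.
  have {1}-> : 2 = expR (ln 2) :> R by rewrite lnK // posrE.
  by rewrite -!expRD lnV ?posrE //; congr expR; field.
have [e1 e2 e3 e5 [e6 e7]] : [/\ 0 < E1, 0 < E2, 0 < E3, 0 < E5 & 0 < E6 /\ 0 < E7] by rewrite !expR_gt0.
have e4 : E4 = E1 * E2 * E3 * E5 * E6 * E7 / 2 by rewrite -key mulrAC mulfV ?mul1r.
have ez0 : 0 < ez by exact: expR_gt0.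
rewrite e4; field; rewrite ?gt_eqF //.
Unshelve. all: end_near. Qed.
End q_asymptotics.

(** * The kernel of the linear form *)

Section partial_fractions.
Context {R : realType}.
Implicit Types X al : R.

(** Partial fractions by finite differences: Pascal's rule gives f_(n+1)(X) = f_n(X - 1) - f_n(X),
    and the right-hand side satisfies the same recursion. *)
Lemma alternating_binomial_inverse n X : (forall m : nat, (m <= n)%N -> X != m%:R) ->
  \sum_(m < n.+1) 'C(n, m)%:R * (-1) ^+ (n - m) / (X - m%:R)
  = n`!%:R / \prod_(m < n.+1) (X - m%:R).
Proof.
elim: n X => [|n IH] X XN.
  by rewrite !big_ord_recl !big_ord0 /= bin0 expr0 !mul1r mulr1 addr0.
pose f X := \sum_(m < n.+1) 'C(n, m)%:R * (-1) ^+ (n - m) / (X - m%:R).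
have -> : \sum_(m < n.+2) 'C(n.+1, m)%:R * (-1) ^+ (n.+1 - m) / (X - m%:R) = f (X - 1) - f X.
  rewrite big_ord_recl /= bin0 mul1r subr0 subn0.
  under eq_bigr => i _ do
    rewrite /bump add1n binS natrD subSS -(addrC 'C(n, i)%:R) !mulrDl.
  rewrite big_split /= addrCA; congr (_ + _).
    by apply: eq_bigr => i _; rewrite -natr1 opprD addrA addrAC.
  rewrite -sumrN [X in _ = X]big_ord_recl /= [in LHS]big_ord_recr /= bin_small // !mul0r addr0.
  congr (_ + _); first by rewrite bin0 subn0 exprS subr0 mulN1r mul1r mulNr.
  apply: eq_bigr => i _; rewrite /bump add1n -(subnSK (ltn_ord i)) exprS.
  by rewrite mulN1r mulrN mulNr.
rewrite /f !IH; first last.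
- by move=> m mn; rewrite subr_eq natr1 XN.
- by move=> m mn; rewrite XN // leqW.
have pX : \prod_(m < n.+2) (X - m%:R) = X * \prod_(m < n.+1) (X - 1 - m%:R).
  rewrite big_ord_recl subr0; congr (_ * _); apply: eq_bigr => i _.
  by rewrite lift0 -natr1; ring.
have pX2 : \prod_(m < n.+2) (X - m%:R) = \prod_(m < n.+1) (X - m%:R) * (X - n.+1%:R).
  by rewrite big_ord_recr.
have X0 : X != 0 by rewrite (XN 0%N).
have Xn : X - n.+1%:R != 0 by rewrite subr_eq0 XN.
have P0 : \prod_(m < n.+1) (X - m%:R) != 0.
  by apply/prodf_neq0 => i _; rewrite subr_eq0 XN // ltnW.
rewrite pX2 factS natrM.
have -> : \prod_(m < n.+1) (X - 1 - m%:R) = (\prod_(m < n.+1) (X - m%:R)) * (X - n.+1%:R) / X.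
  by rewrite -pX2 pX mulrAC mulfV ?mul1r.
move: (\prod_(m < n.+1) _) P0 => P P0.
move: (n.+1%:R : R) Xn => y Xn.
by field; rewrite P0 X0 Xn.
Qed.

(** The coefficient left when one index of the double sum in [kernel_primitive] is summed by partial
    fractions at X = k - al. *)
Definition kernel_coef al n k : R :=
  'C(n, k)%:R * (-1) ^+ (n - k) * (n`!%:R / \prod_(j < n.+1) (k%:R - al - j%:R)).

Lemma fact_sqr_sine_prod al n :
  n`!%:R ^+ 2 * sine_prod al n = \prod_(0 <= i < n) ((i.+1%:R + al) * (i.+1%:R - al)).
Proof.
rewrite /sine_prod; elim: n => [|n IH]; first by rewrite big_ord0 big_nil fact0; ring.
rewrite big_ord_recr big_nat_recr //= -IH factS natrM.
by field; rewrite nat1r pnatr_eq0.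
Qed.

Lemma falling_prod n k al : (k <= n)%N ->
  \prod_(i < k) (n%:R + al - i%:R) = \prod_(n - k <= i < n) (i.+1%:R + al).
Proof.
move=> kn; rewrite -(big_mkord xpredT (fun i => n%:R + al - i%:R)) -[(n - k)%N]add0n big_addn.
rewrite subKn // [RHS]big_nat_rev /=; apply: eq_big_nat => i /andP[_ ik].
have -> : (0 + k - i.+1 + (n - k)).+1 = (n - i)%N by move: ik kn; clear; lia.
rewrite natrB; first by rewrite addrAC.
  by apply/ltnW; apply: leq_trans ik _; exact: kn.
Qed.

(** Cutting the product over [j] at [j = k] leaves -al and initial pieces of the products of i + 1 -
    al and i + 1 + al. The pieces missing from [n!^2 * sine_prod al n] are the numerators of the two
    binomials, so the common factor does not depend on [k]. *)
Lemma kernel_coefE al n k : (k <= n)%N -> (forall m : int, al != m%:~R) -> sine_prod al n != 0 ->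
  kernel_coef al n k
  = - (gbinomR (n%:R + al) k * gbinomR (n%:R - al) (n - k)) / (al * sine_prod al n).
Proof.
move=> kn alZ S0.
have al0 : al != 0 by rewrite (alZ 0).
pose p i : R := i.+1%:R + al; pose m i : R := i.+1%:R - al.
have g3 : \prod_(j < n.+1) (k%:R - al - j%:R)
  = \prod_(0 <= i < k) m i * (- al * ((-1) ^+ (n - k) * \prod_(0 <= i < n - k) p i)).
  rewrite -(big_mkord xpredT (fun j => k%:R - al - j%:R)) (@big_cat_nat _ _ _ k) ?leqW //=.
  congr (_ * _).
    rewrite big_nat_rev /=; apply: eq_big_nat => i /andP[_ ik].
    by rewrite add0n (natrB _ ik) /m; ring.
  rewrite -{1}[k]add0n big_addn subSn // big_nat_recl //= add0n addrAC subrr add0r; congr (_ * _).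
  rewrite -[in (-1) ^+ _](subn0 (n - k)%N) -prodr_const_nat -big_split /=; apply: eq_bigr => i _.
  by rewrite /p natrD; ring.
have pq : n`!%:R ^+ 2 * sine_prod al n = (\prod_(0 <= i < n - k) p i * \prod_(n - k <= i < n) p i)
    * (\prod_(0 <= i < k) m i * \prod_(k <= i < n) m i).
  rewrite fact_sqr_sine_prod big_split /=.
  by congr (_ * _); rewrite -big_cat_nat // leq_subr.
rewrite /kernel_coef /gbinomR g3 falling_prod // falling_prod ?leq_subr // subKn //.
rewrite -/(m _).
rewrite -[X in X * (-1) ^+ _](@mulfK _ (k`! * (n - k)`!)%:R); last first.
  by rewrite pnatr_eq0 -lt0n muln_gt0 !fact_gt0.
rewrite -natrM bin_fact // natrM.
move: pq; rewrite -/(p _) -/(m _).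
have fk : k`!%:R != 0 :> R by rewrite pnatr_eq0 -lt0n fact_gt0.
have fnk : (n - k)`!%:R != 0 :> R by rewrite pnatr_eq0 -lt0n fact_gt0.
have fn : n`!%:R != 0 :> R by rewrite pnatr_eq0 -lt0n fact_gt0.
have s0 : (-1) ^+ (n - k) != 0 :> R by rewrite signr_eq0.
have pN j : \prod_(0 <= i < j) p i != 0.
  rewrite big_mkord; apply/prodf_neq0 => i _; rewrite /p addrC addr_eq0.
  by have := alZ (- (i.+1%:Z)); rewrite mulrNz.
have mN j : \prod_(0 <= i < j) m i != 0.
  rewrite big_mkord; apply/prodf_neq0 => i _; rewrite /m subr_eq0 eq_sym.
  exact: (alZ i.+1).
move: (pN (n - k)%N) (mN k).
set pa := \prod_(0 <= i < n - k) p i; set pb := \prod_(n - k <= i < n) p i.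
set ma := \prod_(0 <= i < k) m i; set mb := \prod_(k <= i < n) m i.
move=> pa0 ma0 pq.
have sE : sine_prod al n = (pa * pb) * (ma * mb) / n`!%:R ^+ 2.
  by rewrite -pq mulrAC mulfV ?mul1r // expf_neq0.
have : pa * pb * (ma * mb) != 0 by rewrite -pq mulf_neq0 // expf_neq0.
rewrite !mulf_eq0 !negb_or => /andP[/andP[_ pb0] /andP[_ mb0]].
rewrite {}sE; move: ((-1) ^+ (n - k)) s0 pa pb ma mb pa0 ma0 pb0 mb0 {pq g3} fn fk fnk al0.
move: (n`!%:R : R) (k`!%:R : R) ((n - k)`!%:R : R) => fn fk fnk sg s0 pa pb ma mb pa0 ma0 pb0 mb0 *.
by field; apply/and5P; split => //; apply/and5P; split.
Qed.
End partial_fractions.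

Section kernel.
Context {R : realType}.
Variables (a1 a2 : R) (n : nat).
Let al := a1 - a2.
Hypothesis alZ : forall m : int, al != m%:~R.

Definition signed_bin k : R := 'C(n, k)%:R * (-1) ^+ (n - k).

(* An antiderivative in h of kernel_factor a2 h * kernel_factor a1 (t - h), obtained by
   expanding both factors. *)
Definition kernel_primitive t h : R := \sum_(k < n.+1) \sum_(m < n.+1)
  signed_bin k * signed_bin m / (k%:R - m%:R - al)
    * expR ((n%:R + k%:R + a2) * h + (n%:R + m%:R + a1) * (t - h)).

(** In the variable y = e^h this is (y - 1)^n y^(n + a). *)
Definition kernel_factor a h : R := (expR h - 1) ^+ n * expR ((n%:R + a) * h).

(** The expanded form of K(e^t), for the K of the overview. *)
Definition kernel t : R :=
  \sum_(k < n.+1) kernel_coef al n k * expR ((n%:R + k%:R + a2) * t)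
  + \sum_(m < n.+1) kernel_coef (- al) n m * expR ((n%:R + m%:R + a1) * t).

Lemma expR_sub1_exprn a h :
  kernel_factor a h = \sum_(k < n.+1) signed_bin k * expR ((n%:R + k%:R + a) * h).
Proof.
rewrite /kernel_factor addrC exprDn mulr_suml; apply: eq_bigr => k _.
rewrite -expRM_natl /signed_bin -[in LHS]mulr_natl -!mulrA -expRD; congr (_ * (_ * expR _)).
by rewrite -!mulrDl; congr (_ * _); ring.
Qed.

Lemma kernel_diff_neq0 (k m : nat) : k%:R - m%:R - al != 0.
Proof.
by rewrite subr_eq0 eq_sym; have := alZ (k%:Z - m%:Z); rewrite rmorphB.
Qed.

Lemma is_derive_kernel_primitive (t h : R) :
  is_derive h 1 (kernel_primitive t) (kernel_factor a2 h * kernel_factor a1 (t - h)).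
Proof.
pose D (k m : nat) : R := signed_bin k * signed_bin m
  * expR ((n%:R + k%:R + a2) * h + (n%:R + m%:R + a1) * (t - h)).
have dkm (k m : nat) : is_derive h 1 (fun h => signed_bin k * signed_bin m / (k%:R - m%:R - al)
    * expR ((n%:R + k%:R + a2) * h + (n%:R + m%:R + a1) * (t - h))) (D k m).
  have K := kernel_diff_neq0 k m.
  apply: is_derive_eq.
  rewrite /GRing.scale /= /D.
  have -> : (n%:R + k%:R + a2) * 1 + (n%:R + m%:R + a1) * ((0 + 1) * -1) = k%:R - m%:R - al.
    by rewrite /al; ring.
  by rewrite mulrA mulrAC mulfVK.
have -> : kernel_factor a2 h * kernel_factor a1 (t - h) = \sum_(k < n.+1) \sum_(m < n.+1) D k m.
  rewrite !expR_sub1_exprn mulr_suml; apply: eq_bigr => k _.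
  rewrite mulr_sumr; apply: eq_bigr => m _.
  by rewrite mulrACA -expRD.
have -> : kernel_primitive t = \sum_(k < n.+1) \sum_(m < n.+1) (fun h => signed_bin k * signed_bin m / (k%:R - m%:R - al)
    * expR ((n%:R + k%:R + a2) * h + (n%:R + m%:R + a1) * (t - h))).
  by apply/funext => x; rewrite fct_sumE; apply: eq_bigr => k _; rewrite fct_sumE.
apply: is_derive_sum => k; exact: is_derive_sum.
Qed.

(** At [h = t] the exponential depends only on [k], at [h = 0] only on [m]; the other index is
    summed by [alternating_binomial_inverse]. *)
Lemma kernel_primitiveE t : kernel_primitive t t - kernel_primitive t 0 = kernel t.
Proof.
rewrite /kernel_primitive; congr (_ + _).
  apply: eq_bigr => k _; rewrite subrr.
  under eq_bigr do rewrite mulr0 addr0.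
  rewrite -mulr_suml; congr (_ * _).
  under eq_bigr do rewrite -mulrA addrAC.
  rewrite -mulr_sumr /kernel_coef; congr (_ * _).
  rewrite alternating_binomial_inverse //.
  by move=> m _; have := kernel_diff_neq0 k m; rewrite addrAC subr_eq0.
rewrite exchange_big -sumrN; apply: eq_bigr => m _; rewrite subr0.
under eq_bigr do rewrite mulr0 add0r.
rewrite -mulr_suml -mulNr; congr (_ * _).
rewrite /kernel_coef -alternating_binomial_inverse; last first.
  by move=> k _; have := kernel_diff_neq0 k m; rewrite -subr_eq0 -oppr_eq0; apply: contra_neq => <-; ring.
rewrite -sumrN mulr_sumr; apply: eq_bigr => k _.
rewrite -/(signed_bin m) -/(signed_bin k).
have -> : m%:R - - al - k%:R = - (k%:R - m%:R - al) by ring.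
by rewrite invrN; ring.
Qed.
End kernel.

(** * Signed integrals with known value *)

Section kernel_sign.
Context {R : realType}.
Local Notation mu := (@lebesgue_measure R).

Definition has_integral (f : R -> R) (v : R) :=
  mu.-integrable setT (EFin \o f) /\ (\int[mu]_x (f x)%:E = v%:E)%E.

Lemma has_integralD f g u v : has_integral f u -> has_integral g v ->
  has_integral (fun x => f x + g x) (u + v).
Proof.
move=> [If iu] [Ig iv]; split.
  by have := integrableD measurableT If Ig.
have := integralD measurableT If Ig.
by move=> h; exact: etrans h (congr2 adde iu iv).
Qed.

Lemma has_integralZ f u k : has_integral f u -> has_integral (fun x => k * f x) (k * u).
Proof.
move=> [If iu]; split.
  by have := integrableZl measurableT k If.
have h := integralZl measurableT If k.
exact: etrans h (congr1 (mule k%:E) iu).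
Qed.

Lemma has_integral_sum N (F : nat -> R -> R) (v : nat -> R) :
  (forall i, has_integral (F i) (v i)) ->
  has_integral (fun x => \sum_(i < N) F i x) (\sum_(i < N) v i).
Proof.
move=> h; elim: N => [|N IH].
  rewrite big_ord0; split; last by under eq_integral do rewrite big_ord0; rewrite integral0.
  by under eq_fun do rewrite big_ord0; exact: integrable0.
rewrite big_ord_recr /=.
have -> : (fun x => \sum_(i < N.+1) F i x) = (fun x => \sum_(i < N) F i x + F N x).
  by apply/funext => x; rewrite big_ord_recr.
exact: has_integralD.
Qed.

Lemma has_integral_logGammaF (s r : R) : 0 < s -> 0 < r ->
  has_integral (logGammaF s r) (Gamma s * r `^ (- s)).
Proof.
move=> s0 r0; split; last exact: integral_logGammaF_scale.
apply/integrableP; split; first by apply/measurable_EFinP; exact: measurable_logGammaF.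
have -> : (\int[mu]_x `|(EFin \o logGammaF s r) x| = \int[mu]_x (logGammaF s r x)%:E)%E.
  by apply: eq_integral => x _ /=; rewrite ger0_norm // logGammaF_ge0.
by rewrite integral_logGammaF_scale // ltry.
Qed.

(** Tonelli's theorem is applied to a nonnegative integrand, while the kernel is signed. Passing to
    the positive part adds the integral [r] of the negative part, which [g] controls. *)
Lemma has_integral_funepos f v (B : R) (g : R -> R) : has_integral f v ->
  measurable_fun setT g -> (forall x, - g x <= f x) ->  (forall x, 0 <= g x) ->
  (\int[mu]_x (g x)%:E <= B%:E)%E ->
  exists2 r, 0 <= r <= B & (\int[mu]_x (Num.max (f x) 0)%:E = (v + r)%:E)%E.
Proof.
move=> [If iv] mg gf g0 gB.
have mf : measurable_fun setT f by have /measurable_EFinP := measurable_int _ If.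
have mN : measurable_fun setT (fun x => Num.max (- f x) 0).
  apply: measurable_maxr; last exact: measurable_cst.
  exact: measurableT_comp.
have I1 : (\int[mu]_x (Num.max (f x) 0)%:E = \int[mu]_x ((EFin \o f)^\+ x))%E.
  by apply: eq_integral => x _; rewrite funeposE EFin_max.
have I2 : (\int[mu]_x (Num.max (- f x) 0)%:E = \int[mu]_x ((EFin \o f)^\- x))%E.
  by apply: eq_integral => x _; rewrite funenegE EFin_max.
have := integralE mu setT (EFin \o f); rewrite -I1 -I2 [X in X = _]iv.
have le : (\int[mu]_x (Num.max (- f x) 0)%:E <= B%:E)%E.
  apply: le_trans gB; apply: ge0_integralT_le => // x; first by rewrite le_max lexx orbT.
  by rewrite ge_max g0 lerNl gf.
have ge : (0 <= \int[mu]_x (Num.max (- f x) 0)%:E)%E.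
  by apply: integral_ge0 => x _; rewrite lee_fin le_max lexx orbT.
case: (\int[mu]_x (Num.max (- f x) 0)%:E)%E le ge => [r| |] //.
rewrite !lee_fin => rB r0; case: (\int[mu]_x _)%E => [p| |] // [] vE.
by exists r; [rewrite r0 | rewrite vE; congr EFin; ring].
Qed.
End kernel_sign.

(** * The kernel as a convolution *)

Section kernel_integral.
Context {R : realType}.
Local Notation mu := (@lebesgue_measure R).
Variables (a1 a2 b : R) (n : nat).
Let al := a1 - a2.
Hypotheses (alZ : forall m : int, al != m%:~R) (a11 : -1 < a1) (a21 : -1 < a2) (b0 : 0 < b).
Hypothesis n2 : (2 <= n)%N.

Let na (a : R) : -1 < a -> 1 <= n%:R + a.
Proof.
move=> h; have : 2 <= n%:R :> R by rewrite ler_nat.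
lra. Qed.

(** By the mean value theorem the kernel is [t] times the product of the two factors at some point
    of [[t, 0]]. There the signs (-1)^n cancel and n + a >= 1 puts the product between 0 and e^t;
    finally -t e^t <= 1. *)
Lemma kernel_le0 (t : R) : t <= 0 -> -1 <= kernel a1 a2 n t <= 0.
Proof.
move=> t0; rewrite -(kernel_primitiveE n alZ).
have dK x := is_derive_kernel_primitive n alZ t x.
have cK : {within `[t, 0], continuous (kernel_primitive a1 a2 n t)}.
  apply: continuous_subspaceT => x.
  by apply/differentiable_continuous/derivable1_diffP; exact: ex_derive.
have [c] := MVT_segment t0 (fun x _ => dK x) cK.
rewrite in_itv /= => /andP[tc c0] e; rewrite -opprB {}e sub0r.
suff [h1 h2] : 0 <= kernel_factor n a2 c * kernel_factor n a1 (t - c) /\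
    kernel_factor n a2 c * kernel_factor n a1 (t - c) <= expR t.
  rewrite oppr_le0 lerN2 mulr_ge0 // ?oppr_ge0 // andbT.
  apply: (@le_trans _ _ (expR t * - t)).
    by rewrite ler_wpM2r // oppr_ge0.
  rewrite -(expRxMexpNx_1 t) ler_wpM2l ?expR_ge0 //.
  by apply: le_trans (expR_ge1Dx _); rewrite lerDr.
have fE (a x : R) : kernel_factor n a x = (-1) ^+ n * ((1 - expR x) ^+ n * expR ((n%:R + a) * x)).
  by rewrite /kernel_factor mulrA -exprMn; congr (_ ^+ n * _); ring.
have fB (a x : R) : -1 < a -> x <= 0 -> 0 <= (1 - expR x) ^+ n * expR ((n%:R + a) * x) <= expR x.
  move=> a_1 x0; have e1 : expR x <= 1 by rewrite -[X in _ <= X]expR0 ler_expR.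
  have := expR_gt0 x => e0.
  rewrite mulr_ge0 ?expR_ge0 ?exprn_ge0 ?subr_ge0 //=.
  apply: (@le_trans _ _ (1 * expR ((n%:R + a) * x))).
    by rewrite ler_wpM2r ?expR_ge0 // exprn_ile1 //; lra.
  rewrite mul1r ler_expR -[X in _ <= X]mul1r ler_wnM2r //; exact: na.
have tc0 : t - c <= 0 by rewrite subr_le0.
have /andP[p1 p2] := fB a2 c a21 c0; have /andP[q1 q2] := fB a1 (t - c) a11 tc0.
rewrite !fE mulrACA -exprMn mulrNN mulr1 expr1n mul1r; split; first exact: mulr_ge0.
have -> : expR t = expR c * expR (t - c) by rewrite -expRD subrKC.
exact: ler_pM.
Qed.

Lemma continuous_exprn_comp (f : R -> R) m : continuous f -> continuous (fun x => f x ^+ m).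
Proof.
move=> cf x; apply: (@continuous_comp _ _ _ f (fun y => y ^+ m)); first exact: cf.
exact: (@exprn_continuous R m (f x)).
Qed.

Lemma continuous_max0 (f : R -> R) : continuous f -> continuous (fun x => Num.max (f x) 0).
Proof.
move=> cf; rewrite (_ : (fun x => _) = (fun x => (f x + `|f x|) / 2)); last first.
  by apply/funext => x; rewrite maxr_absE addr0 subr0.
move=> x; apply: cvgM; last exact: cvg_cst.
by apply: cvgD; [exact: cf|exact: (cvg_norm (cf x))].
Qed.

Lemma continuous_expR_linear (s : R) : continuous (fun x : R => expR (s * x)).
Proof.
by move=> x; apply/differentiable_continuous/derivable1_diffP; exact: ex_derive.
Qed.

Lemma continuous_expR_sub1 : continuous (fun x : R => expR x - 1).
Proof.
by move=> x; apply/differentiable_continuous/derivable1_diffP; exact: ex_derive.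
Qed.

Lemma continuous_kernel_factor (a : R) : continuous (kernel_factor n a).
Proof.
move=> x; apply: cvgM; last exact: continuous_expR_linear.
exact: (@continuous_exprn_comp _ n continuous_expR_sub1 x).
Qed.

(** [kernel_factor] cut off at negative [h], which turns the integral over [[0, t]] into a
    convolution on the whole line. The cut-off sits inside the power and preserves continuity. *)
Definition kernel_pos (a h : R) : R := Num.max (expR h - 1) 0 ^+ n * expR ((n%:R + a) * h).

Lemma kernel_pos_ge0 (a h : R) : 0 <= kernel_pos a h.
Proof. by rewrite mulr_ge0 ?expR_ge0 // exprn_ge0 // le_max lexx orbT. Qed.

Lemma continuous_kernel_pos (a : R) : continuous (kernel_pos a).
Proof.
move=> x; apply: cvgM; last exact: continuous_expR_linear.
exact: (@continuous_exprn_comp _ n (continuous_max0 continuous_expR_sub1) x).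
Qed.

Let kpos (a h : R) : h <= 0 -> kernel_pos a h = 0.
Proof.
move=> h0; rewrite /kernel_pos max_r ?expr0n ?gtn_eqF ?mul0r //; first by case: (n) n2.
by rewrite subr_le0 -[X in _ <= X]expR0 ler_expR.
Qed.

Let kposE (a h : R) : 0 <= h -> kernel_pos a h = kernel_factor n a h.
Proof.
move=> h0; rewrite /kernel_pos max_l // subr_ge0.
by rewrite -[X in X <= _]expR0 ler_expR.
Qed.

Lemma integral_kernel_pos_ge0 (t : R) : 0 <= t ->
  (\int[mu]_h (kernel_pos a2 h * kernel_pos a1 (t - h))%:E = (kernel a1 a2 n t)%:E)%E.
Proof.
move=> t0.
have cF : continuous (fun h => kernel_factor n a2 h * kernel_factor n a1 (t - h)).
  move=> x; apply: cvgM; first exact: continuous_kernel_factor.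
  apply: (@continuous_comp _ _ _ (fun h => t - h)); last exact: continuous_kernel_factor.
  by apply/differentiable_continuous/derivable1_diffP; exact: ex_derive.
have := integral_derive t0 (is_derive_kernel_primitive n alZ t) cF.
rewrite (kernel_primitiveE n alZ) integral_mkcond => <-.
apply: eq_integral => h _; rewrite patchE; case: ifPn.
  rewrite inE /= in_itv /= => /andP[h0 ht].
  by rewrite !kposE // subr_ge0.
rewrite notin_setE /= in_itv /= => /negP; rewrite negb_and -!ltNge => /orP[h0|ht].
  by rewrite kpos ?mul0r // ltW.
by rewrite [X in _ * X]kpos ?mulr0 // subr_le0 ltW.
Qed.

Lemma kernel_ge0 (t : R) : 0 <= t -> 0 <= kernel a1 a2 n t.
Proof.
move=> t0; rewrite -lee_fin -integral_kernel_pos_ge0 //.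
by apply: integral_ge0 => x _; rewrite lee_fin mulr_ge0 // kernel_pos_ge0.
Qed.

Lemma integral_kernel_pos (t : R) :
  (\int[mu]_h (kernel_pos a2 h * kernel_pos a1 (t - h))%:E = (Num.max (kernel a1 a2 n t) 0)%:E)%E.
Proof.
have [t0|t0] := leP 0 t; first by rewrite max_l ?kernel_ge0 ?integral_kernel_pos_ge0.
have /andP[_ k0] := kernel_le0 (ltW t0); rewrite max_r //.
rewrite (_ : (fun h => _) = cst 0%E) ?integral0 //; apply/funext => h /=.
have [h0|h0] := leP h 0; first by rewrite kpos // mul0r.
by rewrite [X in _ * X]kpos ?mulr0 //; lra.
Qed.
End kernel_integral.

(** * The linear form as a positive double integral *)

Section kernel_identity.
Context {R : realType}.
Local Notation mu := (@lebesgue_measure R).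
Variables (a1 a2 b : R) (n : nat).
Let al := a1 - a2.
Hypotheses (alZ : forall m : int, al != m%:~R) (a11 : -1 < a1) (a21 : -1 < a2) (b0 : 0 < b).

Lemma sine_prodN (a : R) m : sine_prod (- a) m = sine_prod a m.
Proof. by apply: eq_bigr => i _; rewrite sqrrN. Qed.

Let half_sum (a a' : R) : -1 < a' -> \sum_(k < n.+1)
    gbinomR (n%:R + (a - a')) k * gbinomR (n%:R - (a - a')) (n - k)
      * (Gamma (n%:R + k%:R + a' + 1) * b `^ (- (n%:R + k%:R + a' + 1)))
  = b `^ (- (2 * n%:R + 1)) * (Gamma (a' + 1) * b `^ (- a') * qR n a a' b).
Proof.
move=> a'1; rewrite /qR mulrA mulr_sumr; apply: eq_bigr => k _.
have kn : (k <= n)%N by rewrite -ltnS.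
have -> : n%:R + k%:R + a' + 1 = (n + k)%:R + 1 + a' by rewrite natrD; ring.
rewrite -pochR_Gamma //.
have -> : b `^ (- ((n + k)%:R + 1 + a')) = b `^ (- (2 * n%:R + 1)) * b `^ (- a') * b ^+ (n - k).
  rewrite -powR_mulrn ?ltW // -!powRD ?(gt_eqF b0) ?implybT //.
  by rewrite natrB // natrD; congr (_ `^ _); ring.
have -> : n%:R + a - a' = n%:R + (a - a') by ring.
have -> : n%:R + a' - a = n%:R - (a - a') by ring.
ring.
Qed.

(** Each exponential of the kernel integrates against e^(t - b e^t) to a Gamma value, that is Gamma
    (a2 + 1) or Gamma (a1 + 1) times a Pochhammer symbol of [q]. The two halves get opposite signs
    because [al] is odd under exchange of [a1] and [a2] while [sine_prod] is even. *)
Lemma kernel_moment : sine_prod al n != 0 ->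
  has_integral (fun t => kernel a1 a2 n t * logGammaF 1 b t)
   (- b `^ (- (2 * n%:R + 1)) / (al * sine_prod al n)
     * (Gamma (a2 + 1) * b `^ (- a2) * qR n a1 a2 b - Gamma (a1 + 1) * b `^ (- a1) * qR n a2 a1 b)).
Proof.
move=> S0.
have ps (a : R) (k : nat) : -1 < a -> 0 < n%:R + k%:R + a + 1.
  by move=> a_1; have := ler0n R n; have := ler0n R k; lra.
have h1 := has_integral_sum n.+1 (fun k => has_integralZ (kernel_coef al n k) (has_integral_logGammaF (ps a2 k a21) b0)).
have h2 := has_integral_sum n.+1 (fun k => has_integralZ (kernel_coef (- al) n k) (has_integral_logGammaF (ps a1 k a11) b0)).
have h := has_integralD h1 h2.
rewrite (_ : (fun x => _ + _) = (fun t => kernel a1 a2 n t * logGammaF 1 b t)) in h; last first.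
  apply/funext => t; rewrite /kernel mulrDl !mulr_suml; congr (_ + _); apply: eq_bigr => k _.
    rewrite -/al -mulrA; congr (_ * _); rewrite /logGammaF -expRD; congr expR; ring.
  rewrite -/al -mulrA; congr (_ * _); rewrite /logGammaF -expRD; congr expR; ring.
have al0 : al != 0 by rewrite (alZ 0).
have NalZ (m : int) : - al != m%:~R by rewrite eqr_oppLR; have := alZ (- m); rewrite mulrNz.
have e1 := half_sum a1 a21; have e2 := half_sum a2 a11.
rewrite (_ : a2 - a1 = - al) in e2; last by rewrite opprB.
have s1 : \sum_(k < n.+1) kernel_coef al n k *
     (Gamma (n%:R + k%:R + a2 + 1) * b `^ (- (n%:R + k%:R + a2 + 1)))
  = - (al * sine_prod al n)^-1 * (b `^ (- (2 * n%:R + 1)) * (Gamma (a2 + 1) * b `^ (- a2) * qR n a1 a2 b)).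
  rewrite -e1 mulr_sumr; apply: eq_bigr => k _; rewrite kernel_coefE //; last by rewrite -ltnS.
  by rewrite -/al; ring.
have s2 : \sum_(k < n.+1) kernel_coef (- al) n k *
     (Gamma (n%:R + k%:R + a1 + 1) * b `^ (- (n%:R + k%:R + a1 + 1)))
  = (al * sine_prod al n)^-1 * (b `^ (- (2 * n%:R + 1)) * (Gamma (a1 + 1) * b `^ (- a1) * qR n a2 a1 b)).
  rewrite -e2 mulr_sumr; apply: eq_bigr => k _; rewrite kernel_coefE //; first last.
  - by rewrite sine_prodN.
  - by rewrite -ltnS.
  by rewrite sine_prodN (mulNr al) invrN mulrNN; ring.
rewrite s1 s2 in h.
have E (f : R -> R) u v : u = v -> has_integral f u -> has_integral f v by move=> ->.
apply: E h.
move: (Gamma (a2 + 1)) (Gamma (a1 + 1)) (al * sine_prod al n) (b `^ _) (b `^ _) (b `^ _) (qR _ _ _ _) (qR _ _ _ _) => *.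
by ring.
Qed.

(** [r] comes from negative [t], where the kernel is at least -1, so it is at most the integral 1 /
    b of [logGammaF 1 b]. Tonelli and the shift t = l + h give the iterated integral. The
    measurability of its outer integrand is recorded for the later use of [has_integral_near]. *)
Lemma kernel_identity : (2 <= n)%N -> sine_prod al n != 0 ->
  measurable_fun setT (fun h => (kernel_pos n a2 h)%:E
    * \int[mu]_l (kernel_pos n a1 l * logGammaF 1 b (l + h))%:E)%E /\
  exists2 r, 0 <= r <= b^-1 &
  (\int[mu]_h ((kernel_pos n a2 h)%:E * \int[mu]_l (kernel_pos n a1 l * logGammaF 1 b (l + h))%:E)
   = (- b `^ (- (2 * n%:R + 1)) / (al * sine_prod al n)
     * (Gamma (a2 + 1) * b `^ (- a2) * qR n a1 a2 b - Gamma (a1 + 1) * b `^ (- a1) * qR n a2 a1 b)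
     + r)%:E)%E.
Proof.
move=> n2 S0; have kM := kernel_moment S0.
have gB : (\int[mu]_x (logGammaF 1 b x)%:E <= b^-1%:E)%E.
  by rewrite integral_logGammaF_scale // Gamma1 mul1r powR_inv1 // ltW.
have wneg (x : R) : - logGammaF 1 b x <= kernel a1 a2 n x * logGammaF 1 b x.
  rewrite -mulN1r ler_wpM2r ?logGammaF_ge0 //.
  have [x0|x0] := leP x 0; first by have /andP[] := kernel_le0 alZ a11 a21 n2 x0.
  apply: (@le_trans _ _ 0); first by rewrite oppr_le0.
  exact: kernel_ge0 (ltW x0).
have [r rb rE] := has_integral_funepos kM (measurable_logGammaF 1 b) wneg (logGammaF_ge0 1 b) gB.
have mk (a : R) : measurable_fun setT (kernel_pos n a).
  by apply: continuous_measurable_fun; exact: continuous_kernel_pos.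
have mw : measurable_fun setT (logGammaF 1 b) by exact: measurable_logGammaF.
pose TR := measurableTypeR R.
pose f (x : TR * TR) : R := kernel_pos n a2 x.2 * kernel_pos n a1 (x.1 - x.2) * logGammaF 1 b x.1.
have f0 x : 0 <= f x by apply: mulr_ge0; [apply: mulr_ge0; exact: kernel_pos_ge0|exact: logGammaF_ge0].
have mf : measurable_fun setT f.
  have mc1 : measurable_fun setT (fun x : TR * TR => x.1 : R) by exact: measurable_fst.
  have mc2 : measurable_fun setT (fun x : TR * TR => x.2 : R) by exact: measurable_snd.
  apply: measurable_funM; last exact: measurableT_comp mw mc1.
  apply: measurable_funM; first exact: measurableT_comp (mk a2) mc2.
  exact: measurableT_comp (mk a1) (measurable_funB mc1 mc2).
have E1 : (\int[mu]_t \int[mu]_h (f (t, h))%:E = \int[mu]_x (Num.max (kernel a1 a2 n x * logGammaF 1 b x) 0)%:E)%E.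
  apply: eq_integral => t _; rewrite /f /=.
  transitivity (\int[mu]_h (logGammaF 1 b t * (kernel_pos n a2 h * kernel_pos n a1 (t - h)))%:E)%E.
    by apply: eq_integral => h _; rewrite mulrC.
  rewrite ge0_integralT_Zl ?logGammaF_ge0 //; first last.
  - by move=> x; rewrite mulr_ge0 ?kernel_pos_ge0.
  - apply: measurable_funM => //; apply: measurableT_comp => //.
    by apply: measurable_funB => //; exact: measurable_cst.
  rewrite integral_kernel_pos // -EFinM maxr_pMr ?logGammaF_ge0 // mulr0.
  by rewrite mulrC.
have mEf : measurable_fun setT (EFin \o f) by exact/measurable_EFinP.
have E2 := @fubini_tonelli _ _ TR TR R (@lebesgue_measure R) (@lebesgue_measure R) _ mEf f0.
have fE h : (\int[mu]_t (f (t, h))%:E = (kernel_pos n a2 h)%:E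
    * \int[mu]_l (kernel_pos n a1 l * logGammaF 1 b (l + h))%:E)%E.
  rewrite /f /=.
  transitivity (\int[mu]_t (kernel_pos n a2 h * (kernel_pos n a1 (t - h) * logGammaF 1 b t))%:E)%E.
    by apply: eq_integral => t _; rewrite mulrA.
  have cs (s : R) : continuous (fun x : R => x + s).
    by move=> x; apply/differentiable_continuous/derivable1_diffP; exact: ex_derive.
  have cf : continuous (fun t => kernel_pos n a1 (t - h) * logGammaF 1 b t).
    move=> t; apply: cvgM; last exact: continuous_logGammaF.
    apply: (@continuous_comp _ _ _ (fun t => t - h)); first exact: cs.
    exact: continuous_kernel_pos.
  have f1 t : 0 <= kernel_pos n a1 (t - h) * logGammaF 1 b t.
    by rewrite mulr_ge0 ?kernel_pos_ge0 ?logGammaF_ge0.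
  apply: etrans (ge0_integralT_Zl (continuous_measurable_fun cf) f1 (kernel_pos_ge0 n a2 h)) _.
  apply: (congr1 (mule _)); apply: etrans (integralT_shift h cf f1) _.
  by apply: eq_integral => l _; rewrite addrK.
split.
  have mG := @measurable_fun_fubini_tonelli_G _ _ TR TR R (@lebesgue_measure R) _ mEf f0.
  apply: eq_measurable_fun mG => h _; exact: fE.
exists r; first exact: rb.
apply: etrans rE; apply: etrans E1; apply: esym; apply: etrans E2 _.
by apply: eq_integral => h _; exact: fE.
Qed.
End kernel_identity.

(** * The inner integral *)

Section pointwise_bounds.
Context {R : realType}.
Implicit Types x t v a : R.

Lemma bernoulli_sub x n : 0 <= x <= 1 -> 1 - n%:R * x <= (1 - x) ^+ n.
Proof.
move=> /andP[x0 x1]; elim: n => [|n IH]; first by rewrite mul0r subr0.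
rewrite exprSr -natr1; apply: (@le_trans _ _ ((1 - n%:R * x) * (1 - x))); last first.
  by rewrite ler_wpM2r // subr_ge0.
by have : 0 <= n%:R * x ^+ 2 by [rewrite mulr_ge0 // sqr_ge0]; nra.
Qed.

(** Above, 1 - x <= e^(-x). Below, e^(-x) (1 - x^2) <= 1 - x is raised to the power [n] and combined
    with Bernoulli's inequality. *)
Lemma normr_onem_exprn x n : 0 <= x <= 1 ->
  `|(1 - x) ^+ n - expR (- (n%:R * x))| <= n%:R * x ^+ 2.
Proof.
move=> /andP[x0 x1].
have e1 : expR (- (n%:R * x)) = expR (- x) ^+ n by rewrite -expRM_natl mulrN.
have le : (1 - x) ^+ n <= expR (- (n%:R * x)).
  rewrite e1 lerXn2r ?nnegrE ?expR_ge0 ?subr_ge0 //.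
  by apply: le_trans (expR_ge1Dx _).
rewrite ler0_norm ?subr_le0 // opprB.
have ge : expR (- x) * (1 - x ^+ 2) <= 1 - x.
  have -> : 1 - x ^+ 2 = (1 - x) * (1 + x) by ring.
  rewrite mulrCA ler_piMr ?subr_ge0 //.
  by have := ler_wpM2l (expR_ge0 (- x)) (expR_ge1Dx x); rewrite -expRD addNr expR0.
have x2 : 0 <= x ^+ 2 <= 1 by rewrite sqr_ge0 expr_le1.
have ge2 : expR (- (n%:R * x)) * (1 - n%:R * x ^+ 2) <= (1 - x) ^+ n.
  apply: (@le_trans _ _ ((expR (- x) * (1 - x ^+ 2)) ^+ n)); last first.
    by rewrite lerXn2r ?nnegrE ?mulr_ge0 ?expR_ge0 ?subr_ge0 //; case/andP: x2.
  by rewrite exprMn -e1 ler_wpM2l ?expR_ge0 // bernoulli_sub.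
have e_1 : expR (- (n%:R * x)) <= 1 by rewrite -[X in _ <= X]expR0 ler_expR oppr_le0 mulr_ge0.
have : expR (- (n%:R * x)) * (n%:R * x ^+ 2) <= 1 * (n%:R * x ^+ 2).
  by rewrite ler_wpM2r // mulr_ge0 ?sqr_ge0.
rewrite mulrBr mulr1 in ge2; rewrite mul1r => h.
by rewrite lerBlDr -lerBlDl; apply: le_trans ge2; rewrite lerD2l lerN2.
Qed.

Lemma normr_powR1D v a : 0 <= v <= 1 -> `|(1 + v) `^ a - 1| <= `|a| * expR `|a| * v.
Proof.
move=> /andP[v0 v1].
rewrite powR_lnE; last by lra.
have l0 : 0 <= ln (1 + v) by rewrite ln_ge0 // lerDl.
have l1 : ln (1 + v) <= v by have := le_ln1Dx (x := v); apply; lra.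
apply: le_trans (normr_expR_sub1 _) _.
have t1 : `|a * ln (1 + v)| <= `|a| * v by rewrite normrM (ger0_norm l0) ler_wpM2l.
rewrite mulrAC; apply: ler_pM => //; rewrite ?expR_ge0 //.
rewrite ler_expR; apply: le_trans t1 _.
by rewrite ler_piMr.
Qed.

(** With z = e^x + 1 / 2 and v = e^(-x) / 2 one has z = e^x (1 + v) and z - 1 = e^x (1 - v). The
    shift by 1 / 2 makes the n-th powers combine to (1 - v^2)^n, so there is no correction of order
    n v. *)
Definition inner_factor a n v : R := Num.max (1 - v) 0 ^+ n * (1 + v) ^+ n * (1 + v) `^ a.

Lemma inner_factor_bound a n v : 0 <= v -> (0 < n)%N ->
  `|inner_factor a n v - expR (- (n%:R * v ^+ 2))| <= n%:R * v ^+ 4 + `|a| * expR `|a| * v.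
Proof.
move=> v0 n0; have Ca : 0 <= `|a| * expR `|a| * v by rewrite !mulr_ge0 ?expR_ge0.
(* For [v > 1] the truncated factor is 0 and the error term n v^4 alone exceeds 1. *)
rewrite /inner_factor; have [v1|v1] := leP v 1; last first.
  rewrite max_r ?subr_le0 ?(ltW v1) // expr0n gtn_eqF // !mul0r sub0r normrN ger0_norm ?expR_ge0 //.
  apply: (@le_trans _ _ 1); first by rewrite -[X in _ <= X]expR0 ler_expR oppr_le0 mulr_ge0 ?sqr_ge0.
  have h1 : 1 <= n%:R :> R by rewrite ler1n.
  have h2 : 1 <= v ^+ 4 by rewrite exprn_ege1 // ltW.
  by have : 1 * 1 <= n%:R * v ^+ 4 by [apply: ler_pM]; lra.
rewrite max_l ?subr_ge0 // -exprMn.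
have -> : (1 - v) * (1 + v) = 1 - v ^+ 2 by ring.
have v2 : 0 <= v ^+ 2 <= 1 by rewrite sqr_ge0 expr_le1.
have := normr_onem_exprn n v2; rewrite -exprM => h1.
have v01 : 0 <= v <= 1 by rewrite v0.
have := normr_powR1D a v01 => h2.
have p0 : 0 <= (1 - v ^+ 2) ^+ n by rewrite exprn_ge0 // subr_ge0; case/andP: v2.
have p1 : (1 - v ^+ 2) ^+ n <= 1.
  by rewrite exprn_ile1 //; move: v2 => /andP[]; lra.
have -> : (1 - v ^+ 2) ^+ n * (1 + v) `^ a - expR (- (n%:R * v ^+ 2))
  = ((1 - v ^+ 2) ^+ n - expR (- (n%:R * v ^+ 2))) + (1 - v ^+ 2) ^+ n * ((1 + v) `^ a - 1) by ring.
apply: le_trans (ler_normD _ _) _; apply: lerD h1 _.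
rewrite normrM (ger0_norm p0) -[X in _ <= X]mul1r.
exact: ler_pM.
Qed.

(** The function is 1 at 0 and has derivative -x^2 e^(x + x^2 / 2), so the mean value theorem gives
    a cubic error. *)
Lemma onem_expR_bound x : 0 <= x <= 1 ->
  1 - expR 2 * x ^+ 3 <= (1 - x) * expR (x + x ^+ 2 / 2) <= 1.
Proof.
move=> /andP[x0 x1].
pose f (t : R) := (1 - t) * expR (t + t ^+ 2 / 2).
have df (t : R) : is_derive t 1 f (- (t ^+ 2 * expR (t + t ^+ 2 / 2))).
  rewrite /f; apply: is_derive_eq; rewrite /GRing.scale /=; by field.
have cf : continuous f.
  by move=> t; apply/differentiable_continuous/derivable1_diffP; exact: ex_derive.
have [c] := MVT_segment x0 (fun t _ => df t) (continuous_subspaceT cf).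
rewrite in_itv /= => /andP[c0 cx].
rewrite subr0 => e.
have f0 : f 0 = 1 by rewrite /f expr0n /= mul0r addr0 expR0; ring.
have -> : (1 - x) * expR (x + x ^+ 2 / 2) = 1 - c ^+ 2 * expR (c + c ^+ 2 / 2) * x.
  by rewrite -/(f x) -[LHS](subrK (f 0)) e f0; ring.
have c1 : c <= 1 by exact: le_trans cx x1.
rewrite lerD2l lerNl opprK.
rewrite [X in _ && X](_ : _ = true) ?andbT; last first.
  by rewrite gerBl !mulr_ge0 ?expR_ge0 ?sqr_ge0.
rewrite (exprSr x 2) mulrA ler_wpM2r // mulrC; apply: ler_pM; rewrite ?expR_ge0 ?sqr_ge0 //.
  rewrite ler_expR; have : c ^+ 2 <= 1 by rewrite expr_le1.
  lra.
by rewrite lerXn2r ?nnegrE.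
Qed.

(** At x = 1 / y this is (1 - 1 / y)^n divided by its first approximation e^(-n / y). *)
Definition outer_factor n x : R := Num.max (1 - x) 0 ^+ n * expR (n%:R * x).

Lemma outer_factor_ge0 n x : 0 <= outer_factor n x.
Proof. by rewrite mulr_ge0 ?expR_ge0 // exprn_ge0 // le_max lexx orbT. Qed.

Lemma outer_factor_bound n x : (0 < n)%N -> 0 <= x ->
  `|outer_factor n x - expR (- (n%:R * x ^+ 2 / 2))| <= expR 2 * n%:R * x ^+ 3.
Proof.
move=> n0 x0; rewrite /outer_factor.
have n1 : 1 <= n%:R :> R by rewrite ler1n.
have E1 : 1 <= expR 2 :> R by rewrite -[X in X <= _]expR0 ler_expR.
have [x1|x1] := leP x 1; last first.
  rewrite max_r ?subr_le0 ?(ltW x1) // expr0n gtn_eqF // !mul0r sub0r normrN ger0_norm ?expR_ge0 //.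
  apply: (@le_trans _ _ 1).
    by rewrite -[X in _ <= X]expR0 ler_expR oppr_le0 divr_ge0 // mulr_ge0 ?sqr_ge0.
  rewrite -[X in X <= _]mulr1 -[X in X * 1 <= _]mulr1; apply: ler_pM => //; first exact: ler_pM.
  by rewrite exprn_ege1 // ltW.
rewrite max_l ?subr_ge0 //.
have x01 : 0 <= x <= 1 by rewrite x0.
have := onem_expR_bound x01; set u := _ * expR (x + _) => /andP[u1 u2].
have u0 : 0 <= u by rewrite mulr_ge0 ?expR_ge0 // subr_ge0.
have E0 : expR (- (n%:R * x ^+ 2 / 2)) <= 1.
  by rewrite -[X in _ <= X]expR0 ler_expR oppr_le0 divr_ge0 // mulr_ge0 ?sqr_ge0.
have -> : (1 - x) ^+ n * expR (n%:R * x) = u ^+ n * expR (- (n%:R * x ^+ 2 / 2)).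
  rewrite /u exprMn -expRM_natl -[RHS]mulrA -expRD; congr (_ * expR _); ring.
have un1 : u ^+ n <= 1 by rewrite exprn_ile1.
have h : 1 - n%:R * (1 - u) <= u ^+ n.
  have : 0 <= 1 - u <= 1 by apply/andP; split; lra.
  by move/(bernoulli_sub n); rewrite opprB subrKC.
have -> : forall e : R, u ^+ n * e - e = - ((1 - u ^+ n) * e) by move=> e; ring.
rewrite normrN ger0_norm ?mulr_ge0 ?expR_ge0 ?subr_ge0 //.
apply: (@le_trans _ _ ((1 - u ^+ n) * 1)); first by rewrite ler_wpM2l // subr_ge0.
have : n%:R * (1 - u) <= n%:R * (expR 2 * x ^+ 3) by rewrite ler_wpM2l //; lra.
by rewrite mulr1 mulrA [n%:R * expR 2]mulrC; lra.
Qed.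

Lemma outer_factor_le1 n x : 0 <= x -> outer_factor n x <= 1.
Proof.
move=> x0; rewrite /outer_factor expRM_natl -exprMn exprn_ile1 //.
  by rewrite mulr_ge0 ?expR_ge0 // le_max lexx orbT.
have [x1|x1] := leP x 1; last by rewrite max_r ?mul0r // subr_le0 ltW.
rewrite max_l ?subr_ge0 //.
by have := ler_wpM2r (expR_ge0 x) (expR_ge1Dx (- x)); rewrite -expRD addNr expR0.
Qed.
End pointwise_bounds.

Section inner_integral.
Context {R : realType}.
Local Notation mu := (@lebesgue_measure R).

Lemma has_integral_le (f g : R -> R) u v : has_integral f u -> has_integral g v ->
  (forall x, f x <= g x) -> u <= v.
Proof.
move=> [If iu] [Ig iv] fg; rewrite -lee_fin -iu -iv.
by apply: (le_integral measurableT If Ig) => x _; rewrite lee_fin.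
Qed.

(** Serves in both integrations to replace a perturbed integrand by a simpler one when the integral
    of the error bound is also available. *)
Lemma has_integral_near (f g e : R -> R) u d : measurable_fun setT f ->
  has_integral g u -> has_integral e d -> (forall x, `|f x - g x| <= e x) ->
  exists2 v, has_integral f v & `|v - u| <= d.
Proof.
move=> mf Ig Ie fge.
have If : mu.-integrable setT (EFin \o f).
  apply: (@le_integrable _ _ R mu setT measurableT _ (fun x => `|(g x)%:E| + (e x)%:E)%E).
  - exact/measurable_EFinP.
  - move=> x _; rewrite /= lee_fin [X in _ <= X]ger0_norm; last first.
      by rewrite addr_ge0 //; exact: le_trans (fge x).
    by rewrite -[f x](subrKC (g x)); apply: le_trans (ler_normD _ _) _; rewrite lerD2l.
  - apply: integrableD => //; last exact: Ie.1.
    exact: (integrable_abse Ig.1).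
have fin := integrable_fin_num measurableT If.
exists (fine (\int[mu]_x (f x)%:E)%E).
  by split => //; rewrite fineK.
set v := fine _.
have Hf : has_integral f v by split => //; rewrite fineK.
have D := has_integralD Hf (has_integralZ (-1) Ig).
rewrite ler_norml; apply/andP; split.
  have := has_integral_le (has_integralZ (-1) Ie) D; rewrite !mulN1r; apply => x.
  by rewrite !mulN1r; have := fge x; rewrite ler_norml => /andP[].
have := has_integral_le D Ie; rewrite !mulN1r; apply => x.
by rewrite mulN1r; apply: le_trans (fge x); exact: ler_norm.
Qed.

Lemma Gamma_moment (N r : R) k : 0 < r -> k%:R < N + 1 ->
  Gamma (N + 1 - k%:R) * r `^ (- (N + 1 - k%:R))
  = Gamma (N + 1) * r `^ (- (N + 1)) * (r ^+ k / \prod_(i < k) (N - i%:R)).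
Proof.
move=> r0; elim: k => [|k IH] kN; first by rewrite big_ord0 expr0 divr1 mulr1 subr0.
have kN' : k%:R < N + 1 by apply: lt_trans kN; rewrite ltr_nat.
have Nk : 0 < N - k%:R by move: kN; rewrite -natr1; lra.
have := IH kN'.
have -> : N + 1 - k%:R = (N - k%:R) + 1 by ring.
rewrite Gamma_rec // big_ord_recr /= exprSr invfM.
have -> : N + 1 - k.+1%:R = N - k%:R by rewrite -natr1; ring.
have -> : r `^ (- (N - k%:R + 1)) = r `^ (- (N - k%:R)) / r.
  by rewrite opprD powRD ?powR_inv1 ?ltW // (gt_eqF r0) implybT.
move=> h.
have -> : Gamma (N - k%:R) * r `^ (- (N - k%:R))
  = ((N - k%:R) * Gamma (N - k%:R) * (r `^ (- (N - k%:R)) / r)) * r / (N - k%:R).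
  by field; rewrite !gt_eqF.
by rewrite h; ring.
Qed.

Lemma has_integral_moment (N r : R) k : 0 < r -> k%:R < N + 1 ->
  has_integral (fun x => logGammaF (N + 1) r x * (expR (- x) / 2) ^+ k)
    (Gamma (N + 1) * r `^ (- (N + 1)) * ((r / 2) ^+ k / \prod_(i < k) (N - i%:R))).
Proof.
move=> r0 kN; have s0 : 0 < N + 1 - k%:R by rewrite subr_gt0.
have := has_integralZ (2 ^- k) (has_integral_logGammaF s0 r0).
rewrite Gamma_moment //.
rewrite (_ : (fun x => _ * logGammaF _ _ _) = (fun x => logGammaF (N + 1) r x * (expR (- x) / 2) ^+ k)).
  rewrite (_ : 2 ^- k * _ = Gamma (N + 1) * r `^ (- (N + 1)) * ((r / 2) ^+ k / \prod_(i < k) (N - i%:R))) //.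
  by rewrite expr_div_n; ring.
apply/funext => x; rewrite expr_div_n mulrA mulrC; congr (_ / _).
rewrite /logGammaF -expRM_natl -expRD; congr expR; ring.
Qed.

Lemma continuous_inner_factor a n :
  continuous (fun x : R => inner_factor a n (expR (- x) / 2)).
Proof.
have cv : continuous (fun x : R => expR (- x) / 2).
  by move=> x; apply/differentiable_continuous/derivable1_diffP; exact: ex_derive.
have c1 : continuous (fun x : R => 1 - expR (- x) / 2).
  by move=> x; apply/differentiable_continuous/derivable1_diffP; exact: ex_derive.
have c2 : continuous (fun x : R => 1 + expR (- x) / 2).
  by move=> x; apply/differentiable_continuous/derivable1_diffP; exact: ex_derive.
move=> x; apply: cvgM.
  apply: cvgM; last exact: (@continuous_exprn_comp _ _ n c2 x).
  exact: (@continuous_exprn_comp _ _ n (continuous_max0 c1) x).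
apply: (@continuous_comp _ _ _ (fun x : R => 1 + expR (- x) / 2) (fun y => y `^ a)); first exact: c2.
by apply: continuous_powRl; rewrite ltr_wpDr // divr_ge0 ?expR_ge0.
Qed.
End inner_integral.

Section inner_moment.
Context {R : realType}.
Local Notation mu := (@lebesgue_measure R).

(** [m1], [m2], [m4] are moments of v = e^(-x) / 2 under the normalised Gamma weight, and [q] is the
    square of its typical value r / (4 n). The mean of (v^2 - q)^2 is [m4 - 2 q m2 + q^2], at most
    of order r^4 / n^5, and [th] balances the two AM-GM terms that bound the mean of n |v^2 - q|. *)
Lemma inner_moment_algebra (a n N r s c q th m1 m2 m4 : R) : 0 <= c -> 0 < s -> s ^+ 2 = n -> 0 < r ->
  `|a| + 4 <= n -> N = 2 * n + a ->
  q = (r / (4 * n)) ^+ 2 -> th = n ^+ 2 * s / r ^+ 2 ->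
  m1 = r / 2 / N -> m2 = (r / 2) ^+ 2 / (N * (N - 1)) ->
  m4 = (r / 2) ^+ 4 / (N * (N - 1) * (N - 2) * (N - 3)) ->
  n * m4 + c * m1 + n * th / 2 * (m4 - 2 * q * m2 + q ^+ 2) + n / (2 * th)
  <= (c + (5 * `|a| + 3) ^+ 2 + 14) * (r / n + r ^+ 4 / n ^+ 3 + r ^+ 2 * s / n ^+ 2).
Proof.
move=> c0 s0 s2 r0 an NE q_ th_ m1_ m2_ m4_.
have a0 := normr_ge0 a.
have n4 : 4 <= n by lra.
have n0 : 0 < n by lra.
have [aN Na] : a <= `|a| /\ - a <= `|a| by rewrite ler_norm -normrN ler_norm.
have hN3 : n <= N - 3 by rewrite NE; lra.
have hN : N <= 3 * n by rewrite NE; lra.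
pose p := N * (N - 1); pose p' := (N - 2) * (N - 3).
have p1 : n ^+ 2 <= p by rewrite /p expr2; apply: ler_pM; lra.
have p'1 : n ^+ 2 <= p' by rewrite /p' expr2; apply: ler_pM; lra.
have n20 : 0 < n ^+ 2 by rewrite exprn_gt0.
have p0 : 0 < p by lra.
have p'0 : 0 < p' by lra.
have m4E : m4 = r ^+ 4 / 16 / (p * p') by rewrite m4_ /p /p'; field; rewrite ?gt_eqF //; lra.
have m2E : m2 = r ^+ 2 / 4 / p by rewrite m2_ /p; field; rewrite ?gt_eqF //; lra.
have ip : p^-1 <= (n ^+ 2)^-1 by rewrite lef_pV2.
have ip' : p'^-1 <= (n ^+ 2)^-1 by rewrite lef_pV2.
have ip0 : 0 <= p^-1 by rewrite invr_ge0 ltW.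
have ip'0 : 0 <= p'^-1 by rewrite invr_ge0 ltW.
have n2i : 0 <= (n ^+ 2)^-1 by rewrite invr_ge0 ltW.
have X3 : 0 <= r ^+ 2 * s / n ^+ 2 := divr_ge0 (mulr_ge0 (sqr_ge0 r) (ltW s0)) (sqr_ge0 n).
have A0 : 0 <= (5 * `|a| + 3) ^+ 2 := sqr_ge0 _.
have A12 : 0 <= (5 * `|a| + 3) ^+ 2 + 12 by rewrite addr_ge0.
have th0 : 0 <= th by rewrite th_; exact: divr_ge0 (mulr_ge0 (sqr_ge0 n) (ltW s0)) (sqr_ge0 r).
have r40 : 0 <= r ^+ 4 by rewrite exprn_ge0 // ltW.
have m4B : n * m4 <= r ^+ 4 / n ^+ 3.
  have -> : n * m4 = n * (r ^+ 4 / 16) * (p^-1 * p'^-1) by rewrite m4E invfM; ring.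
  have -> : r ^+ 4 / n ^+ 3 = n * r ^+ 4 * ((n ^+ 2)^-1 * (n ^+ 2)^-1) by field; rewrite gt_eqF.
  have r4 : 0 <= r ^+ 4 / 16 by rewrite divr_ge0.
  apply: ler_pM; [exact: mulr_ge0 (ltW n0) r4|exact: mulr_ge0 ip0 ip'0| |exact: ler_pM].
  by rewrite ler_wpM2l ?(ltW n0) // ler_pdivrMr //; move: r40; clear; lra.
have m1B : c * m1 <= c * (r / n).
  rewrite ler_wpM2l // m1_ -mulrA ler_wpM2l ?(ltW r0) // -invfM lef_pV2 ?posrE; lra.
pose D := (p^-1 - (4 * n ^+ 2)^-1).
(* Squared bias plus variance of v^2, with r^4 / 16 factored out. *)
have qE : m4 - 2 * q * m2 + q ^+ 2 = r ^+ 4 / 16 * (D ^+ 2 + p^-1 * (p'^-1 - p^-1)).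
  by rewrite m4E m2E q_ /D; field; rewrite ?gt_eqF //; lra.
have DB : D ^+ 2 <= (5 * `|a| + 3) ^+ 2 / n ^+ 5.
  have DE : D = (4 * n ^+ 2 - p) / (4 * n ^+ 2) * p^-1 by rewrite /D; field; rewrite ?gt_eqF.
  have np : `|4 * n ^+ 2 - p| <= n * (5 * `|a| + 3).
    have -> : 4 * n ^+ 2 - p = - (2 * n * (2 * a - 1) + a * (a - 1)) by rewrite /p NE; ring.
    rewrite normrN; apply: le_trans (ler_normD _ _) _.
    rewrite (normrM (2 * n)) (normrM a) (ger0_norm (_ : 0 <= 2 * n)); last by lra.
    have h1 : `|2 * a - 1| <= 2 * `|a| + 1.
      by apply: le_trans (ler_normB _ _) _; rewrite normr1 normrM ger0_norm.
    have h2 : `|a - 1| <= `|a| + 1 by apply: le_trans (ler_normB _ _) _; rewrite normr1.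
    have h3 : `|a| * `|a - 1| <= n * (`|a| + 1) by apply: ler_pM => //; lra.
    have h4 : 2 * n * `|2 * a - 1| <= 2 * n * (2 * `|a| + 1) by rewrite ler_wpM2l //; lra.
    by lra.
  have DN : `|D| <= (5 * `|a| + 3) * n^-1 ^+ 3.
    rewrite DE normrM (normrM (4 * _ - _)) (ger0_norm ip0) normrV ?unitfE ?gt_eqF ?mulr_gt0 //.
    have n24 : 0 <= 4 * n ^+ 2 by exact: mulr_ge0 (ler0n R 4) (ltW n20).
    rewrite (ger0_norm n24).
    apply: (@le_trans _ _ (n * (5 * `|a| + 3) / (n ^+ 2) * (n ^+ 2)^-1)); last first.
      rewrite [leRHS](_ : _ = n * (5 * `|a| + 3) / n ^+ 2 / n ^+ 2) //.
      by field; rewrite gt_eqF.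
    have i4 : 0 <= (4 * n ^+ 2)^-1 by rewrite invr_ge0.
    apply: ler_pM => //; first exact: mulr_ge0 (normr_ge0 _) i4.
    apply: ler_pM => //.
    by rewrite lef_pV2 ?posrE ?mulr_gt0 //; move: n20; clear; lra.
  rewrite -[D ^+ 2]ger0_norm ?sqr_ge0 // normrX.
  apply: (@le_trans _ _ (((5 * `|a| + 3) * n^-1 ^+ 3) ^+ 2)).
    by rewrite lerXn2r ?nnegrE // mulr_ge0 ?exprn_ge0 ?invr_ge0 //; lra.
  rewrite exprMn ler_wpM2l ?sqr_ge0 // -exprM -exprVn (exprS _ 5) ler_piMl ?exprn_ge0 ?invr_ge0 ?invf_le1 //; lra.
have p'B : p^-1 * (p'^-1 - p^-1) <= 12 / n ^+ 5.
  have -> : p^-1 * (p'^-1 - p^-1) = (4 * N - 6) * (p^-1 * (p^-1 * p'^-1)).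
    have pp : p - p' = 4 * N - 6 by rewrite /p /p'; ring.
    by rewrite -pp; field; rewrite ?gt_eqF.
  apply: (@le_trans _ _ (12 * n * ((n ^+ 2)^-1 * ((n ^+ 2)^-1 * (n ^+ 2)^-1)))); last first.
    by rewrite [leLHS](_ : _ = 12 / n ^+ 5) //; field; rewrite gt_eqF.
  apply: ler_pM; [by lra|by rewrite mulr_ge0 // mulr_ge0|by lra|].
  apply: ler_pM => //; first by rewrite mulr_ge0.
  exact: ler_pM.
have qB : m4 - 2 * q * m2 + q ^+ 2 <= r ^+ 4 / 16 * (((5 * `|a| + 3) ^+ 2 + 12) / n ^+ 5).
  by rewrite qE ler_wpM2l ?divr_ge0 // mulrDl lerD.
have thB : n * th / 2 * (m4 - 2 * q * m2 + q ^+ 2) <= ((5 * `|a| + 3) ^+ 2 + 12) * (r ^+ 2 * s / n ^+ 2).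
  apply: (@le_trans _ _ (n * th / 2 * (r ^+ 4 / 16 * (((5 * `|a| + 3) ^+ 2 + 12) / n ^+ 5)))).
    by rewrite ler_wpM2l //; exact: divr_ge0 (mulr_ge0 (ltW n0) th0) (ler0n R 2).
  rewrite th_ [leLHS](_ : _ = ((5 * `|a| + 3) ^+ 2 + 12) * (r ^+ 2 * s / n ^+ 2) / 32); last first.
    by field; rewrite ?gt_eqF.
  have : 0 <= ((5 * `|a| + 3) ^+ 2 + 12) * (r ^+ 2 * s / n ^+ 2).
    exact: mulr_ge0.
  by clear; lra.
have lB : n / (2 * th) <= r ^+ 2 * s / n ^+ 2.
  have -> : n / (2 * th) = r ^+ 2 * s / n ^+ 2 / 2.
    by rewrite th_ -s2; field; rewrite ?gt_eqF.
  by move: X3; clear; lra.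
have X1 : 0 <= r / n by rewrite divr_ge0 // ltW.
have X2 : 0 <= r ^+ 4 / n ^+ 3 by rewrite divr_ge0 // exprn_ge0 // ltW.
move: (r / n) (r ^+ 4 / n ^+ 3) (r ^+ 2 * s / n ^+ 2) X1 X2 X3 m4B m1B thB lB => x1 x2 x3 X1 X2 X3 m4B m1B thB lB.
move: ((5 * `|a| + 3) ^+ 2) A0 thB => A A0 thB.
have : 0 <= (A + 14) * x1 + (c + A + 13) * x2 + (c + 1) * x3.
  have a1 : 0 <= A + 14 by lra.
  have a2 : 0 <= c + A + 13 by lra.
  have a3 : 0 <= c + 1 by lra.
  exact: addr_ge0 (addr_ge0 (mulr_ge0 a1 X1) (mulr_ge0 a2 X2)) (mulr_ge0 a3 X3).
by lra.
Qed.
End inner_moment.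

Section inner_evaluation.
Context {R : realType}.
Local Notation mu := (@lebesgue_measure R).

Lemma normr_expRN_sub (s t : R) : 0 <= s -> 0 <= t -> `|expR (- s) - expR (- t)| <= `|s - t|.
Proof.
wlog st : s t / s <= t.
  move=> H s0 t0; have [st|/ltW ts] := leP s t; first exact: H.
  by rewrite distrC [leRHS]distrC; exact: H.
move=> s0 t0; rewrite ger0_norm; last by rewrite subr_ge0 ler_expR lerN2.
rewrite distrC ger0_norm ?subr_ge0 //.
have -> : expR (- t) = expR (- s) * expR (s - t) by rewrite -expRD; congr expR; ring.
have e1 : expR (- s) <= 1 by rewrite -[X in _ <= X]expR0 ler_expR oppr_le0.
have h := expR_ge1Dx (s - t).
have h2 : expR (s - t) <= 1 by rewrite -[X in _ <= X]expR0 ler_expR subr_le0.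
rewrite -[X in X - _]mulr1 -mulrBr.
apply: (@le_trans _ _ (1 * (1 - expR (s - t)))); first by rewrite ler_wpM2r // subr_ge0.
lra.
Qed.

(** Under the Gamma weight [inner_factor] is replaced by e^(-n v^2), and then v^2 by the constant
    [q], which gives e^(-r^2 / (16 n)). The error is a combination of moments of orders 0, 1, 2 and
    4, available since |a| + 4 <= n. *)
Lemma inner_moment (a : R) : exists2 C : R, 0 <= C & forall n : nat, `|a| + 4 <= n%:R ->
  forall r : R, 0 < r -> exists2 v,
  has_integral (fun x => logGammaF (2 * n%:R + a + 1) r x * inner_factor a n (expR (- x) / 2)) v &
  `|v - Gamma (2 * n%:R + a + 1) * r `^ (- (2 * n%:R + a + 1)) * expR (- (r ^+ 2 / (16 * n%:R)))|
  <= Gamma (2 * n%:R + a + 1) * r `^ (- (2 * n%:R + a + 1))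
     * (C * (r / n%:R + r ^+ 4 / n%:R ^+ 3 + r ^+ 2 * Num.sqrt n%:R / n%:R ^+ 2)).
Proof.
pose c : R := `|a| * expR `|a|.
have c0 : 0 <= c by rewrite mulr_ge0 ?expR_ge0.
exists (c + (5 * `|a| + 3) ^+ 2 + 14); first by rewrite !addr_ge0 ?sqr_ge0.
move=> n an r r0.
have a0 := normr_ge0 a.
have np : 0 < n%:R :> R by lra.
have n0 : (0 < n)%N by rewrite -(ltr0n R).
have s0 : 0 < Num.sqrt n%:R :> R by rewrite sqrtr_gt0.
have s2 : Num.sqrt n%:R ^+ 2 = n%:R :> R by rewrite sqr_sqrtr // ltW.
have aN : - a <= `|a| by rewrite -normrN ler_norm.
pose N : R := 2 * n%:R + a.
have G0 : 0 < Gamma (N + 1) by apply: Gamma_gt0; rewrite /N; lra.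
rewrite -/N; set s := Num.sqrt n%:R in s0 s2 *.
pose q : R := (r / (4 * n%:R)) ^+ 2; pose th : R := n%:R ^+ 2 * s / r ^+ 2.
have th0 : 0 < th by rewrite divr_gt0 ?exprn_gt0 // mulr_gt0 // exprn_gt0.
have alg := inner_moment_algebra c0 s0 s2 r0 an (erefl N) (erefl q) (erefl th)
  (erefl _) (erefl _) (erefl _).
have kN (k : nat) : (k < 5)%N -> k%:R < N + 1.
  by rewrite -(ltr_nat R) /N; lra.
have H0 := has_integral_moment r0 (kN 0%N isT).
have H1 := has_integral_moment r0 (kN 1%N isT).
have H2 := has_integral_moment r0 (kN 2%N isT).
have H4 := has_integral_moment r0 (kN 4%N isT).
have He := has_integralD (has_integralD (has_integralZ (n%:R + n%:R * th / 2) H4) (has_integralZ c H1))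
  (has_integralD (has_integralZ (- (n%:R * th * q)) H2)
    (has_integralZ (n%:R * th / 2 * q ^+ 2 + n%:R / (2 * th)) H0)).
have Hg := has_integralZ (expR (- (n%:R * q))) H0.
have [] := has_integral_near _ Hg He (f := fun x => logGammaF (N + 1) r x * inner_factor a n (expR (- x) / 2)).
- apply: measurable_funM; first exact: measurable_logGammaF.
  by apply: continuous_measurable_fun; exact: continuous_inner_factor.
- move=> x; have w0 := logGammaF_ge0 (N + 1) r x; set w := logGammaF _ _ _ in w0 *.
  have v0 : 0 <= expR (- x) / 2 by rewrite divr_ge0 ?expR_ge0.
  set v := expR (- x) / 2 in v0 *.
  have q0 : 0 <= q by exact: sqr_ge0.
  have -> : w * inner_factor a n v - expR (- (n%:R * q)) * (w * v ^+ 0)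
    = w * ((inner_factor a n v - expR (- (n%:R * v ^+ 2)))
      + (expR (- (n%:R * v ^+ 2)) - expR (- (n%:R * q)))) by rewrite expr0; ring.
  have -> : (n%:R + n%:R * th / 2) * (w * v ^+ 4) + c * (w * v ^+ 1) +
      (- (n%:R * th * q) * (w * v ^+ 2) + (n%:R * th / 2 * q ^+ 2 + n%:R / (2 * th)) * (w * v ^+ 0))
    = w * ((n%:R * v ^+ 4 + c * v) + n%:R * (th * (v ^+ 2 - q) ^+ 2 + th^-1) / 2).
    by field; rewrite gt_eqF.
  rewrite normrM (ger0_norm w0) ler_wpM2l //; apply: le_trans (ler_normD _ _) _.
  apply: lerD; first exact: inner_factor_bound.
  have nv0 : 0 <= n%:R * v ^+ 2 by exact: mulr_ge0 (ltW np) (sqr_ge0 v).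
  have nq0 : 0 <= n%:R * q by exact: mulr_ge0 (ltW np) q0.
  apply: le_trans (normr_expRN_sub nv0 nq0) _.
  rewrite -mulrBr normrM (ger0_norm (ltW np)) -mulrA ler_wpM2l ?(ltW np) //.
  (* AM-GM: n |X| <= n (th X^2 + 1 / th) / 2 *)
  set X := v ^+ 2 - q.
  have -> : th * X ^+ 2 = (th * `|X|) ^+ 2 / th by rewrite exprMn real_normK ?num_real //; field; rewrite gt_eqF.
  rewrite -(ler_pM2l (mulr_gt0 (ltr0n R 2) th0)).
  rewrite [leRHS](_ : _ = (th * `|X|) ^+ 2 + 1); last by field; rewrite gt_eqF.
  by have := sqr_ge0 (th * `|X| - 1); rewrite sqrrB1; lra.
move=> v Hv hv; exists v => //.
move: hv; rewrite !big_ord_recr !big_ord0 /= !mulr0n !mul1r ?subr0 ?expr0 ?expr1 ?divr1 ?mulr1.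
rewrite (_ : n%:R * q = r ^+ 2 / (16 * n%:R)); last by rewrite /q; field; rewrite gt_eqF.
set W := Gamma _ * _; rewrite [_ * W]mulrC => hv.
have W0 : 0 <= W by rewrite mulr_ge0 ?powR_ge0 // ltW.
apply: le_trans hv _; apply: le_trans (ler_wpM2l W0 alg).
rewrite le_eqVlt; apply/orP; left; apply/eqP.
by field; rewrite ?gt_eqF //; rewrite /N; lra.
Qed.
End inner_evaluation.

Section inner_substitution.
Context {R : realType}.
Local Notation mu := (@lebesgue_measure R).

Lemma kernel_pos_eq0 n (a h : R) : (0 < n)%N -> h <= 0 -> kernel_pos n a h = 0.
Proof.
move=> n0 h0; rewrite /kernel_pos max_r ?expr0n ?gtn_eqF ?mul0r //.
by rewrite subr_le0 -[X in _ <= X]expR0 ler_expR.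
Qed.

(** Substitution e^l = e^x + 1 / 2. It reaches every l > -ln 2, and [kernel_pos] vanishes on the
    rest. The shift by 1 / 2 produces the factor e^(-b e^h / 2) and leaves a Gamma weight of rate b
    e^h. *)
Lemma integral_kernel_pos_logGammaF n (a b h v : R) : (0 < n)%N ->
  has_integral (fun x => logGammaF (2 * n%:R + a + 1) (b * expR h) x
    * inner_factor a n (expR (- x) / 2)) v ->
  (\int[mu]_l (kernel_pos n a l * logGammaF 1 b (l + h))%:E
    = (expR (h - b * expR h / 2) * v)%:E)%E.
Proof.
move=> n0 Hv; pose c := expR (h - b * expR h / 2).
pose F (x : R) : R := ln (expR x + 1 / 2); pose F' (x : R) : R := expR x / (expR x + 1 / 2).
pose G l := kernel_pos n a l * logGammaF 1 b (l + h).
have p0 (x : R) : 0 < expR x + 1 / 2 by rewrite addr_gt0 ?expR_gt0.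
have dF (x : R) : is_derive x 1 F (F' x).
  have dl := is_derive1_ln (p0 x).
  have de : is_derive x 1 (fun x : R => expR x + 1 / 2) (expR x).
    by apply: is_derive_eq; rewrite /GRing.scale /=; ring.
  have := @is_derive1_comp _ (@ln R) (fun x : R => expR x + 1 / 2) x _ _ dl de.
  by rewrite (_ : _^-1 * _ = F' x) // mulrC.
have cF' : continuous F'.
  move=> x; apply: cvgM; first exact: continuous_expR.
  apply: cvgV; first by rewrite gt_eqF.
  by apply: cvgD; [exact: continuous_expR|exact: cvg_cst].
have F'0 x : 0 < F' x by rewrite divr_gt0 ?expR_gt0.
have cG : continuous G.
  move=> x; apply: cvgM; first exact: continuous_kernel_pos.
  apply: (@continuous_comp _ _ _ (fun t => t + h)); last exact: continuous_logGammaF.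
  by apply/differentiable_continuous/derivable1_diffP; exact: ex_derive.
have G0 l : 0 <= G l by rewrite mulr_ge0 ?kernel_pos_ge0 ?logGammaF_ge0.
have S := @integral_substitution R F F' G dF cF' F'0 (fun x => cG (F x)) (fun x => G0 (F x)).
have e1 : (\int[mu]_l (G l)%:E = \int[mu]_(y in range F) (G y)%:E)%E.
  rewrite [RHS]integral_mkcond; apply: eq_integral => l _; rewrite patchE; case: ifPn => //.
  rewrite notin_setE /= => nF; congr EFin; rewrite /G kernel_pos_eq0 ?mul0r //.
  rewrite leNgt; apply/negP => l0; apply: nF.
  have e0 : 0 < expR l - 1 / 2.
    have : 1 < expR l by rewrite -[X in X < _]expR0 ltr_expR.
    lra.
  exists (ln (expR l - 1 / 2)) => //; rewrite /F lnK ?posrE //.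
  by rewrite subrK expRK.
have e2 x : G (F x) * F' x = c * (logGammaF (2 * n%:R + a + 1) (b * expR h) x
    * inner_factor a n (expR (- x) / 2)).
  have z0 := p0 x; have zE : expR x + 1 / 2 = expR x * (1 + expR (- x) / 2).
    by rewrite mulrDr mulr1 mulrA -expRD subrr expR0.
  have v0 : 0 < 1 + expR (- x) / 2 by rewrite ltr_wpDr ?divr_ge0 ?expR_ge0.
  have m0 : Num.max (expR x + 1 / 2 - 1) 0 = expR x * Num.max (1 - expR (- x) / 2) 0.
    rewrite maxr_pMr ?expR_ge0 // mulr0; congr (Num.max _ _).
    by rewrite mulrBr mulr1 mulrA -expRD subrr expR0; field.
  have lE : ln (expR x + 1 / 2) = x + ln (1 + expR (- x) / 2).
    by rewrite zE lnM ?posrE ?expR_gt0 // expRK.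
  have k1 : kernel_pos n a (F x) = expR (n%:R * x) * expR ((n%:R + a) * x)
      * inner_factor a n (expR (- x) / 2).
    rewrite /kernel_pos /F lnK ?posrE // m0 lE /inner_factor (powR_lnE _ v0) exprMn -expRM_natl.
    rewrite mulrDr (mulrDl n%:R a (ln _)) 2!expRD (expRM_natl n (ln _)) lnK ?posrE //; ring.
  have k2 : logGammaF 1 b (F x + h) * F' x = expR (h - b * (expR x + 1 / 2) * expR h + x).
    rewrite /logGammaF /F' [expR (F x + h)]expRD {2}/F lnK ?posrE // mul1r.
    rewrite (_ : F x + h - _ = F x + (h - b * (expR x + 1 / 2) * expR h)); last by ring.
    have FE : expR (F x) = expR x + 1 / 2 by rewrite /F lnK ?posrE.
    rewrite (expRD (F x)) FE (expRD _ x); set u := expR (h - b * (expR x + 1 / 2) * expR h).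
    by field; rewrite gt_eqF //; have := expR_gt0 x; lra.
  rewrite /G -mulrA k2 k1 [RHS]mulrA [LHS]mulrAC; congr (_ * _).
  rewrite /c /logGammaF -!expRD; congr expR; by field.
have Hc := has_integralZ c Hv.
apply: etrans e1 _; apply: etrans S _; rewrite -Hc.2.
by apply: eq_integral => x _; rewrite e2.
Qed.
End inner_substitution.

(** * The outer integral *)

Section gaussian.
Context {R : realType}.
Local Notation mu := (@lebesgue_measure R).
Implicit Types x t K : R.

Lemma sh2_sqr x : sh2 x ^+ 2 = expR x + expR (- x) - 2.
Proof.
rewrite /sh2 sqrrB -!expRM_natl -expRD addrN expR0.
have -> : 2%:R * (x / 2) = x by field.
have -> : 2%:R * - (x / 2) = - x by field.
ring.
Qed.

Lemma sqr_le_sh2_sqr x : x ^+ 2 <= sh2 x ^+ 2.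
Proof.
wlog x0 : x / 0 <= x.
  move=> H; have [x0|/ltW x0] := leP 0 x; first exact: H.
  have := H (- x); rewrite sqrrN oppr_ge0 => /(_ x0).
  by rewrite !sh2_sqr opprK [expR (- x) + _]addrC.
have h : x <= sh2 x.
  rewrite /sh2; have := expR_ge1Dx (x / 2); have e1 := expR_ge1Dx (- (x / 2)).
  have cf : continuous (fun x : R => sh2 x - x).
    by move=> t; apply/differentiable_continuous/derivable1_diffP; rewrite /sh2; exact: ex_derive.
  have df t : is_derive t 1 (fun x : R => sh2 x - x) (ch2 t - 1).
    by rewrite /sh2; apply: is_derive_eq; rewrite /ch2 /GRing.scale /=; ring.
  have [c _] := MVT_segment x0 (fun t _ => df t) (continuous_subspaceT cf).
  have s0 : sh2 0 = 0 :> R by rewrite /sh2 mul0r oppr0 subrr.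
  rewrite s0 !subr0 => e _; rewrite -subr_ge0 -/(sh2 x) e mulr_ge0 // subr_ge0.
  exact: ch2_ge1.
by rewrite lerXn2r ?nnegrE //; exact: le_trans h.
Qed.

Lemma ch2_sub1_le x : ch2 x - 1 <= sh2 x ^+ 2.
Proof.
have c1 := ch2_ge1 x.
have e : ch2 x ^+ 2 - 1 = sh2 x ^+ 2 / 4.
  rewrite /ch2 /sh2; have h : expR (x / 2) * expR (- (x / 2)) = 1 by rewrite -expRD subrr expR0.
  move: (expR _) (expR _) h => u v h.
  have -> : ((v + u) / 2) ^+ 2 - 1 = ((v - u) ^+ 2 + 4 * (v * u) - 4) / 4 by field.
  by rewrite h; field.
have : 0 <= sh2 x ^+ 2 by exact: sqr_ge0.
nra.
Qed.

(** [sh2 x ^+ 2] is at least e^|x| - 2, so the right-hand side grows doubly exponentially; a Taylor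
    term of order [m] above [K] suffices. *)
Lemma expR_abs_le_gauss K : exists2 C : R, 0 <= C & forall x, expR (K * `|x|) <= C * expR (sh2 x ^+ 2 / 2).
Proof.
pose m := (Num.bound `|K|).+1.
exists (expR 1 * 2 ^+ m * m`!%:R); first by rewrite 2?mulr_ge0 ?expR_ge0 ?exprn_ge0.
move=> x.
have h1 : expR `|x| - 2 <= sh2 x ^+ 2.
  rewrite sh2_sqr; case: (ger0P x) => _; rewrite lerD2r ?lerDl ?lerDr expR_ge0 //.
have h2 : expR (expR `|x| / 2) <= expR 1 * expR (sh2 x ^+ 2 / 2).
  by rewrite -expRD ler_expR; lra.
have h3 : expR (K * `|x|) <= expR `|x| ^+ m.
  rewrite -expRM_natl ler_expR ler_wpM2r //.
  by apply: le_trans (ler_norm K) _; apply/ltW; apply: lt_le_trans (archi_boundP (normr_ge0 K)) _; rewrite ler_nat.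
have h4 : (expR `|x| / 2) ^+ m / m`!%:R <= expR (expR `|x| / 2).
  have e0 : 0 <= expR `|x| / 2 by rewrite divr_ge0 ?expR_ge0.
  by apply: le_trans (expR_ge1Dxn (Num.bound `|K|) e0); rewrite -[_ <= _]/(_ <= 1 + _) lerDr.
have f0 : 0 < m`!%:R :> R by rewrite ltr0n fact_gt0.
apply: (le_trans h3); move: h4; rewrite ler_pdivrMr // expr_div_n ler_pdivrMr ?exprn_gt0 // => h4.
apply: (le_trans h4); rewrite -mulrA [_ * (m`!%:R * _)]mulrC.
have -> : expR 1 * 2 ^+ m * m`!%:R * expR (sh2 x ^+ 2 / 2) = m`!%:R * 2 ^+ m * (expR 1 * expR (sh2 x ^+ 2 / 2)) by ring.
by rewrite ler_wpM2l // mulr_ge0 // ltW.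
Qed.

(** For negative [t] this avoids e^|t|. It will be applied to the exponent [psi] of the profile,
    which can be doubly exponentially negative and is well controlled only from above. *)
Lemma expR_sub1_sub_le_sqr t : `|expR t - 1 - t| <= t ^+ 2 * (1 + expR t).
Proof.
rewrite ger0_norm ?expR_sub1_sub_ge0 //; have e0 := expR_gt0 t.
have [t0|t0] := leP 0 t.
  apply: le_trans (expR_sub1_sub_le _) _; rewrite ger0_norm // ler_wpM2l ?sqr_ge0 //.
  by rewrite lerDr.
have h : expR t <= (1 - t)^-1.
  rewrite -[leLHS]invrK -expRN lef_pV2 ?posrE ?expR_gt0 //; last by lra.
  exact: expR_ge1Dx.
have h2 : (1 - t)^-1 <= 1 + t + t ^+ 2.
  rewrite -[leLHS]mul1r ler_pdivrMr; last by lra.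
  have -> : (1 + t + t ^+ 2) * (1 - t) = 1 - t ^+ 3 by ring.
  rewrite lerDl oppr_ge0 exprS pmulr_lle0 ?exprn_even_gt0 ?ltW //=.
  by rewrite lt_eqF.
have : 0 <= t ^+ 2 * expR t by rewrite mulr_ge0 ?sqr_ge0 // ltW.
lra.
Qed.
End gaussian.

Section outer_profile.
Context {R : realType}.
Local Notation mu := (@lebesgue_measure R).
Variables (al b : R).
Hypothesis b0 : 0 < b.

(** [x] is the logarithmic distance to the saddle point. The term with b / 8 is the inner correction
    e^(-r^2 / (16 n)), the one with b / 4 approximates [outer_factor]; at 0 they give e^(-3 b /
    8). *)
Definition outer_profile (x : R) : R :=
  expR (- (al * x) - b / 8 * expR (2 * x) - b / 4 * expR (- (2 * x))).

Lemma continuous_outer_profile : continuous outer_profile.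
Proof.
move=> x; apply/differentiable_continuous/derivable1_diffP.
by rewrite /outer_profile; exact: ex_derive.
Qed.

Lemma outer_profile_bound : exists C : R, exists2 K : R, 0 <= C & forall x,
  `|outer_profile x - expR (- (3 * b / 8)) * (1 + (b / 4 - al) * x)|
  <= expR (- (3 * b / 8)) * (C * x ^+ 2 * expR (K * `|x|)).
Proof.
have b32 : 0 <= 3 * b / 2 by have := b0; lra.
have e1 : 0 <= 1 + expR (3 * b / 8) by rewrite addr_ge0 ?expR_ge0.
pose D : R := `|b / 4 - al| + 3 * b / 2.
have D0 : 0 <= D by rewrite addr_ge0.
exists (3 * b / 2 + D ^+ 2 * (1 + expR (3 * b / 8))); exists (6 + `|al|).
  exact: addr_ge0 b32 (mulr_ge0 (sqr_ge0 D) e1).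
move=> x; pose psi : R := - (al * x) - b / 8 * (expR (2 * x) - 1) - b / 4 * (expR (- (2 * x)) - 1).
have x0 := normr_ge0 x.
have -> : outer_profile x = expR (- (3 * b / 8)) * expR psi.
  by rewrite -expRD; congr expR; rewrite /psi; field.
rewrite -mulrBr normrM (ger0_norm (expR_ge0 _)) ler_wpM2l ?expR_ge0 //.
pose r : R := psi - (b / 4 - al) * x.
have ee (k l : R) : k <= l -> expR (k * `|x|) <= expR (l * `|x|) by move=> kl; rewrite ler_expR ler_wpM2r.
have rE : `|r| <= 3 * b / 2 * (x ^+ 2 * expR (2 * `|x|)).
  have -> : r = - (b / 8 * (expR (2 * x) - 1 - 2 * x)) - b / 4 * (expR (- (2 * x)) - 1 - - (2 * x)).
    by rewrite /r /psi; field.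
  have h1 := normr_expR_sub1_sub (2 * x); have h2 := normr_expR_sub1_sub (- (2 * x)).
  rewrite normrN in h2; rewrite normrM [`|2|]ger0_norm // in h1 h2; rewrite sqrrN in h2.
  have b8 : 0 <= b / 8 by rewrite divr_ge0 // ltW.
  have b4 : 0 <= b / 4 by rewrite divr_ge0 // ltW.
  apply: le_trans (ler_normB _ _) _; rewrite normrN (normrM (b / 8)) (normrM (b / 4)).
  rewrite (ger0_norm b8) (ger0_norm b4).
  have := lerD (ler_wpM2l b8 h1) (ler_wpM2l b4 h2).
  by move/le_trans; apply; rewrite le_eqVlt; apply/orP; left; apply/eqP; field.
have psiB : `|psi| <= D * (`|x| * expR (3 * `|x|)).
  have -> : psi = (b / 4 - al) * x + r by rewrite /r; ring.
  apply: le_trans (ler_normD _ _) _; rewrite normrM mulrDl; apply: lerD.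
    rewrite ler_wpM2l // ler_peMr // -[X in X <= _]expR0 ler_expR; lra.
  apply: le_trans rE _; rewrite ler_wpM2l //.
  rewrite -[x ^+ 2]real_normK ?num_real // expr2 -mulrA ler_wpM2l //.
  have -> : expR (3 * `|x|) = expR `|x| * expR (2 * `|x|) by rewrite -expRD; congr expR; ring.
  by rewrite ler_wpM2r ?expR_ge0 //; apply: le_trans (expR_ge1Dx _); rewrite lerDr.
have psiU : expR psi <= expR (3 * b / 8) * expR (`|al| * `|x|).
  rewrite -expRD ler_expR /psi; have h1 : - (al * x) <= `|al| * `|x|.
    by rewrite -normrM -normrN ler_norm.
  have h2 : 0 <= b / 8 * expR (2 * x) by rewrite mulr_ge0 ?expR_ge0 // divr_ge0 // ltW.
  have h3 : 0 <= b / 4 * expR (- (2 * x)) by rewrite mulr_ge0 ?expR_ge0 // divr_ge0 // ltW.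
  lra.
have psi2 : psi ^+ 2 <= D ^+ 2 * (x ^+ 2 * expR (6 * `|x|)).
  rewrite -[psi ^+ 2]real_normK ?num_real //.
  have -> : D ^+ 2 * (x ^+ 2 * expR (6 * `|x|)) = (D * (`|x| * expR (3 * `|x|))) ^+ 2.
    rewrite !exprMn real_normK ?num_real // -expRM_natl; congr (_ * (_ * expR _)); ring.
  by rewrite lerXn2r ?nnegrE // mulr_ge0 // mulr_ge0 ?expR_ge0.
have -> : expR psi - (1 + (b / 4 - al) * x) = (expR psi - 1 - psi) + r by rewrite /r; ring.
apply: le_trans (ler_normD _ _) _; rewrite addrC mulrDl mulrDl; apply: lerD.
  apply: le_trans rE _; rewrite -[leRHS]mulrA ler_wpM2l // ler_wpM2l ?sqr_ge0 //.
  by apply: ee; have := normr_ge0 al; lra.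
apply: le_trans (expR_sub1_sub_le_sqr _) _.
have h1 : 1 + expR psi <= (1 + expR (3 * b / 8)) * expR (`|al| * `|x|).
  rewrite mulrDl mul1r; apply: lerD => //.
  by rewrite -[X in X <= _]expR0 ler_expR mulr_ge0.
apply: le_trans (ler_pM (sqr_ge0 _) _ psi2 h1) _; first by rewrite addr_ge0 ?expR_ge0.
rewrite (mulrDl 6) (expRD (6 * _)) le_eqVlt; apply/orP; left; apply/eqP; ring.
Qed.

End outer_profile.

(** * Gaussian integrals of the profile *)

Section outer_gaussian.
Context {R : realType}.
Local Notation mu := (@lebesgue_measure R).

Lemma has_integral_ge0 (f : R -> R) v : measurable_fun setT f -> (forall x, 0 <= f x) ->
  (\int[mu]_x (f x)%:E)%E = v%:E -> has_integral f v.
Proof.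
move=> mf f0 fv; split => //; apply/integrableP; split; first exact/measurable_EFinP.
have -> : (\int[mu]_x `|(EFin \o f) x| = \int[mu]_x (f x)%:E)%E.
  by apply: eq_integral => x _ /=; rewrite ger0_norm.
by rewrite fv ltry.
Qed.

Lemma has_integral_shift (f : R -> R) v c : continuous f -> (forall x, 0 <= f x) ->
  has_integral f v -> has_integral (fun x => f (x - c)) v.
Proof.
move=> cf f0 [_ fv]; have cg : continuous (fun x => f (x - c)).
  move=> x; apply: (@continuous_comp _ _ _ (fun x : R => x - c)); last exact: cf.
  by apply/differentiable_continuous/derivable1_diffP; exact: ex_derive.
apply: has_integral_ge0 => //; first exact: continuous_measurable_fun.
by apply: etrans fv; apply/esym; exact: integralT_shift.
Qed.

Lemma continuous_gauss_sh2 (c : R) : continuous (fun x => expR (- c * sh2 x ^+ 2)).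
Proof.
have c1 : continuous (fun x : R => - c * sh2 x ^+ 2).
  move=> x; apply: cvgM; first exact: cvg_cst.
  exact: (@continuous_exprn_comp _ _ 2 (@continuous_sh2 R) x).
move=> x; apply: (@continuous_comp _ _ _ (fun x => - c * sh2 x ^+ 2)); first exact: c1.
exact: continuous_expR.
Qed.

Lemma has_integral_gauss (c : R) : 0 < c ->
  has_integral (fun x => expR (- c * sh2 x ^+ 2) * ch2 x) (Num.sqrt (pi / c)).
Proof.
move=> c0; apply: has_integral_ge0; last exact: integral_gauss_sh2.
- apply: continuous_measurable_fun => x.
  by apply: cvgM; [exact: continuous_gauss_sh2|exact: continuous_ch2].
- by move=> x; rewrite mulr_ge0 ?expR_ge0 // (le_trans _ (ch2_ge1 x)).
Qed.

Lemma gauss_half_sqrt (c : R) : 0 < c -> Num.sqrt (pi / (c / 2)) <= 2 * Num.sqrt (pi / c).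
Proof.
move=> c0; have -> : pi / (c / 2) = 2 * (pi / c) :> R by field; rewrite gt_eqF.
rewrite sqrtrM // ler_wpM2r ?sqrtr_ge0 //.
rewrite -[leRHS]ger0_norm // -sqrtr_sqr ler_sqrt //; lra.
Qed.

Lemma gauss_moment (K : R) : exists2 C : R, 0 <= C & forall c, 2 <= c -> exists2 v,
  has_integral (fun x => expR (- c * sh2 x ^+ 2) * expR (K * `|x|)) v & `|v| <= C * Num.sqrt (pi / c).
Proof.
have [C C0 HC] := expR_abs_le_gauss K.
exists (C * 2); first by rewrite mulr_ge0.
move=> c c2; have c0 : 0 < c by lra.
have c20 : 0 < c / 2 by lra.
(* Comparison with the zero function: only a bound on the integral is wanted. *)
have Hg := has_integralZ 0 (has_integral_gauss c0).
have He := has_integralZ C (has_integral_gauss c20).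
have [] := has_integral_near (f := fun x => expR (- c * sh2 x ^+ 2) * expR (K * `|x|)) _ Hg He.
- apply: continuous_measurable_fun => x; apply: cvgM; first exact: continuous_gauss_sh2.
  apply: (@continuous_comp _ _ _ (fun x : R => K * `|x|)); last exact: continuous_expR.
  apply: cvgM; first exact: cvg_cst.
  exact: (cvg_norm (@cvg_id _ _)).
- move=> x; rewrite mul0r subr0 ger0_norm ?mulr_ge0 ?expR_ge0 //.
  have c1 := ch2_ge1 x; have s0 : 0 <= sh2 x ^+ 2 by exact: sqr_ge0.
  apply: (@le_trans _ _ (expR (- c * sh2 x ^+ 2) * (C * expR (sh2 x ^+ 2 / 2)))).
    by rewrite ler_wpM2l ?expR_ge0.
  rewrite mulrCA ler_wpM2l // -expRD.
  apply: (@le_trans _ _ (expR (- (c / 2) * sh2 x ^+ 2))); last by rewrite ler_peMr ?expR_ge0.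
  by rewrite ler_expR; nra.
move=> v Hv; rewrite mul0r subr0 => hv; exists v => //.
by apply: le_trans hv _; rewrite -mulrA ler_wpM2l // gauss_half_sqrt.
Qed.

(** The linear term of the profile at 0 is odd and disappears from [f x + f (- x)], which makes the
    relative error 1 / c instead of c^(-1/2). Half of the Gaussian exponent is spent on absorbing
    the quadratic remainder. *)
Lemma gauss_profile (al b : R) : 0 < b -> exists2 C : R, 0 <= C & forall c, 2 <= c -> exists2 v,
  has_integral (fun x => expR (- c * sh2 x ^+ 2) * outer_profile al b x) v &
  `|v - expR (- (3 * b / 8)) * Num.sqrt (pi / c)| <= C / c * Num.sqrt (pi / c).
Proof.
move=> b0; have [C1 [K C10 HC1]] := outer_profile_bound al b0.
have [C2 C20 HC2] := expR_abs_le_gauss `|K|.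
set E0 := expR (- (3 * b / 8)) in HC1 *.
have E00 : 0 < E0 by exact: expR_gt0.
pose D := E0 * (C1 + 1) * C2.
have D0 : 0 <= D by rewrite mulr_ge0 // mulr_ge0 ?(ltW E00) //; lra.
exists (D * 8); first by rewrite mulr_ge0.
move=> c c2; have c0 : 0 < c by lra.
have c20 : 0 < c / 2 by lra.
pose f x := expR (- c * sh2 x ^+ 2) * outer_profile al b x.
have cf : continuous f.
  by move=> x; apply: cvgM; [exact: continuous_gauss_sh2|exact: continuous_outer_profile].
have f0 x : 0 <= f x by rewrite mulr_ge0 ?expR_ge0.
have cfN : continuous (fun x => f (- x)).
  move=> x; apply: (@continuous_comp _ _ _ (fun x : R => - x)); last exact: cf.
  exact: opp_continuous.
have Hg := has_integralZ (2 * E0) (has_integral_gauss c0).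
have He := has_integralZ (D * 8 / c) (has_integral_gauss c20).
have [] := has_integral_near (f := fun x => f x + f (- x)) _ Hg He.
- by apply: measurable_funD; exact: continuous_measurable_fun.
- move=> x; have c1 := ch2_ge1 x; have s0 : 0 <= sh2 x ^+ 2 by exact: sqr_ge0.
  have sN : sh2 (- x) ^+ 2 = sh2 x ^+ 2 by rewrite !sh2_sqr opprK [expR (- x) + _]addrC.
  have -> : f x + f (- x) - 2 * E0 * (expR (- c * sh2 x ^+ 2) * ch2 x)
    = expR (- c * sh2 x ^+ 2) * ((outer_profile al b x - E0 * (1 + (b / 4 - al) * x))
      + (outer_profile al b (- x) - E0 * (1 + (b / 4 - al) * - x)) - 2 * E0 * (ch2 x - 1)).
    by rewrite /f sN; ring.
  rewrite normrM (ger0_norm (expR_ge0 _)).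
  have hp := HC1 x; have hm := HC1 (- x); have hK := HC2 x; have xs := sqr_le_sh2_sqr x.
  have ks : expR (K * `|x|) <= C2 * expR (sh2 x ^+ 2 / 2).
    by apply: le_trans hK; rewrite ler_expR ler_wpM2r // ler_norm.
  have k1 : 1 <= C2 * expR (sh2 x ^+ 2 / 2).
    by apply: le_trans hK; rewrite -[X in X <= _]expR0 ler_expR mulr_ge0.
  have c3 : ch2 x - 1 <= sh2 x ^+ 2 := ch2_sub1_le x.
  rewrite normrN sqrrN in hm.
  (* s <= (4 / c) e^(c s / 4) gains the factor 1 / c, and 1 / 2 + c / 4 <= c / 2 because c >= 2. *)
  have eb : expR (- c * sh2 x ^+ 2) * (sh2 x ^+ 2 * expR (sh2 x ^+ 2 / 2))
      <= 4 / c * expR (- (c / 2) * sh2 x ^+ 2).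
    have h1 : sh2 x ^+ 2 <= 4 / c * expR (c / 4 * sh2 x ^+ 2).
      rewrite [leLHS](_ : _ = 4 / c * (c / 4 * sh2 x ^+ 2)); last by field; rewrite gt_eqF.
      rewrite ler_wpM2l ?divr_ge0 ?(ltW c0) //.
      by apply: le_trans (expR_ge1Dx _); rewrite lerDr.
    rewrite mulrCA; apply: le_trans (ler_wpM2r _ h1) _.
      by rewrite mulr_ge0 ?expR_ge0.
    rewrite -[leLHS]mulrA ler_wpM2l ?divr_ge0 ?(ltW c0) // -!expRD ler_expR.
    by move: (sh2 x ^+ 2) s0 => s s0; nra.
  have big : `|outer_profile al b x - E0 * (1 + (b / 4 - al) * x)
      + (outer_profile al b (- x) - E0 * (1 + (b / 4 - al) * - x)) - 2 * E0 * (ch2 x - 1)|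
      <= 2 * D * (sh2 x ^+ 2 * expR (sh2 x ^+ 2 / 2)).
    have t1 : C1 * x ^+ 2 * expR (K * `|x|) <= C1 * sh2 x ^+ 2 * (C2 * expR (sh2 x ^+ 2 / 2)).
      exact: ler_pM (mulr_ge0 C10 (sqr_ge0 x)) (expR_ge0 _) (ler_wpM2l C10 xs) ks.
    have t2 : ch2 x - 1 <= sh2 x ^+ 2 * (C2 * expR (sh2 x ^+ 2 / 2)).
      by apply: le_trans c3 _; rewrite ler_peMr.
    have {}hp := le_trans hp (ler_wpM2l (ltW E00) t1).
    have {}hm := le_trans hm (ler_wpM2l (ltW E00) t1).
    have h3 := ler_wpM2l (ltW E00) t2.
    apply: le_trans (ler_normB _ _) _; apply: le_trans (lerD (ler_normD _ _) (lexx _)) _.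
    rewrite [`|2 * E0 * _|]ger0_norm; last first.
      by rewrite mulr_ge0 ?subr_ge0 // mulr_ge0 // ltW.
    have -> : 2 * D * (sh2 x ^+ 2 * expR (sh2 x ^+ 2 / 2))
      = E0 * (C1 * sh2 x ^+ 2 * (C2 * expR (sh2 x ^+ 2 / 2)))
      + E0 * (C1 * sh2 x ^+ 2 * (C2 * expR (sh2 x ^+ 2 / 2)))
      + 2 * (E0 * (sh2 x ^+ 2 * (C2 * expR (sh2 x ^+ 2 / 2)))) by rewrite /D; ring.
    apply: lerD; first exact: lerD.
    by rewrite -mulrA ler_wpM2l.
  apply: le_trans (ler_wpM2l (expR_ge0 _) big) _.
  rewrite mulrCA; apply: le_trans (ler_wpM2l _ eb) _; first by rewrite mulr_ge0.
  rewrite [leLHS](_ : _ = D * 8 / c * expR (- (c / 2) * sh2 x ^+ 2)); last by field; rewrite gt_eqF.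
  rewrite ler_wpM2l //; first exact: divr_ge0 (mulr_ge0 D0 (ler0n R 8)) (ltW c0).
  by rewrite ler_peMr ?expR_ge0.
(* The reflection invariance of the integral makes [v] twice the integral of [f]. *)
move=> v Hv hv; exists (v / 2).
  apply: (has_integral_ge0 (continuous_measurable_fun cf) f0).
  have := ge0_integralT_D (continuous_measurable_fun cf) (continuous_measurable_fun cfN) f0 (fun x => f0 (- x)).
  rewrite -(integralT_opp cf f0) => /(etrans (esym Hv.2)).
  have : (0 <= \int[mu]_x (f x)%:E)%E by apply: integral_ge0 => x _; rewrite lee_fin.
  case: (\int[mu]_x (f x)%:E)%E => [u| |] // _ [] ->; congr EFin; by field.
have h2 := ler_wpM2l (divr_ge0 (mulr_ge0 D0 (ler0n R 8)) (ltW c0)) (gauss_half_sqrt c0).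
have := le_trans hv h2; rewrite ![`|_ - _| <= _]ler_norml => /andP[hv1 hv2].
by apply/andP; split; lra.
Qed.
End outer_gaussian.

Section outer_pointwise.
Context {R : realType}.

Lemma kernel_pos_outer_factor n (a h : R) :
  kernel_pos n a h = expR ((2 * n%:R + a) * h - n%:R * expR (- h)) * outer_factor n (expR (- h)).
Proof.
have m0 : Num.max (expR h - 1) 0 = expR h * Num.max (1 - expR (- h)) 0.
  rewrite maxr_pMr ?expR_ge0 // mulr0; congr (Num.max _ _).
  by rewrite mulrBr mulr1 -expRD subrr expR0.
rewrite /kernel_pos m0 exprMn /outer_factor -expRM_natl mulrAC -expRD.
rewrite [RHS]mulrA [RHS]mulrAC -expRD; congr (expR _ * _); ring.
Qed.

(* With y0 = e^l0, the exponent n e^{-h} + b e^h / 2 at h = k + l0 is c (e^k + e^{-k}) = c (sh2 k ^ 2 + 2). *)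
Lemma outer_pointwise n (a1 a2 b C l0 k v : R) : 0 < b -> 0 <= C -> -1 < a1 -> (0 < n)%N ->
  n%:R = b * expR l0 ^+ 2 / 2 -> 1 <= expR l0 ->
  let c := b * expR l0 / 2 in
  let s := 2 * n%:R + a1 + 1 in let r := b * expR (k + l0) in
  let P := Gamma s * b `^ (- s) * expR (- ((a1 - a2) * l0) - 2 * c) in
  let C' := C * (2 + 8 * b + 4 * Num.sqrt (b / 2)) + expR 2 * b / 2 in
  `|v - Gamma s * r `^ (- s) * expR (- (r ^+ 2 / (16 * n%:R)))|
    <= Gamma s * r `^ (- s) * (C * (r / n%:R + r ^+ 4 / n%:R ^+ 3 + r ^+ 2 * Num.sqrt n%:R / n%:R ^+ 2)) ->
  `|kernel_pos n a2 (k + l0) * (expR (k + l0 - r / 2) * v)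
      - P * (expR (- c * sh2 k ^+ 2) * outer_profile (a1 - a2) b k)|
    <= P * (C' / expR l0) * (expR (- c * sh2 k ^+ 2) * expR ((4 + `|a1 - a2|) * `|k|)).
Proof.
move=> b0 C0 a11 n0 nE l1 c s r P C' hv.
have np : 0 < n%:R :> R by rewrite ltr0n.
have s0 : 0 < s by rewrite /s; lra.
have G0 : 0 < Gamma s by exact: Gamma_gt0.
have r0 : 0 < r by rewrite mulr_gt0 ?expR_gt0.
have W0 : 0 < Gamma s * r `^ (- s) by rewrite mulr_gt0 ?powR_gt0.
set W := Gamma s * r `^ (- s) in W0 hv.
pose u := v / W; have vE : v = W * u by rewrite mulrC mulfVK ?gt_eqF.
set dl := C * _ in hv; set B0 := expR (- (r ^+ 2 / _)) in hv.
have hu : `|u - B0| <= dl.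
  by rewrite -(ler_pM2l W0) -{1}(ger0_norm (ltW W0)) -normrM mulrBr -vE.
set y0 := expR l0 in nE l1 *.
have y00 : 0 < y0 by exact: expR_gt0.
pose A0 := expR (- (b / 4 * expR (- (2 * k)))).
set OF := outer_factor n (expR (- (k + l0))).
have eN : expR (- (k + l0)) = expR (- k) / y0 by rewrite opprD expRD (expRN l0).
have eD : expR (k + l0) = expR k * y0 by rewrite expRD.
have ek2 : expR (2 * k) = expR k ^+ 2 by rewrite -expRM_natl.
have ekN2 : expR (- (2 * k)) = expR (- k) ^+ 2 by rewrite -expRM_natl; congr expR; ring.
have B0E : B0 = expR (- (b / 8 * expR (2 * k))).
  rewrite /B0 /r eD nE ek2; congr expR; field; by rewrite !gt_eqF.
have A0E : `|OF - A0| <= expR 2 * n%:R * expR (- (k + l0)) ^+ 3.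
  have := outer_factor_bound n0 (expR_ge0 (- (k + l0))).
  rewrite (_ : - (n%:R * expR (- (k + l0)) ^+ 2 / 2) = - (b / 4 * expR (- (2 * k)))) //.
  by rewrite eN ekN2 nE; field; rewrite gt_eqF.
(* The powers of e^(k + l0) from [kernel_pos], from e^h and from r^(-s) cancel down to the exponent
   a2 - a1, so the large exponents 2 n disappear. *)
have main : kernel_pos n a2 (k + l0) * (expR (k + l0 - r / 2) * v)
    = P * (expR (- c * sh2 k ^+ 2) * expR (- ((a1 - a2) * k))) * (OF * u).
  rewrite kernel_pos_outer_factor -/OF vE /W /P.
  have -> : r `^ (- s) = b `^ (- s) * expR (- s * (k + l0)).
    by rewrite /r powRM ?expR_ge0 ?(ltW b0) // powR_expR.
  have EE : expR ((2 * n%:R + a2) * (k + l0) - n%:R * expR (- (k + l0))) * expR (k + l0 - r / 2)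
      * expR (- s * (k + l0))
    = expR (- ((a1 - a2) * l0) - 2 * c) * expR (- c * sh2 k ^+ 2) * expR (- ((a1 - a2) * k)).
    rewrite -!expRD sh2_sqr eN /r eD /c nE -/y0 /s nE; congr expR; by field; rewrite gt_eqF.
  transitivity (expR ((2 * n%:R + a2) * (k + l0) - n%:R * expR (- (k + l0))) * expR (k + l0 - r / 2)
      * expR (- s * (k + l0)) * (OF * (Gamma s * b `^ (- s) * u))); first by ring.
  by rewrite EE; ring.
have prof : outer_profile (a1 - a2) b k = expR (- ((a1 - a2) * k)) * (A0 * B0).
  by rewrite B0E /A0 -!expRD /outer_profile; congr expR; ring.
have OF01 : 0 <= OF <= 1 by rewrite outer_factor_ge0 outer_factor_le1 ?expR_ge0.
have B01 : B0 <= 1.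
  by rewrite -[X in _ <= X]expR0 ler_expR oppr_le0 divr_ge0 ?sqr_ge0 // mulr_ge0.
have dif : `|OF * u - A0 * B0| <= dl + expR 2 * n%:R * expR (- (k + l0)) ^+ 3.
  have -> : OF * u - A0 * B0 = OF * (u - B0) + B0 * (OF - A0) by ring.
  apply: le_trans (ler_normD _ _) _; rewrite (normrM OF) (normrM B0); case/andP: OF01 => o0 o1.
  apply: lerD.
    by rewrite (ger0_norm o0) -[X in _ <= X]mul1r ler_pM.
  by rewrite (ger0_norm (expR_ge0 _)) -[X in _ <= X]mul1r ler_pM ?expR_ge0.
have tot : dl + expR 2 * n%:R * expR (- (k + l0)) ^+ 3 <= C' / y0 * expR (4 * `|k|).
  have kT (m : nat) (x : R) : `|x| = `|k| -> (m <= 4)%N -> expR x ^+ m <= expR (4 * `|k|).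
    move=> xk m4; rewrite -expRM_natl ler_expR.
    apply: (@le_trans _ _ (m%:R * `|k|)); first by rewrite ler_wpM2l // -xk ler_norm.
    by rewrite ler_wpM2r // ler_nat.
  set T := expR (4 * `|k|) in kT *.
  have sn : Num.sqrt n%:R = y0 * Num.sqrt (b / 2).
    rewrite nE mulrAC sqrtrM ?divr_ge0 ?(ltW b0) // sqrtr_sqr ger0_norm ?(ltW y00) //.
    by rewrite mulrC.
  have sb0 := sqrtr_ge0 (b / 2).
  have iy0 : 0 < y0^-1 by rewrite invr_gt0.
  have iy1 : y0^-1 <= 1 by rewrite invf_le1.
  have t1 : r / n%:R <= 2 / y0 * T.
    have -> : r / n%:R = 2 / y0 * expR k ^+ 1.
      by rewrite /r eD nE expr1; field; rewrite !gt_eqF.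
    by rewrite ler_wpM2l ?kT // divr_ge0 // ltW.
  have t2 : r ^+ 4 / n%:R ^+ 3 <= 8 * b / y0 * T.
    have -> : r ^+ 4 / n%:R ^+ 3 = 8 * b / y0 * (y0^-1 * expR k ^+ 4).
      by rewrite /r eD nE; field; rewrite !gt_eqF.
    rewrite ler_wpM2l ?divr_ge0 ?mulr_ge0 ?(ltW b0) ?(ltW y00) //.
    rewrite -[leRHS]mul1r; exact: ler_pM (ltW iy0) (exprn_ge0 _ (expR_ge0 _)) iy1 (kT _ _ _ _).
  have t3 : r ^+ 2 * Num.sqrt n%:R / n%:R ^+ 2 <= 4 * Num.sqrt (b / 2) / y0 * T.
    have -> : r ^+ 2 * Num.sqrt n%:R / n%:R ^+ 2 = 4 * Num.sqrt (b / 2) / y0 * expR k ^+ 2.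
      by rewrite sn /r eD nE; field; rewrite !gt_eqF.
    by rewrite ler_wpM2l ?kT // divr_ge0 ?(ltW y00) // mulr_ge0.
  have t4 : expR 2 * n%:R * expR (- (k + l0)) ^+ 3 <= expR 2 * b / 2 / y0 * T.
    have -> : expR 2 * n%:R * expR (- (k + l0)) ^+ 3 = expR 2 * b / 2 / y0 * expR (- k) ^+ 3.
      by rewrite eN nE; field; rewrite !gt_eqF.
    rewrite ler_wpM2l ?kT ?normrN // divr_ge0 ?(ltW y00) // divr_ge0 // mulr_ge0 ?expR_ge0 ?(ltW b0) //.
  have t123 := ler_wpM2l C0 (lerD (lerD t1 t2) t3).
  apply: le_trans (lerD t123 t4) _.
  by rewrite le_eqVlt; apply/orP; left; apply/eqP; rewrite /C'; field; rewrite gt_eqF.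
have P0 : 0 <= P by rewrite mulr_ge0 ?expR_ge0 // mulr_ge0 ?powR_ge0 // ltW.
rewrite main prof.
have -> : forall G e : R, P * (G * e) * (OF * u) - P * (G * (e * (A0 * B0))) = P * G * e * (OF * u - A0 * B0).
  by move=> G e; ring.
have PG0 : 0 <= P * expR (- c * sh2 k ^+ 2) := mulr_ge0 P0 (expR_ge0 _).
rewrite normrM (ger0_norm (mulr_ge0 PG0 (expR_ge0 _))).
have ek : expR (- ((a1 - a2) * k)) <= expR (`|a1 - a2| * `|k|).
  by rewrite ler_expR -normrM -normrN ler_norm.
rewrite (mulrDl 4) (expRD (4 * _)).
rewrite [leRHS](_ : _ = P * expR (- c * sh2 k ^+ 2) * expR (`|a1 - a2| * `|k|) * (C' / y0 * expR (4 * `|k|))); last by ring.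
apply: ler_pM; rewrite ?normr_ge0 //; first exact: mulr_ge0 PG0 (expR_ge0 _).
  exact: ler_wpM2l.
exact: le_trans dif tot.
Qed.
End outer_pointwise.

Section outer_integral.
Context {R : realType}.
Local Notation mu := (@lebesgue_measure R).
Variables (a1 a2 b : R).
Hypotheses (a11 : -1 < a1) (b0 : 0 < b).

Definition saddle n : R := Num.sqrt (2 * n%:R / b).

(** The Gamma prefactor of the inner integral, the exponential at the saddle point, and the Gaussian
    integral with c = b y0 / 2 weighted by the value e^(-3 b / 8) of the profile. *)
Definition kernel_lead n : R :=
  Gamma (2 * n%:R + a1 + 1) * b `^ (- (2 * n%:R + a1 + 1))
    * expR (- ((a1 - a2) * ln (saddle n)) - 2 * (b * saddle n / 2))
    * (expR (- (3 * b / 8)) * Num.sqrt (pi / (b * saddle n / 2))).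

Lemma saddleE n : saddle n = Num.sqrt (2 / b) * Num.sqrt n%:R.
Proof. by rewrite /saddle mulrAC sqrtrM // divr_ge0 // ltW. Qed.

(** [outer_pointwise] compares the integrand with a Gaussian times the profile, centred at [l0]. Its
    relative error is of order 1 / [saddle n], that of [gauss_profile] is of order 1 / c, and both
    are O(n^(-1/2)). *)
Lemma kernel_integral_asymp : exists C : R, \forall n \near \oo,
  measurable_fun setT (fun h => (kernel_pos n a2 h)%:E
    * \int[mu]_l (kernel_pos n a1 l * logGammaF 1 b (l + h))%:E)%E ->
  exists2 v, (\int[mu]_h ((kernel_pos n a2 h)%:E
    * \int[mu]_l (kernel_pos n a1 l * logGammaF 1 b (l + h))%:E) = v%:E)%E &
  `|v / kernel_lead n - 1| <= C / Num.sqrt n%:R.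
Proof.
have [Ci Ci0 HI] := inner_moment a1.
have [Cg Cg0 HG] := gauss_moment (4 + `|a1 - a2|).
have [Cp Cp0 HP] := gauss_profile (a1 - a2) b0.
pose C' := Ci * (2 + 8 * b + 4 * Num.sqrt (b / 2)) + expR 2 * b / 2.
set E0 := expR (- (3 * b / 8)) in HP.
have E00 : 0 < E0 by exact: expR_gt0.
pose q : R := Num.sqrt (2 / b).
have q0 : 0 < q by rewrite sqrtr_gt0 divr_gt0.
have C'0 : 0 <= C'.
  have h1 : 0 <= 2 + 8 * b + 4 * Num.sqrt (b / 2) by have := sqrtr_ge0 (b / 2); have := b0; lra.
  have h2 : 0 <= expR 2 * b / 2 := divr_ge0 (mulr_ge0 (expR_ge0 2) (ltW b0)) (ler0n R 2).
  exact: addr_ge0 (mulr_ge0 Ci0 h1) h2.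
exists ((C' * Cg + 2 * Cp / b) / (E0 * q)); near=> n => mF.
have n0 : (0 < n)%N by near: n; exact: nbhs_infty_gt.
have np : 0 < n%:R :> R by rewrite ltr0n.
have an : `|a1| + 4 <= n%:R.
  have h : Num.max 1 (`|a1| + 4) <= Num.sqrt n%:R by near: n; exact: near_sqrt_ge.
  have [h1 h2] : 1 <= Num.sqrt n%:R :> R /\ `|a1| + 4 <= Num.sqrt n%:R.
    by move: h; rewrite ge_max => /andP[].
  by apply: le_trans h2 _; rewrite -[leRHS]sqr_sqrtr ?(ltW np) // expr2 ler_peMr // (le_trans ler01).
have ys : saddle n = q * Num.sqrt n%:R by exact: saddleE.
have y1 : 1 <= saddle n.
  rewrite ys mulrC -ler_pdivrMr //; near: n; exact: near_sqrt_ge.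
have c2 : 2 <= b * saddle n / 2.
  have : 4 / (b * q) <= Num.sqrt n%:R by near: n; exact: near_sqrt_ge.
  rewrite ler_pdivrMr ?mulr_gt0 // => h; rewrite ys ler_pdivlMr //.
  by apply: le_trans (_ : 4 <= _); [lra|rewrite mulrA [b * q * _]mulrC].
have sn0 : 0 < Num.sqrt n%:R :> R by rewrite sqrtr_gt0.
have y0 : 0 < saddle n by lra.
pose l0 := ln (saddle n); have l0E : expR l0 = saddle n by rewrite lnK ?posrE.
have nE : n%:R = b * expR l0 ^+ 2 / 2.
  rewrite l0E sqr_sqrtr; first by field; rewrite gt_eqF.
  by rewrite divr_ge0 ?(ltW b0) // mulr_ge0 // ltW.
have [vp Hp hp] := HP _ c2; have [vg Hg hg] := HG _ c2.
pose s := 2 * n%:R + a1 + 1.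
pose P := Gamma s * b `^ (- s) * expR (- ((a1 - a2) * l0) - 2 * (b * saddle n / 2)).
have P0 : 0 < P.
  have s0 : 0 < s.
    rewrite /s -addrA addr_gt0 ?mulr_gt0 //; have := a11; lra.
  exact: mulr_gt0 (mulr_gt0 (Gamma_gt0 s0) (powR_gt0 _ b0)) (expR_gt0 _).
have cG := @continuous_gauss_sh2 R (b * saddle n / 2).
have fp0 x : 0 <= expR (- (b * saddle n / 2) * sh2 x ^+ 2) * outer_profile (a1 - a2) b x.
  by rewrite mulr_ge0 ?expR_ge0.
have cfp : continuous (fun x => expR (- (b * saddle n / 2) * sh2 x ^+ 2) * outer_profile (a1 - a2) b x).
  by move=> x; apply: cvgM; [exact: cG|exact: continuous_outer_profile].
have fg0 x : 0 <= expR (- (b * saddle n / 2) * sh2 x ^+ 2) * expR ((4 + `|a1 - a2|) * `|x|).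
  by rewrite mulr_ge0 ?expR_ge0.
have cfg : continuous (fun x => expR (- (b * saddle n / 2) * sh2 x ^+ 2) * expR ((4 + `|a1 - a2|) * `|x|)).
  move=> x; apply: cvgM; first exact: cG.
  apply: (@continuous_comp _ _ _ (fun x : R => (4 + `|a1 - a2|) * `|x|)); last exact: continuous_expR.
  by apply: cvgM; [exact: cvg_cst|exact: (cvg_norm (@cvg_id _ _))].
have HT := has_integralZ P (has_integral_shift l0 cfp fp0 Hp).
have HE := has_integralZ (P * (C' / saddle n)) (has_integral_shift l0 cfg fg0 Hg).
pose J h := (\int[mu]_l (kernel_pos n a1 l * logGammaF 1 b (l + h))%:E)%E.
pose F h := fine ((kernel_pos n a2 h)%:E * J h)%E.
have FE h : exists2 v, ((kernel_pos n a2 h)%:E * J h)%E = (F h)%:E /\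
    F h = kernel_pos n a2 h * (expR (h - b * expR h / 2) * v) &
  `|v - Gamma s * (b * expR h) `^ (- s) * expR (- ((b * expR h) ^+ 2 / (16 * n%:R)))|
    <= Gamma s * (b * expR h) `^ (- s) * (Ci * ((b * expR h) / n%:R
      + (b * expR h) ^+ 4 / n%:R ^+ 3 + (b * expR h) ^+ 2 * Num.sqrt n%:R / n%:R ^+ 2)).
  have [v Hv hv] := HI n an _ (mulr_gt0 b0 (expR_gt0 h)).
  by exists v => //; rewrite /F /J (integral_kernel_pos_logGammaF n0 Hv).
have mFE : measurable_fun setT F.
  apply/measurable_EFinP; apply: eq_measurable_fun mF => h _.
  by have [v []] := FE h.
have bound h : `|F h - P * (expR (- (b * saddle n / 2) * sh2 (h - l0) ^+ 2) * outer_profile (a1 - a2) b (h - l0))|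
    <= P * (C' / saddle n) * (expR (- (b * saddle n / 2) * sh2 (h - l0) ^+ 2) * expR ((4 + `|a1 - a2|) * `|h - l0|)).
  have [v [_ ->] hv] := FE h.
  have y1' : 1 <= expR l0 by rewrite l0E.
  have := @outer_pointwise R n a1 a2 b Ci l0 (h - l0) v b0 Ci0 a11 n0 nE y1'.
  by rewrite subrK l0E; apply.
have [v Hv hv] := has_integral_near mFE HT HE bound.
exists v.
  apply: etrans Hv.2; apply: eq_integral => h _.
  by have [w []] := FE h.
have -> : kernel_lead n = P * (E0 * Num.sqrt (pi / (b * saddle n / 2))) by [].
have sq0 : 0 < Num.sqrt (pi / (b * saddle n / 2)).
  by rewrite sqrtr_gt0 divr_gt0 ?pi_gt0 //; lra.
move: (Num.sqrt (pi / _)) sq0 hp hg => sq sq0 hp hg.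
move: hv hp; rewrite ys in y0 *; move: (Num.sqrt n%:R) sn0 y0 => sn sn0 y0 hv hp.
have PC0 : 0 <= P * (C' / (q * sn)) := mulr_ge0 (ltW P0) (divr_ge0 C'0 (ltW y0)).
have h1 : `|v - P * vp| <= P * (C' / (q * sn)) * (Cg * sq).
  apply: le_trans hv _; apply: ler_wpM2l => //; apply: le_trans hg; exact: ler_norm.
have h2 : `|P * vp - P * (E0 * sq)| <= P * (Cp / (b * (q * sn) / 2) * sq).
  by rewrite -mulrBr normrM (ger0_norm (ltW P0)) ler_wpM2l // ltW.
have PE0 : 0 < P * (E0 * sq) := mulr_gt0 P0 (mulr_gt0 E00 sq0).
have -> : v / (P * (E0 * sq)) - 1 = ((v - P * vp) + (P * vp - P * (E0 * sq))) / (P * (E0 * sq)).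
  by rewrite subrKA mulrBl mulfV // gt_eqF.
rewrite normrM normfV (gtr0_norm PE0) ler_pdivrMr //.
apply: le_trans (ler_normD _ _) _; apply: le_trans (lerD h1 h2) _.
rewrite le_eqVlt; apply/orP; left; apply/eqP.
by field; rewrite ?(gt_eqF sq0, gt_eqF P0, gt_eqF E00, gt_eqF q0, gt_eqF sn0, gt_eqF b0).
Unshelve. all: end_near. Qed.
End outer_integral.

(** * Asymptotics of the linear form *)

Section difference_asymptotics.
Context {R : realType}.
Local Notation mu := (@lebesgue_measure R).
Variables (a1 a2 b : R).
Let al := a1 - a2.
Hypotheses (a11 : -1 < a1) (a21 : -1 < a2) (b0 : 0 < b).

Lemma kernel_leadE n : (0 < n)%N ->
  kernel_lead a1 a2 b n = Gamma_ratio a1 (2 * n) * (2 * n)`!%:R * expR (- (2 * n%:R * ln b))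
   * expR (a1 * ln 2 - (a1 + 1) * ln b - al / 2 * (ln 2 - ln b) - 3 * b / 8
      + ln pi / 2 - ln b / 4 + ln 2 / 4 + (a1 - al / 2 - 1 / 4) * ln n%:R - Num.sqrt (2 * b * n%:R)).
Proof.
move=> n0; have np : 0 < n%:R :> R by rewrite ltr0n.
have f0 : 0 < ((2 * n)`!)%:R :> R by rewrite ltr0n fact_gt0.
have n2 : (2 * n)%:R = 2 * n%:R :> R by rewrite natrM.
have y0 : 0 < saddle b n by rewrite sqrtr_gt0 divr_gt0 // mulr_gt0.
have lnS : ln (saddle b n) = (ln 2 + ln n%:R - ln b) / 2.
  by rewrite /saddle sqrt_lnE ?divr_gt0 ?mulr_gt0 // expRK ln_div ?posrE ?mulr_gt0 // lnM ?posrE.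
have bS : b * saddle b n = Num.sqrt (2 * b * n%:R).
  rewrite -[X in X * _](ger0_norm (ltW b0)) -sqrtr_sqr -sqrtrM ?sqr_ge0 //; congr Num.sqrt.
  by field; rewrite gt_eqF.
have bs0 : 0 < b * saddle b n by rewrite mulr_gt0.
have lnB : ln (pi / (b * saddle b n / 2)) = ln pi - (ln b / 2 + ln n%:R / 2 - ln 2 / 2) :> R.
  rewrite ln_div ?posrE ?pi_gt0 ?divr_gt0 // ln_div ?posrE // lnM ?posrE // lnS; by field.
rewrite /kernel_lead /Gamma_ratio sqrt_lnE ?divr_gt0 ?pi_gt0 // lnB lnS bS n2.
have -> : 2 * n%:R + a1 + 1 = 2 * n%:R + 1 + a1 :> R by ring.
set G := Gamma _.
rewrite !powR_lnE ?mulr_gt0 // lnM ?posrE //.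
set E1 := expR (a1 * _).
have e1 : 0 < E1 by exact: expR_gt0.
have -> : G / (E1 * (2 * n)`!%:R) * (2 * n)`!%:R = G * E1^-1.
  by field; rewrite !gt_eqF.
rewrite /E1 -expRN -!mulrA -!expRD; congr (_ * expR _); rewrite /al; by field.
Qed.

(** From x^(2 n) / (2 n)! <= e^x at x = b e: the extra e leaves a factor e^(2 n), which outweighs
    e^(-sqrt(2 b n)). *)
Lemma fact_ge_expR n : expR (- (b * expR 1)) * expR (2 * n%:R) <= (2 * n)`!%:R * expR (- (2 * n%:R * ln b)).
Proof.
have K0 : 0 <= b * expR 1 by rewrite mulr_ge0 ?expR_ge0 // ltW.
have f0 : 0 < ((2 * n)`!)%:R :> R by rewrite ltr0n fact_gt0.
have h : (b * expR 1) ^+ (2 * n) / (2 * n)`!%:R <= expR (b * expR 1).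
  case: n f0 => [|n] f0; first by rewrite muln0 expr0 fact0 divr1 -[X in X <= _]expR0 ler_expR.
  have -> : (2 * n.+1 = (2 * n).+1.+1)%N by lia.
  by apply: le_trans (expR_ge1Dxn (2 * n).+1 K0); rewrite -[_ <= _]/(_ <= 1 + _) lerDr.
rewrite ler_pdivrMr // in h.
have e2 : (b * expR 1) ^+ (2 * n) = expR (2 * n%:R * ln b) * expR (2 * n%:R).
  rewrite exprMn -[X in X ^+ _](lnK (_ : b \is Num.pos)) ?posrE // -!expRM_natl natrM mulr1 //.
rewrite e2 in h.
rewrite -(ler_pM2l (expR_gt0 (b * expR 1))) -(ler_pM2r (expR_gt0 (2 * n%:R * ln b))).
rewrite (mulrA (expR (b * expR 1))) -expRD subrr expR0 mul1r.
rewrite [leRHS](_ : _ = expR (b * expR 1) * (2 * n)`!%:R); first by rewrite [leLHS]mulrC.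
by rewrite -!mulrA -expRD addNr expR0 mulr1.
Qed.

(** Makes the bounded remainder [r] of [kernel_identity] negligible. *)
Lemma kernel_lead_inv : exists C : R, \forall n \near \oo,
  0 < kernel_lead a1 a2 b n /\ (kernel_lead a1 a2 b n)^-1 <= C / Num.sqrt n%:R.
Proof.
have [Cr HCr] := Gamma_ratio_asymp a11.
have [C1 HC1] := asymp1_distP (asymp1_comp_double (ex_intro _ Cr HCr)).
pose k1 : R := a1 - al / 2 - 1 / 4.
pose k0 : R := a1 * ln 2 - (a1 + 1) * ln b - al / 2 * (ln 2 - ln b) - 3 * b / 8
      + ln pi / 2 - ln b / 4 + ln 2 / 4.
exists (2 * expR (b * expR 1) * expR (- k0)); near=> n.
have n0 : (0 < n)%N by near: n; exact: nbhs_infty_gt.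
have np : 0 < n%:R :> R by rewrite ltr0n.
have s0 : 0 < Num.sqrt n%:R :> R by rewrite sqrtr_gt0.
have h1 : `|Gamma_ratio a1 (2 * n) - 1| <= C1 / Num.sqrt n%:R by near: n.
have h2 : C1 / Num.sqrt n%:R <= 1 / 2.
  have : 2 * C1 <= Num.sqrt n%:R by near: n; exact: near_sqrt_ge.
  by rewrite ler_pdivrMr // => h; lra.
have h3 : (2 * `|k1| + Num.sqrt (2 * b) + 1) / 2 <= Num.sqrt n%:R by near: n; exact: near_sqrt_ge.
have G12 : 1 / 2 <= Gamma_ratio a1 (2 * n).
  have : `|Gamma_ratio a1 (2 * n) - 1| <= 1 / 2 by exact: le_trans h2.
  by rewrite ler_norml => /andP[]; lra.
rewrite kernel_leadE // -/k0 -/k1.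
have ff := fact_ge_expR n.
have s2 : Num.sqrt n%:R ^+ 2 = n%:R :> R by rewrite sqr_sqrtr // ltW.
have sB : Num.sqrt (2 * b * n%:R) = Num.sqrt (2 * b) * Num.sqrt n%:R.
  by rewrite sqrtrM // mulr_ge0 // ltW.
have l0 : 0 <= ln (n%:R : R) by rewrite ln_ge0 // ler1n.
have lnn : ln (n%:R : R) <= 2 * Num.sqrt n%:R.
  have -> : ln (n%:R : R) = 2 * ln (Num.sqrt n%:R) by rewrite -{1}s2 lnXn // mulr_natl.
  rewrite ler_wpM2l //.
  have := @le_ln1Dx R (Num.sqrt n%:R - 1); rewrite subrKC => h; apply: le_trans (h _) _; lra.
have low : expR k0 * expR (Num.sqrt n%:R) <= expR (2 * n%:R) *
    expR (k0 + k1 * ln n%:R - Num.sqrt (2 * b * n%:R)).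
  rewrite -!expRD ler_expR sB.
  have h4 : - (k1 * ln n%:R) <= `|k1| * (2 * Num.sqrt n%:R).
    apply: le_trans (ler_norm _) _; rewrite normrN normrM (ger0_norm l0) ler_wpM2l //.
  have h5 : (2 * `|k1| + Num.sqrt (2 * b) + 1) * Num.sqrt n%:R <= 2 * Num.sqrt n%:R ^+ 2.
    by rewrite expr2 mulrA ler_wpM2r ?(ltW s0) // -ler_pdivrMl // mulrC.
  rewrite s2 in h5; move: h4 h5; clear.
  move: (k1 * _) (`|k1|) (Num.sqrt (2 * b)) (Num.sqrt n%:R) => u v w s h4 h5; lra.
set Y := expR (k0 + k1 * ln n%:R - Num.sqrt (2 * b * n%:R)) in low *.
set FF := (2 * n)`!%:R * expR (- (2 * n%:R * ln b)) in ff *.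
have Y0 : 0 < Y by exact: expR_gt0.
have FF0 : 0 < FF by rewrite mulr_gt0 ?expR_gt0 // ltr0n fact_gt0.
have -> : Gamma_ratio a1 (2 * n) * (2 * n)`!%:R * expR (- (2 * n%:R * ln b)) * Y
   = Gamma_ratio a1 (2 * n) * FF * Y by rewrite /FF; ring.
have g0 : 0 < Gamma_ratio a1 (2 * n) by apply: lt_le_trans G12; rewrite divr_gt0.
have X0 : 0 < Gamma_ratio a1 (2 * n) * FF * Y := mulr_gt0 (mulr_gt0 g0 FF0) Y0.
split => //.
have ge : 1 / 2 * (expR (- (b * expR 1)) * (expR k0 * expR (Num.sqrt n%:R))) <= Gamma_ratio a1 (2 * n) * FF * Y.
  rewrite -[leRHS]mulrA; apply: ler_pM; rewrite ?mulr_ge0 ?expR_ge0 //.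
  apply: le_trans (ler_wpM2r (ltW Y0) ff); rewrite -[leRHS]mulrA ler_wpM2l ?expR_ge0 //.
have s_e : Num.sqrt n%:R <= expR (Num.sqrt n%:R) :> R.
  by apply: le_trans (expR_ge1Dx _); rewrite lerDr.
have lb0 : 0 < 1 / 2 * (expR (- (b * expR 1)) * (expR k0 * expR (Num.sqrt n%:R))).
  by rewrite !mulr_gt0 ?expR_gt0.
apply: (@le_trans _ _ (1 / 2 * (expR (- (b * expR 1)) * (expR k0 * expR (Num.sqrt n%:R))))^-1).
  by rewrite lef_pV2.
rewrite !invfM -!expRN !opprK -[leRHS]mulrA -[leRHS]mulrA.
rewrite [X in X * _ <= _](_ : _ = 2); last by rewrite invr1 mul1r invrK.
rewrite ler_wpM2l // ler_wpM2l ?expR_ge0 // ler_wpM2l ?expR_ge0 // expRN lef_pV2 ?posrE ?expR_gt0 //.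
Unshelve. all: end_near. Qed.
End difference_asymptotics.

Section difference_limit.
Context {R : realType}.
Local Notation mu := (@lebesgue_measure R).
Variables (a1 a2 b : R).
Let al := a1 - a2.
Hypotheses (alZ : forall m : int, al != m%:~R) (a11 : -1 < a1) (a21 : -1 < a2) (b0 : 0 < b).

Lemma sqr_neq_nat_sqr (m : nat) : al ^+ 2 != m%:R ^+ 2.
Proof.
rewrite eqf_sqr negb_or (alZ m) /=.
by have := alZ (- m%:Z); rewrite mulrNz.
Qed.

Definition kernel_value n : R := - b `^ (- (2 * n%:R + 1)) / (al * sine_prod al n)
  * (Gamma (a2 + 1) * b `^ (- a2) * qR n a1 a2 b - Gamma (a1 + 1) * b `^ (- a1) * qR n a2 a1 b).

Lemma kernel_value_asymp : asymp1 (fun n => kernel_value n / kernel_lead a1 a2 b n).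
Proof.
have [C HC] := kernel_integral_asymp a2 a11 b0.
have [D HD] := kernel_lead_inv a11 a21 b0.
apply: (@asymp1_dist _ _ (C + b^-1 * D)); near=> n.
have n2 : (2 <= n)%N by near: n; exact: nbhs_infty_ge.
have [L0 Li] : 0 < kernel_lead a1 a2 b n /\ (kernel_lead a1 a2 b n)^-1 <= D / Num.sqrt n%:R by near: n.
have [mF [r rb rE]] := kernel_identity alZ a11 a21 b0 n2 (sine_prod_neq0 n sqr_neq_nat_sqr).
have [v vE hv] : exists2 v, (\int[mu]_h ((kernel_pos n a2 h)%:E
    * \int[mu]_l (kernel_pos n a1 l * logGammaF 1 b (l + h))%:E) = v%:E)%E &
  `|v / kernel_lead a1 a2 b n - 1| <= C / Num.sqrt n%:R.
  move: mF; near: n; exact: HC.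
rewrite vE -/(kernel_value n) in rE; case: rE => rE.
have -> : kernel_value n / kernel_lead a1 a2 b n - 1
   = (v / kernel_lead a1 a2 b n - 1) - r / kernel_lead a1 a2 b n by rewrite rE; ring.
apply: le_trans (ler_normB _ _) _; rewrite mulrDl; apply: lerD => //.
have /andP[r0 r1] := rb.
rewrite ger0_norm ?divr_ge0 ?(ltW L0) // -mulrA; apply: ler_pM => //.
by rewrite invr_ge0 ltW.
Unshelve. all: end_near. Qed.

(** [kernel_value] is the linear form times an explicit factor in which al [sine_prod al n] tends to
    sin (pi al) / pi. This brings the sine into [c1], and its argument a2 - a1 accounts for the
    minus sign of [kernel_value]. *)
Lemma q_difference_asymp : asymp1 (fun n =>
  (qR n a1 a2 b * ((Gamma (a2 + 1) / b `^ a2) / (Gamma (a1 + 1) / b `^ a1)) - qR n a2 a1 b)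
  / (((2 * n)`!)%:R * (expR (- Num.sqrt (2 * b * n%:R)) / n%:R `^ (1 / 4 - (a1 + a2) / 2))
     * c1 a1 a2 b)).
Proof.
have [sin0 [C HC]] := sine_prod_asymp sqr_neq_nat_sqr.
have au : asymp1 (fun n => sine_prod al n * (pi * al) / sin (pi * al)).
  exists `|C|; near=> n.
  have [h1 h2] : 0 < sine_prod al n * (pi * al) / sin (pi * al) /\
    `|ln (sine_prod al n * (pi * al) / sin (pi * al))| <= C / n%:R by near: n.
  split => //; apply: le_trans h2 _.
  have n0 : (0 < n)%N by near: n; exact: nbhs_infty_gt.
  have np : 0 < n%:R :> R by rewrite ltr0n.
  have s0 : 0 < Num.sqrt n%:R :> R by rewrite sqrtr_gt0.
  apply: (@le_trans _ _ (`|C| / n%:R)).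
    by rewrite ler_wpM2r ?invr_ge0 ?(ltW np) // ler_norm.
  by rewrite ler_wpM2l // lef_pV2 ?posrE // sqrt_nat_le.
have aG : asymp1 (fun n => Gamma_ratio a1 (2 * n)).
  have [Cr HCr] := Gamma_ratio_asymp a11.
  by have := asymp1_comp_double (ex_intro _ Cr HCr).
apply: asymp1_near (asymp1M (asymp1M au kernel_value_asymp) aG).
have [D HD] := kernel_lead_inv a11 a21 b0.
near=> n.
have n0 : (0 < n)%N by near: n; exact: nbhs_infty_gt.
have np : 0 < n%:R :> R by rewrite ltr0n.
have [L0 _] : 0 < kernel_lead a1 a2 b n /\ (kernel_lead a1 a2 b n)^-1 <= D / Num.sqrt n%:R by near: n.
have f0 : 0 < ((2 * n)`!)%:R :> R by rewrite ltr0n fact_gt0.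
have G1 : 0 < Gamma (a1 + 1) by apply: Gamma_gt0; have := a11; lra.
have G2 : 0 < Gamma (a2 + 1) by apply: Gamma_gt0; have := a21; lra.
have S0 : sine_prod al n != 0 by exact: sine_prod_neq0 sqr_neq_nat_sqr.
have al0 : al != 0 by exact: (alZ 0).
have pi0 := pi_gt0 R.
have sE : sin (pi * (a2 - a1)) = - sin (pi * al) by rewrite -sinN /al; congr sin; ring.
move: L0; rewrite kernel_leadE // => L0.
rewrite /kernel_value /c1 /c2 sE !powR_lnE // (sqrt_lnE pi0).
move: L0; rewrite -/al.
set GR := Gamma_ratio _ _; set E := expR (_ + _ * ln n%:R - _).
set B2 := expR (- (2 * n%:R * ln b)); set B1 := expR (- (_ + 1) * ln b).
set es := expR (- Num.sqrt _); set Np := expR (_ * ln n%:R).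
set T := expR (_ * ln 2); set A1 := expR (a1 * ln b); set A2 := expR (a2 * ln b).
set NA1 := expR (- a1 * ln b); set NA2 := expR (- a2 * ln b).
set DD := expR ((a2 - a1) * ln b); set FF := expR ((1 / 4 + _) * ln b).
set H := expR (3 * b / 8); set J := expR (ln pi / 2).
move=> L0.
(* Writing 2 and pi as exponentials turns this into a linear identity between logarithms. *)
have key : pi * B1 * es * 2 * T = Np * A1 * B2 * E * DD * FF * H * J.
  have -> : pi * B1 * es * 2 * T = expR (ln pi) * B1 * es * expR (ln 2) * T by rewrite !lnK ?posrE.
  by rewrite -!expRD; congr expR; rewrite /al; field.
have NA1E : NA1 = A1^-1 by rewrite /NA1 /A1 mulNr expRN.
have NA2E : NA2 = A2^-1 by rewrite /NA2 /A2 mulNr expRN.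
have [Np0 A10 B20 DD0] : [/\ 0 < Np, 0 < A1, 0 < B2 & 0 < DD] by rewrite !expR_gt0.
have [FF0 H0 J0 A20] : [/\ 0 < FF, 0 < H, 0 < J & 0 < A2] by rewrite !expR_gt0.
have [B10 es0 T0] : [/\ 0 < B1, 0 < es & 0 < T] by rewrite !expR_gt0.
have EE : E = pi * B1 * es * 2 * T / (Np * A1 * B2 * DD * FF * H * J).
  by rewrite key; field; rewrite ?gt_eqF.
have GR0 : GR != 0.
  by apply: contraTneq L0 => ->; rewrite !mul0r ltxx.
rewrite EE NA1E NA2E.
move: sin0 al0 S0 {L0 EE key NA1E NA2E}.
move: (qR n a1 a2 b) (qR n a2 a1 b) (sin _) (sine_prod _ _) => q12 q21 sn Sp sin0 al0 S0.
move: (Gamma (a1 + 1)) (Gamma (a2 + 1)) ((2 * n)`!%:R : R) G1 G2 f0 => Ga1 Ga2 f G1 G2 f0.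
move: (pi : R) pi0 => p pi0.
field; repeat (apply/andP; split); by [exact: sin0|exact: al0|exact: S0|exact: GR0|rewrite gt_eqF].
Unshelve. all: end_near. Qed.
End difference_limit.

Theorem theorem1 (R : realType) (a1 a2 b : rat)
    (ha : a1 - a2 \isn't a Num.int) (ha1 : -1 < a1) (ha2 : -1 < a2)
    (hb : 0 < b) :
  let A1 : R := ratr a1 in
  let A2 : R := ratr a2 in
  let B : R := ratr b in
  [/\ forall n : nat, exists P : {poly int}, forall x : rat,
        (mu (a2 - a1) n)%:R * (mu a2 (2 * n))%:R * q n a1 a2 x
        = (n`!)%:R * (map_poly intr P).[x],
      exists2 delta : nat -> R,
        delta =O_\oo (fun n : nat => n%:R `^ (- (1 / 2)) : R) &
        \forall n \near \oo,
          ratr (q n a1 a2 b)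
            * ((Gamma (A2 + 1) / B `^ A2) / (Gamma (A1 + 1) / B `^ A1))
            - ratr (q n a2 a1 b)
          = ((2 * n)`!)%:R
            * (expR (- Num.sqrt (2 * B * n%:R))
               / n%:R `^ (1 / 4 - (A1 + A2) / 2))
            * (c1 A1 A2 B + delta n)
    & exists2 delta : nat -> R,
        delta =O_\oo (fun n : nat => n%:R `^ (- (1 / 2)) : R) &
        \forall n \near \oo,
          ratr (q n a1 a2 b)
          = ((2 * n)`!)%:R
            * (expR (Num.sqrt (2 * B * n%:R))
               / n%:R `^ (1 / 4 - (A1 + A2) / 2))
            * (c2 A1 A2 B + delta n)].
Proof.
move=> A1 A2 B.
have rN1 : -1 = ratr (-1) :> R by rewrite rmorphN rmorph1.
have A11 : -1 < A1 by rewrite rN1 ltr_rat.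
have A21 : -1 < A2 by rewrite rN1 ltr_rat.
have B0 : 0 < B by rewrite /B ltr0q.
have alZ (m : int) : A1 - A2 != m%:~R.
  apply: contra ha => /eqP e.
  have /eqP : ratr (a1 - a2) = ratr m%:~R :> R by rewrite rmorphB e ratr_int.
  rewrite (inj_eq (fmorph_inj _)) => /eqP ->; exact: intr_int.
have GA1 : 0 < Gamma (A1 + 1) by apply: Gamma_gt0; lra.
have GA2 : 0 < Gamma (A2 + 1) by apply: Gamma_gt0; lra.
have c20 : c2 A1 A2 B != 0.
  rewrite /c2 mulf_neq0 ?invr_neq0 ?gt_eqF ?powR_gt0 //.
  by rewrite 3?mulr_gt0 ?powR_gt0 ?expR_gt0 ?sqrtr_gt0 ?pi_gt0 // GA2.
(* [c1] is nonzero because the sine product already showed that sin (pi al) does not vanish. *)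
have c10 : c1 A1 A2 B != 0.
  have [sin0 _] := sine_prod_asymp (sqr_neq_nat_sqr alZ).
  have -> : c1 A1 A2 B = - (2 * sin (pi * (A1 - A2)) * Gamma (A2 + 1)
      / (B `^ (A2 - A1) * Gamma (A1 + 1)) * c2 A1 A2 B).
    have sE : sin (pi * (A2 - A1)) = - sin (pi * (A1 - A2)) by rewrite -sinN; congr sin; ring.
    by rewrite /c1 sE; ring.
  rewrite oppr_eq0; apply: mulf_neq0 c20; apply: mulf_neq0.
    by apply: mulf_neq0; [exact: mulf_neq0|rewrite gt_eqF].
  by rewrite invr_eq0 mulf_neq0 // gt_eqF // powR_gt0.
have prefE (s : R) : \forall n \near \oo, ((2 * n)`!)%:R
    * (expR (s * Num.sqrt (2 * B * n%:R)) / n%:R `^ (1 / 4 - (A1 + A2) / 2)) != 0.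
  near=> n; rewrite gt_eqF // mulr_gt0 ?ltr0n ?fact_gt0 // divr_gt0 ?expR_gt0 //.
  rewrite powR_gt0 // ltr0n; near: n; exact: nbhs_infty_gt.
split.
- by move=> n; exact: q_integrality.
- apply: asymp1_bigO => //.
    by near=> n; rewrite -mulN1r; near: n; exact: prefE.
  apply: asymp1_near (q_difference_asymp alZ A11 A21 B0); near=> n.
  by rewrite !ratr_q.
- apply: asymp1_bigO => //.
    by near=> n; rewrite -[X in expR X]mul1r; near: n; exact: prefE.
  apply: asymp1_near (q_asymp A1 A21 B0); near=> n.
  by rewrite ratr_q.
Unshelve. all: end_near. Qed.
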